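(* For $n=2$, the nonnegative typical ranks of $\mathbb{R}_+^{2\times 2\times 2}$ are exactly all integers $m$ with $2\le m\le 4$. For $n=3$, the nonnegative typical ranks of $\mathbb{R}_+^{3\times 3\times 3}$ are exactly all integers $m$ with $5\le m\le 9$. For $n\ge 4$, the nonnegative typical ranks of $\mathbb{R}_+^{n\times n\times n}$ are exactly all integers $m$ with $$\left\lceil \frac{n^3}{3n-2}\right\rceil\le m\le n^2 .$$
   Context: $\mathbb{R}_+^{n\times n\times n}$ is the set of real $n\times n\times n$ hypermatrices (elements of $\mathbb{R}^n\otimes\mathbb{R}^n\otimes\mathbb{R}^n$) with nonnegative entries. The nonnegative rank $\operatorname{rank}_+(A)$ of $A\in\mathbb{R}_+^{n\times n\times n}$ is the minimum number $r$ such that $A=\sum_{i=1}^r u_i\otimes v_i\otimes w_i$ with $u_i,v_i,w_i\in\mathbb{R}^n$ having nonnegative entries. An integer $r$ is a nonnegative typical rank of $\mathbb{R}_+^{n\times n\times n}$ if $\{A\in\mathbb{R}_+^{n\times n\times n}:\operatorname{rank}_+(A)=r\}$ contains a nonempty (Euclidean) open subset of $\mathbb{R}^{n\times n\times n}$. *)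

(* Defs.v *)
From mathcomp Require Export all_boot all_order all_algebra.
From mathcomp Require Export all_classical all_reals all_analysis.
Export Order.TTheory GRing.Theory Num.Theory numFieldNormedType.Exports.

Set Implicit Arguments.
Unset Strict Implicit.
Unset Printing Implicit Defensive.

Local Open Scope classical_set_scope.
Local Open Scope ring_scope.

(* The entry (i, j, k) of A is A 0 i j k. The topology of nested matrices is   *)
(* that of entrywise convergence, i.e., the Euclidean topology on R^(n*n*n).   *)
Notation hypermatrix R n := 'rV['M[R]_n]_n.

Definition nonneg_vec (R : realType) (n : nat) (u : 'rV[R]_n) : Prop :=
  forall i, 0 <= u 0 i.

Definition nonneg_hypermatrix (R : realType) (n : nat)
    (A : hypermatrix R n) : Prop :=
  forall i j k, 0 <= A 0 i j k.

Definition outer (R : realType) (n : nat) (u v w : 'rV[R]_n) :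
    hypermatrix R n :=
  \row_i \matrix_(j, k) (u 0 i * v 0 j * w 0 k).

Definition nonneg_decomposable (R : realType) (n : nat)
    (A : hypermatrix R n) (r : nat) : Prop :=
  exists u v w : 'I_r -> 'rV[R]_n,
    (forall i, [/\ nonneg_vec (u i), nonneg_vec (v i) & nonneg_vec (w i)]) /\
    A = \sum_(i < r) outer (u i) (v i) (w i).

(* rank_+ as a relation: every nonnegative A has exactly one such r.           *)
Definition is_nonneg_rank (R : realType) (n : nat)
    (A : hypermatrix R n) (r : nat) : Prop :=
  nonneg_decomposable A r /\
  forall s : nat, nonneg_decomposable A s -> (r <= s)%N.

Definition nonneg_typical_rank (R : realType) (n r : nat) : Prop :=
  exists U : set (hypermatrix R n),
    [/\ open U, U !=set0 &
        U `<=` [set A | nonneg_hypermatrix A /\ is_nonneg_rank A r]].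

(* Main.v *)
(* Upper end: A = sum_(i, j) e_i (x) e_j (x) A_(i, j) gives rank_+ <= n^2, and near the
   tensor of the Latin square i + j mod n two unit entries cannot share a rank-one term,
   so that n^2 terms are needed. Lower end: a sum of m terms has m (3n - 2) parameters, so
   no box is filled if m (3n - 2) < n^3; for n = 3 the vanishing of Strassen's 9 x 9
   determinant also excludes m = 4.

   In between, perturb the n^2 terms of the Latin square so that all entries are positive
   and the differential of the sum of the first m terms is onto. Then the sums of m nearby
   terms fill a box, and each of them has rank_+ exactly m: with fewer terms, adding the
   other n^2 - m ones would give a tensor near the Latin square of rank_+ < n^2.

   That the differential is onto for some m points means that no nonzero trilinear form T
   has T(., v, w) = T(u, ., w) = T(u, v, .) = 0 at each of the m points (u, v, w) (this is
   Lickteig's theorem on the generic rank). Such points are found with few coordinates: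
   these are cut into a base block and blocks of size 3, and each point lives on at most
   two blocks, except for one or two points on each of some groups of one or three blocks
   (superblocks). The vanishing of T is then local: it follows from 18 configurations of
   bounded size, which are checked by elimination modulo 31, and the local conditions hold
   together because each of them holds off a hypersurface of the parameter space. *)

From Stdlib Require Import BinNat.
From HB Require Import structures.
Require Import Defs.
From mathcomp Require Import zify ring lra.

Set Implicit Arguments.
Unset Strict Implicit.
Unset Printing Implicit Defensive.

(** * Trilinear forms annihilated by points *)

Section Forms.
Local Open Scope ring_scope.

(** The obstacle is the count. For n >= 4 at most the rounded-up value of n^3/(3n-2) = n^2/3 + 2n/9
    + 4/27 + ... may be spent, so less than one point may be wasted. With n = beta + 3N, the terms
    that involve N are 3N^2 + 2 beta N + 2N/3. Three points per block, six per pair of blocks and 2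
    beta per block for its link with the base block make 3N^2 + 2 beta N, which leaves 2N/3 spare
    points. Three blocks with two spares meet this rate exactly; a single block with one spare
    exceeds it by 1/3; the base block rounds up its own share, to 2, 4, 7, 36 points for beta = 2,
    3, 4, 10. The total excess stays below 1 except for beta = 4 with two single blocks, that is,
    for n = 1 modulo 9; this is why those n have a base block of size 10. *)

Definition slot (X : Type) (s : nat) (T : nat -> nat -> nat -> X) x y z :=
  match s with 0%N => T x y z | 1%N => T y x z | _ => T y z x end.

(** The indices [(s == 0)] and [2 - (s == 2)] are the two slots other than [s], in increasing
    order. *)
Definition pairing (A : pzRingType) (n : nat) (p : nat -> nat -> A)
    (T : nat -> nat -> nat -> A) s x :=
  \sum_(y < n) \sum_(z < n)
    p (s == 0)%N y * p (2 - (s == 2))%N z * slot s T x y z.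

(** The form annihilates the tangent space at the point (u, v, w) to the cone of rank-one tensors,
    which consists of the sums of tensors x (x) v (x) w, u (x) y (x) w and u (x) v (x) z. *)
Definition kills (A : pzRingType) n (p : nat -> nat -> A) T :=
  forall s x, (s < 3)%N -> (x < n)%N -> pairing n p T s x = 0.

Definition vanishes_off (A : pzRingType) (D : nat -> nat -> nat -> bool)
    (T : nat -> nat -> nat -> A) :=
  forall x y z, ~~ D x y z -> T x y z = 0.

Definition determined (A : pzRingType) (P : eqType) n (S : seq P)
    (D : nat -> nat -> nat -> bool) (p : P -> nat -> nat -> A) :=
  forall T, vanishes_off D T -> (forall t, t \in S -> kills n (p t) T) ->
  forall x y z, (x < n)%N -> (y < n)%N -> (z < n)%N -> T x y z = 0.

Section SystemMatrix.
Variables (P : eqType) (n : nat) (S : seq P) (D : nat -> nat -> nat -> bool).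
Let cell := ('I_n * 'I_n * 'I_n)%type.
Let equation := ('I_(size S) * 'I_3 * 'I_n + cell)%type.

Definition coef (A : pzRingType) (p : nat -> nat -> A) (s x a b c : nat) :=
  match s with
  | 0%N => (a == x)%:R * (p 1%N b * p 2 c)
  | 1%N => (b == x)%:R * (p 0%N a * p 2 c)
  | _ => (c == x)%:R * (p 0%N a * p 1%N b)
  end.

(** The rows [inr d] express that the form vanishes off [D]; thus every region gives a matrix of the
    same shape, with one column per cell. *)
Definition sysmx (A : pzRingType) (p : P -> nat -> nat -> A) :
    'M[A]_(#|{: equation}|, #|{: cell}|) :=
  \matrix_(i, j) let: (a, b, c) := (enum_val j : cell) in
    match (enum_val i : equation) with
    | inl (t, s, x) => coef (p (tnth (in_tuple S) t)) s x a b c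
    | inr d => (~~ D a b c)%:R * (d == enum_val j :> cell)%:R
    end.

Lemma sum_cell (A : nmodType) (f : cell -> A) :
  \sum_(d : cell) f d = \sum_(j < #|{: cell}|) f (enum_val j).
Proof. exact: (reindex (fun j : 'I_#|{: cell}| => enum_val j) (onW_bij _ (enum_val_bij _))). Qed.

Lemma pairing_coef (A : comPzRingType) (p : nat -> nat -> A) T s x :
  (s < 3)%N -> (x < n)%N ->
  pairing n p T s x =
  \sum_(d : cell) coef p s x d.1.1 d.1.2 d.2 * T d.1.1 d.1.2 d.2.
Proof.
move=> s3 xn; rewrite -(pair_bigA _ (fun (d : 'I_n * 'I_n) (c : 'I_n) =>
  coef p s x d.1 d.2 c * T d.1 d.2 c)) /=.
rewrite -(pair_bigA _ (fun (a b : 'I_n) =>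
  \sum_(c < n) coef p s x a b c * T a b c)) /=.
pose x' := Ordinal xn.
have sel (F : 'I_n -> A) : \sum_(i < n) (i == x :> nat)%:R * F i = F x'.
  rewrite (bigD1 x') //= eqxx mul1r big1 ?addr0 // => i.
  by rewrite -val_eqE /= => /negPf->; rewrite mul0r.
case: s s3 => [|[|[|//]]] _; rewrite /pairing /=.
- rewrite -[LHS](sel (fun a => \sum_(b < n) \sum_(c < n) p 1%N b * p 2 c * T a b c)).
  apply: eq_bigr => a _; rewrite mulr_sumr; apply: eq_bigr => b _.
  by rewrite mulr_sumr; apply: eq_bigr => c _; rewrite !mulrA.
- apply: eq_bigr => a _.
  rewrite -[LHS](sel (fun b => \sum_(c < n) p 0%N a * p 2 c * T a b c)).
  by apply: eq_bigr => b _; rewrite mulr_sumr; apply: eq_bigr => c _; rewrite !mulrA.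
- apply: eq_bigr => a _; apply: eq_bigr => b _.
  rewrite -[LHS](sel (fun c => p 0%N a * p 1%N b * T a b c)).
  by apply: eq_bigr => c _; rewrite !mulrA.
Qed.

Lemma sysmxP (A : comPzRingType) (p : P -> nat -> nat -> A) :
  determined n S D p <-> (forall x : 'cV_#|{: cell}|, sysmx p *m x = 0 -> x = 0).
Proof.
split=> [det x Mx0|det T T0 kT a b c an bn cn].
  pose T a b c : A := if insub a is Some a' then if insub b is Some b' then
    if insub c is Some c' then x (enum_rank (a', b', c')) 0 else 0 else 0 else 0.
  have TE (d : cell) : T d.1.1 d.1.2 d.2 = x (enum_rank d) 0.
    by case: d => -[a b] c; rewrite /T /= !insubT /= ?ltn_ord // => ? ? ?;
      congr (x (enum_rank (_, _, _)) _); apply: val_inj.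
  have Tn a b c : ~~ [&& a < n, b < n & c < n]%N -> T a b c = 0.
    by rewrite /T; (case: insubP => //= a' -> _); (case: insubP => //= b' -> _);
      case: insubP => //= c' ->.
  have rowE i : \sum_j sysmx p i j * x j 0 = 0 by have /matrixP/(_ i 0) := Mx0; rewrite !mxE.
  have T0 : vanishes_off D T.
    move=> a b c Dn; case: (boolP [&& a < n, b < n & c < n]%N) => [|/Tn//].
    case/and3P=> an bn cn; pose d : cell := (Ordinal an, Ordinal bn, Ordinal cn).
    have := rowE (enum_rank (inr d)); rewrite (bigD1 (enum_rank d)) //= mxE !enum_rankK /=.
    rewrite Dn eqxx !mul1r -TE /= big1 ?addr0 // => j jd.
    rewrite mxE enum_rankK; case E: (enum_val j) => [[a' b'] c'].
    have /negPf-> : d != (a', b', c') by rewrite -E; apply: contraNneq jd => ->; rewrite enum_valK.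
    by rewrite mulr0 mul0r.
  have kT t : t \in S -> kills n (p t) T.
    move=> tS s y s3 yn; rewrite pairing_coef //.
    have iS : (index t S < size S)%N by rewrite index_mem.
    rewrite -[RHS](rowE (enum_rank (inl (Ordinal iS, Ordinal s3, Ordinal yn)))).
    rewrite sum_cell; apply: eq_bigr => j _; rewrite mxE enum_rankK TE enum_valK.
    case: (enum_val j) => -[a b] c /=.
    by rewrite (tnth_nth t) /= nth_index.
  apply/matrixP => j j0; rewrite ord1 mxE -(enum_valK j) -TE.
  by apply: det => //.
pose x : 'cV[A]_#|{: cell}| := \col_j let: (a, b, c) := (enum_val j : cell) in T a b c.
suff /det x0 : sysmx p *m x = 0.
  have := congr1 (fun y : 'cV_#|{: cell}| =>
    y (enum_rank (Ordinal an, Ordinal bn, Ordinal cn)) 0) x0.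
  by rewrite !mxE enum_rankK.
apply/matrixP => i j0; rewrite ord1 !mxE.
case E: (enum_val i) => [[[t s] y]|d].
  rewrite -[RHS](kT (tnth (in_tuple S) t) (mem_tnth _ _) s y) ?ltn_ord // pairing_coef //.
  rewrite sum_cell.
  by apply: eq_bigr => j _; rewrite !mxE E; case: (enum_val j) => -[a' b'] c'.
rewrite big1 // => j _; rewrite !mxE E; case: (enum_val j) => -[a' b'] c' /=.
by case: (boolP (D a' b' c')) => [_|/T0->]; rewrite ?mulr0 ?mul0r.
Qed.

Lemma map_sysmx (A B : pzRingType) (f : {rmorphism A -> B}) (p : P -> nat -> nat -> A) :
  map_mx f (sysmx p) = sysmx (fun t s x => f (p t s x)).
Proof.
apply/matrixP => i j; rewrite !mxE; case: (enum_val j) => -[a b] c.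
case: (enum_val i) => [[[t s] y]|d]; last by rewrite rmorphM !rmorph_nat.
by rewrite /coef; case: (nat_of_ord s) => [|[|?]]; rewrite !rmorphM rmorph_nat.
Qed.
End SystemMatrix.

(** * Maximal minors, and the passage from a prime field to characteristic 0 *)

Section TrivialKernel.

(** A nonzero minor is a polynomial witness of full column rank: it can be reduced modulo a prime
    and followed along a line. *)
Lemma trivial_kernel_minor (F : fieldType) r c (M : 'M[F]_(r, c)) :
  (forall x : 'cV_c, M *m x = 0 -> x = 0) <->
  exists g : 'I_c -> 'I_r, \det (rowsub g M) != 0.
Proof.
split=> [kM|[g dg] x Mx].
  have fM : row_full M.
    rewrite -sub1mx submxE mul1mx; apply/eqP/matrixP => i j.
    have /kM/matrixP/(_ i 0) : M *m col j (cokermx M) = 0.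
      by rewrite colE mulmxA mulmx_coker mul0mx.
    by rewrite !mxE.
  by exists (fullrankfun fM); rewrite -unitfE -unitmxE fullrowsub_unit.
have : rowsub g M *m x = 0 by rewrite mul_rowsub_mx Mx; apply/matrixP => ? ?; rewrite !mxE.
by move/(congr1 (mulmx (invmx (rowsub g M)))); rewrite mulKmx ?mulmx0 // unitmxE unitfE.
Qed.

(** The points have integer coordinates, so the minor is an integer; being nonzero modulo [q], it is
    nonzero, also in characteristic 0. *)
Lemma determined_lift (F : numFieldType) q (P : eqType) n (S : seq P) D
    (p : P -> nat -> nat -> nat) : prime q ->
  determined n S D (fun t s x => (p t s x)%:R : 'F_q) ->
  determined n S D (fun t s x => (p t s x)%:R : F).
Proof.
move=> q_pr /sysmxP/trivial_kernel_minor[g dg].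
apply/sysmxP/trivial_kernel_minor; exists g.
pose M := sysmx n S D (fun t s x => (p t s x)%:R : int).
have ME (B : comNzRingType) (f : {rmorphism int -> B}) :
    \det (rowsub g (sysmx n S D (fun t s x => (p t s x)%:R : B))) = f (\det (rowsub g M)).
  rewrite -det_map_mx map_mxsub map_sysmx; congr (\det (rowsub _ _)).
  by apply/matrixP => i j; rewrite !mxE; case: (enum_val j) => -[a b] c;
     case: (enum_val i) => [[[t s] y]|d] //; rewrite /coef !rmorph_nat.
rewrite (ME F intr) intr_eq0; apply: contraNneq dg => d0.
by rewrite (ME 'F_q intr) d0 rmorph0.
Qed.
End TrivialKernel.

End Forms.

(** * Properties that hold off a hypersurface *)

Section Generic.
Local Open Scope ring_scope.
Variables (F : numFieldType) (P : eqType).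
Let param := P -> nat -> nat -> F.
Implicit Types (p q : param) (V Q : param -> Prop) (f : param -> F).

Definition segment p q (a : F) : param :=
  fun t s x => p t s x + a * (q t s x - p t s x).

(** The space [param] has infinitely many coordinates. Polynomiality is asked along lines only,
    which suits arguments that join two witnesses. *)
Definition line_poly f := forall p q, exists h : {poly F}, forall a,
  f (segment p q a) = h.[a].

Definition line_closed V := forall p q a, V p -> V q -> V (segment p q a).

(* Q holds on the complement in V of a proper Zariski-closed set *)
Definition generic V Q := exists f,
  [/\ line_poly f, exists2 p, V p & f p != 0
    & forall p, V p -> f p != 0 -> Q p].

Lemma segment0 p q : segment p q 0 = p.
Proof. by do 3!apply/funext => ?; rewrite /segment mul0r addr0. Qed.

Lemma segment1 p q : segment p q 1 = q.
Proof. by do 3!apply/funext => ?; rewrite /segment mul1r addrC subrK. Qed.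

Lemma nonroot (h : {poly F}) (x : nat -> F) : injective x -> h != 0 ->
  exists i, h.[x i] != 0.
Proof.
move=> x_inj h0; apply/not_existsP => H.
have rts : all (root h) [seq x i | i <- iota 0 (size h)].
  by apply/allP => _ /mapP[i _ ->]; apply/rootP/eqP/negPn/negP/H.
have := max_poly_roots h0 rts; rewrite map_inj_uniq ?iota_uniq // => /(_ isT).
by rewrite size_map size_iota ltnn.
Qed.

(** Both polynomials restrict to nonzero ones on the line that joins the two witnesses, so their
    product is nonzero at some natural number on it. *)
Lemma generic_conj V Q1 Q2 : line_closed V -> generic V Q1 -> generic V Q2 ->
  generic V (fun p => Q1 p /\ Q2 p).
Proof.
move=> Vl [f [fl [p Vp fp] fQ]] [g [gl [q Vq gq] gQ]].
exists (fun p => f p * g p); split.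
- move=> a b; have [h1 h1E] := fl a b; have [h2 h2E] := gl a b.
  by exists (h1 * h2) => c; rewrite hornerM h1E h2E.
- have [h1 h1E] := fl p q; have [h2 h2E] := gl p q.
  have h10 : h1 != 0 by apply: contraNneq fp => h0; rewrite -(segment0 p q) h1E h0 horner0.
  have h20 : h2 != 0 by apply: contraNneq gq => h0; rewrite -(segment1 p q) h2E h0 horner0.
  have ninj : injective (fun i : nat => i%:R : F) by move=> i j /eqP; rewrite eqr_nat => /eqP.
  have [i] := nonroot ninj (mulf_neq0 h10 h20).
  rewrite hornerM -h1E -h2E => fg; exists (segment p q i%:R) => //; exact: Vl.
- move=> r Vr; rewrite mulf_eq0 negb_or => /andP[fr gr].
  by split; [exact: fQ|exact: gQ].
Qed.

Lemma generic_imp V Q1 Q2 : (forall p, V p -> Q1 p -> Q2 p) -> generic V Q1 -> generic V Q2.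
Proof.
by move=> Q12 [f [fl fn fQ]]; exists f; split=> // p Vp fp; apply: Q12 => //; apply: fQ.
Qed.

Lemma generic_all V (X : eqType) (s : seq X) (Q : X -> param -> Prop) :
  line_closed V -> (exists p, V p) -> (forall x, x \in s -> generic V (Q x)) ->
  generic V (fun p => forall x, x \in s -> Q x p).
Proof.
move=> Vl Vn; elim: s => [_|x s IH sQ].
  have [p Vp] := Vn; exists (fun=> 1); split=> [a b||] //.
  - by exists 1 => c; rewrite hornerC.
  - by exists p => //; rewrite oner_neq0.
have Qx := sQ x (mem_head _ _).
have /IH Qs : forall y, y \in s -> generic V (Q y).
  by move=> y ys; apply: sQ; rewrite in_cons ys orbT.
apply: generic_imp (generic_conj Vl Qx Qs) => p _ [Qxp Qsp] y.
by rewrite in_cons => /predU1P[->|/Qsp].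
Qed.

Lemma generic_ex V Q : generic V Q -> exists2 p, V p & Q p.
Proof. by case=> f [_ [p Vp fp] fQ]; exists p => //; exact: fQ. Qed.

Lemma generic_near V Q p : line_closed V -> generic V Q -> V p ->
  exists2 q, V q & forall d, 0 < d -> exists a, [/\ 0 < a, a < d & Q (segment p q a)].
Proof.
move=> Vl [f [fl [q Vq fq] fQ]] Vp; exists q => // d d0.
have [h hE] := fl p q.
have h0 : h != 0 by apply: contraNneq fq => h0; rewrite -(segment1 p q) hE h0 horner0.
(* The candidates d/2, d/3, ... all lie strictly between 0 and [d]. *)
have xinj : injective (fun i : nat => d / i.+2%:R).
  move=> i j /(mulfI (lt0r_neq0 d0))/invr_inj/eqP.
  by rewrite eqr_nat => /eqP[].
have [i hi] := nonroot xinj h0.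
exists (d / i.+2%:R); split; first by rewrite divr_gt0 ?ltr0Sn.
  by rewrite ltr_pdivrMr ?ltr0Sn // ltr_pMr // ltr1n.
apply: fQ; first exact: Vl.
by rewrite hE.
Qed.

Lemma line_poly_det r c (M : param -> 'M[F]_(r, c)) (g : 'I_c -> 'I_r) :
  (forall i j, line_poly (fun p => M p i j)) -> line_poly (fun p => \det (rowsub g (M p))).
Proof.
move=> Ml p q.
have /fin_all_exists[h hE] (ij : 'I_r * 'I_c) : exists h : {poly F},
    forall a, M (segment p q a) ij.1 ij.2 = h.[a] by exact: Ml.
exists (\det (\matrix_(i, j) h (g i, j))) => a.
rewrite -[RHS]/(horner_eval a _) -det_map_mx; congr (\det _).
by apply/matrixP => i j; rewrite !mxE; exact: (hE (g i, j)).
Qed.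

Lemma line_poly_sysmx n (S : seq P) D i j : line_poly (fun p => sysmx n S D p i j).
Proof.
move=> p q.
have lin t s x : exists h : {poly F}, forall a, segment p q a t s x = h.[a].
  exists ((p t s x)%:P + 'X * (q t s x - p t s x)%:P) => a.
  by rewrite !hornerE.
case Ej: (enum_val j) => [[a b] c]; case Ei: (enum_val i) => [[[t s] x]|d]; last first.
  exists ((~~ D a b c)%:R * (d == (a, b, c))%:R)%:P => e.
  by rewrite mxE Ej Ei hornerC.
pose h (s y : nat) := sval (cid (lin (tnth (in_tuple S) t) s y)).
have hE s' y e : segment p q e (tnth (in_tuple S) t) s' y = (h s' y).[e].
  exact: (svalP (cid (lin (tnth (in_tuple S) t) s' y))).
exists (coef h s x a b c) => e; rewrite mxE Ej Ei /coef.
by case: (nat_of_ord s) => [|[|?]]; rewrite !hornerM !hE -polyC_natr hornerC.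
Qed.

(** One witness suffices: the minor that is nonzero there serves as the polynomial. *)
Lemma generic_determined V n (S : seq P) D p : V p -> determined n S D p ->
  generic V (determined n S D).
Proof.
move=> Vp /sysmxP/trivial_kernel_minor[g dg].
exists (fun p => \det (rowsub g (sysmx n S D p))); split.
- by apply: line_poly_det => i j; exact: line_poly_sysmx.
- by exists p.
- by move=> q _ dq; apply/sysmxP/trivial_kernel_minor; exists g.
Qed.
End Generic.

(** * Certified elimination modulo 31 *)

Inductive residue :=
  | r0 | r1 | r2 | r3 | r4 | r5 | r6 | r7 | r8 | r9
  | r10 | r11 | r12 | r13 | r14 | r15 | r16 | r17 | r18 | r19
  | r20 | r21 | r22 | r23 | r24 | r25 | r26 | r27 | r28 | r29
  | r30.

Definition nat_of_residue (a : residue) : nat :=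
  match a with
  | r0 => 0 | r1 => 1 | r2 => 2 | r3 => 3 | r4 => 4 | r5 => 5
  | r6 => 6 | r7 => 7 | r8 => 8 | r9 => 9 | r10 => 10 | r11 => 11
  | r12 => 12 | r13 => 13 | r14 => 14 | r15 => 15 | r16 => 16 | r17 => 17
  | r18 => 18 | r19 => 19 | r20 => 20 | r21 => 21 | r22 => 22 | r23 => 23
  | r24 => 24 | r25 => 25 | r26 => 26 | r27 => 27 | r28 => 28 | r29 => 29
  | r30 => 30
  end.

Definition residue_of_nat (k : nat) : residue :=
  nth r0 [:: r0; r1; r2; r3; r4; r5; r6; r7; r8; r9; r10; r11;
    r12; r13; r14; r15; r16; r17; r18; r19; r20; r21; r22; r23;
    r24; r25; r26; r27; r28; r29; r30] (k %% 31).

Lemma nat_of_residueK : cancel nat_of_residue residue_of_nat.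
Proof. by case. Qed.

HB.instance Definition _ := Equality.copy residue (can_type nat_of_residueK).

Definition residue_goal (a : residue) : Type := residue.

Ltac residue_table :=
  match goal with |- residue_goal ?a => let b := eval vm_compute in a in exact b end.

(* Tactic-generated tables, so that each operation reduces in two steps. *)
Definition rmul (a b : residue) : residue.
Proof.
change (residue_goal (residue_of_nat (nat_of_residue a * nat_of_residue b))).
destruct a, b; residue_table.
Defined.

Definition radd (a b : residue) : residue.
Proof.
change (residue_goal (residue_of_nat (nat_of_residue a + nat_of_residue b))).
destruct a, b; residue_table.
Defined.

Definition ropp (a : residue) : residue.
Proof.
change (residue_goal (residue_of_nat (31 - nat_of_residue a))).
destruct a; residue_table.
Defined.

(** By Fermat's little theorem, the inverse of a nonzero residue modulo 31 is its 29th power. *)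
Definition rinv (a : residue) : residue.
Proof.
change (residue_goal
  (residue_of_nat (iter 29 (fun b => (b * nat_of_residue a) %% 31) 1))).
destruct a; residue_table.
Defined.

Definition is_r0 (a : residue) := if a is r0 then true else false.

Arguments rmul : simpl never.
Arguments radd : simpl never.
Arguments ropp : simpl never.
Arguments rinv : simpl never.

Section ResidueField.
Local Open Scope ring_scope.

Definition rval (a : residue) : 'F_31 := (nat_of_residue a)%:R.

Lemma Fp31_mod k : (k %% 31)%N%:R = k%:R :> 'F_31.
Proof. exact: Fp_nat_mod. Qed.

Lemma rval_mul a b : rval (rmul a b) = rval a * rval b.
Proof.
have H : nat_of_residue (rmul a b) = ((nat_of_residue a * nat_of_residue b) %% 31)%N.
  by case: a; case: b.
by rewrite /rval H Fp31_mod natrM.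
Qed.

Lemma rval_add a b : rval (radd a b) = rval a + rval b.
Proof.
have H : nat_of_residue (radd a b) = ((nat_of_residue a + nat_of_residue b) %% 31)%N.
  by case: a; case: b.
by rewrite /rval H Fp31_mod natrD.
Qed.

Lemma rval_inv a : is_r0 a = false -> rval (rinv a) * rval a = 1.
Proof.
have H : is_r0 a = false -> rmul (rinv a) a = r1 by case: a.
by move/H => E; rewrite -rval_mul E.
Qed.

Lemma rval_is0 a : is_r0 a -> rval a = 0.
Proof. by case: a. Qed.

Lemma rval_of_nat k : rval (residue_of_nat k) = k%:R.
Proof.
rewrite /rval /residue_of_nat -[RHS]Fp31_mod; congr (_%:R).
move: (k %% 31)%N (ltn_pmod k (isT : 0 < 31)%N) => m.
by do 31!(case: m => [//|m]).
Qed.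
End ResidueField.

(** * Sparse rows as binary tries, with keys in lexicographic order ([false] first) *)

Inductive trie (A : Type) := Empty | Leaf (a : A) | Node (l r : trie A).
Arguments Empty {A}.

(** Empty subtrees are collapsed, so that cancelled entries take no space. *)
Definition node A (l r : trie A) :=
  match l, r with Empty, Empty => Empty | _, _ => Node l r end.

Definition leaf (a : residue) := if a is r0 then Empty else Leaf a.

Fixpoint lookup A (t : trie A) (k : bitseq) : option A :=
  match t, k with
  | Leaf a, [::] => Some a
  | Node l r, b :: k => if b then lookup r k else lookup l k
  | _, _ => None
  end.

Fixpoint single A (k : bitseq) (a : A) : trie A :=
  match k with
  | [::] => Leaf a
  | b :: k => if b then Node Empty (single k a) else Node (single k a) Empty
  end.

Fixpoint store A (t : trie A) (k : bitseq) (a : A) : trie A :=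
  match k, t with
  | b :: k', Node l r => if b then Node l (store r k' a) else Node (store l k' a) r
  | _, _ => single k a
  end.

Fixpoint scale (c : residue) (t : trie residue) : trie residue :=
  match t with
  | Empty => Empty
  | Leaf a => Leaf (rmul c a)
  | Node l r => Node (scale c l) (scale c r)
  end.

Fixpoint axpy (c : residue) (s t : trie residue) : trie residue :=
  match s, t with
  | Empty, _ => t
  | _, Empty => scale c s
  | Leaf a, Leaf b => leaf (radd (rmul c a) b)
  | Node l r, Node l' r' => node (axpy c l l') (axpy c r r')
  | _, _ => t
  end.

Fixpoint lead (t : trie residue) : option (bitseq * residue) :=
  match t with
  | Empty => None
  | Leaf a => if is_r0 a then None else Some ([::], a)
  | Node l r =>
    match lead l with
    | Some (k, a) => Some (false :: k, a)
    | None => match lead r with Some (k, a) => Some (true :: k, a) | None => None end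
    end
  end.

(* Row reduction; a row stored under the key k has leading coefficient 1 at k. *)
Fixpoint reduce (fuel : nat) (st : trie (trie residue)) (row : trie residue) :=
  if fuel is fuel'.+1 then
    match lead row with
    | None => st
    | Some (k, a) =>
      match lookup st k with
      | None => store st k (scale (rinv a) row)
      | Some piv => reduce fuel' st (axpy (ropp a) piv row)
      end
    end
  else st.

Section TrieSemantics.
Local Open Scope ring_scope.
Implicit Types (X : bitseq -> 'F_31).

Fixpoint teval (t : trie residue) X : 'F_31 :=
  match t with
  | Empty => 0
  | Leaf a => rval a * X [::]
  | Node l r => teval l (fun k => X (false :: k)) + teval r (fun k => X (true :: k))
  end.

(** All leaves at one depth: this invariant excludes the default case of [axpy], which would drop a
    summand. *)
Fixpoint depth A (d : nat) (t : trie A) {struct t} : bool :=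
  match t, d with
  | Empty, _ => true
  | Leaf _, 0%N => true
  | Node l r, d.+1 => depth d l && depth d r
  | _, _ => false
  end.

Fixpoint zero_after (k : bitseq) X : Prop :=
  match k with
  | [::] => True
  | false :: k => zero_after k (fun k => X (false :: k)) /\
      forall q, size q = size k -> X (true :: q) = 0
  | true :: k => zero_after k (fun k => X (true :: k))
  end.

Lemma teval_node l r X : teval (node l r) X = teval (Node l r) X.
Proof. by case: l r => [|?|? ?] [|?|? ?] //=; rewrite addr0. Qed.

Lemma teval_leaf a X : teval (leaf a) X = rval a * X [::].
Proof. by case: a => //; rewrite (@rval_is0 r0) // mul0r. Qed.

Lemma teval_scale c t X : teval (scale c t) X = rval c * teval t X.
Proof.
by elim: t X => [|a|l IHl r IHr] X /=; rewrite ?mulr0 ?rval_mul ?mulrA ?IHl ?IHr ?mulrDr.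
Qed.

Lemma teval_axpy d c s t X : depth d s -> depth d t ->
  teval (axpy c s t) X = rval c * teval s X + teval t X.
Proof.
elim: s d t X => [|a|l IHl r IHr] d [|b|l' r'] X; rewrite ?teval_scale /= ?mulr0 ?addr0 ?add0r //.
- by case: d => // _ _; rewrite teval_leaf rval_add rval_mul mulrDl mulrA.
- by case: d.
- by case: d.
- by case: d => // d /andP[ld rd] /andP[ld' rd']; rewrite teval_node /= (IHl d) // (IHr d) // mulrDr addrACA.
Qed.

Lemma depth_node A d (l r : trie A) : depth d l -> depth d r -> depth d.+1 (node l r).
Proof. by case: l r => [|?|? ?] [|?|? ?] //= *; apply/andP. Qed.

Lemma depth_scale d c t : depth d (scale c t) = depth d t.
Proof. by elim: t d => [|a|l IHl r IHr] [|d] //=; rewrite IHl IHr. Qed.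

Lemma depth_leaf a : depth 0 (leaf a).
Proof. by case: a. Qed.

Lemma depth_axpy d c s t : depth d s -> depth d t -> depth d (axpy c s t).
Proof.
elim: s d t => [|a|l IHl r IHr] d t; first by case: t.
  case: t => [|b|l r]; [by rewrite /axpy depth_scale| |by case: d].
  by case: d => // _ _; apply: depth_leaf.
case: t => [|b|l' r'].
- by move=> dlr _; change (depth d (scale c (Node l r))); rewrite depth_scale.
- by case: d => [|d] // _.
by case: d => [//|d] /andP[ld rd] /andP[ld' rd']; apply: depth_node; [apply: IHl|apply: IHr].
Qed.

Lemma depth_single A (k : bitseq) (a : A) : depth (size k) (single k a).
Proof. by elim: k => [|[] k IH] //=; rewrite ?andbT. Qed.

Lemma teval_single k a X : teval (single k a) X = rval a * X k.
Proof. by elim: k X => [|[] k IH] X //=; rewrite ?add0r ?addr0 IH. Qed.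

Lemma zero_after_teval d t X : depth d t -> (forall q, size q = d -> X q = 0) -> teval t X = 0.
Proof.
elim: t d X => [|a|l IHl r IHr] [|d] X //=; first by move=> _ ->; rewrite ?mulr0.
case/andP=> ld rd X0; rewrite (IHl d) ?(IHr d) ?addr0 // => q qd; apply: X0; rewrite /= qd //.
Qed.

Lemma lead_noneP d t X : depth d t -> lead t = None -> teval t X = 0.
Proof.
elim: t d X => [|a|l IHl r IHr] [|d] X //=.
  by case: (boolP (is_r0 a)) => // /rval_is0-> _ _; rewrite mul0r.
case/andP=> ld rd; case El: (lead l) => [[]|] //; case Er: (lead r) => [[]|] // _.
by rewrite (IHl d) // (IHr d) // addr0.
Qed.

Lemma leadP d t k a : depth d t -> lead t = Some (k, a) ->
  [/\ size k = d, is_r0 a = false & forall X, zero_after k X -> teval t X = rval a * X k].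
Proof.
elim: t d k a => [|b|l IHl r IHr] [|d] k a //=.
  by case: (boolP (is_r0 b)) => // /negPf b0 _ [<- <-].
case/andP=> ld rd; case El: (lead l) => [[kl al]|].
  have [skl al0 E] := IHl _ _ _ ld El.
  move=> [<- <-]; split=> [||X /= [za X0]] //; first by rewrite /= skl.
  by rewrite E // (zero_after_teval rd) ?addr0 // => q qd; apply: X0; rewrite skl.
case Er: (lead r) => [[kr ar]|] // [<- <-].
have [skr ar0 E] := IHr _ _ _ rd Er.
by split=> [||X /= za] //; [rewrite /= skr|rewrite (lead_noneP _ ld El) add0r E].
Qed.

(** Induction on the keys from the last to the first; this is back substitution. *)
Lemma zero_after_ind d X : (forall k, size k = d -> zero_after k X -> X k = 0) ->
  forall k, size k = d -> X k = 0.
Proof.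
elim: d X => [|d IH] X H k kd; first by apply: H => //; move/size0nil: kd => ->.
have Ht q : size q = d -> X (true :: q) = 0.
  by apply: (IH (fun q => X (true :: q))) => q' q'd za; apply: H; rewrite //= q'd.
have Hf q : size q = d -> X (false :: q) = 0.
  apply: (IH (fun q => X (false :: q))) => q' q'd za; apply: H => /=; rewrite ?q'd.
    by [].
  by split=> // q2 q2d; apply: Ht.
by case: k kd => [//|[] k [kd]]; [apply: Ht|apply: Hf].
Qed.

Lemma lookup_single A (k q : bitseq) (a b : A) :
  lookup (single k a) q = Some b -> q = k /\ b = a.
Proof.
elim: k q => [|[] k IH] [|[] q] //=; first by case=> <-.
- by case/IH=> -> ->.
- by case/IH=> -> ->.
Qed.

Lemma lookup_store A (t : trie A) (k q : bitseq) (a b : A) :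
  lookup (store t k a) q = Some b -> (q = k /\ b = a) \/ lookup t q = Some b.
Proof.
elim: k t q => [|c k IH] t q.
  by case: t => [|?|? ?] E; left; apply: (@lookup_single _ [::]).
case: t => [|?|l r] E; try by left; apply: (@lookup_single _ (c :: k)).
by case: c q E => [] [|[] q] //= E; (try by right); (case/IH: E => [[-> ->]|?]; [by left|by right]).
Qed.

(** The last clause says that the row has leading coefficient 1 at [k], in the form that back
    substitution consumes. *)
Definition pivots_ok d X (st : trie (trie residue)) := forall k r, lookup st k = Some r ->
  [/\ depth d r, teval r X = 0 & forall Y, zero_after k Y -> teval r Y = Y k].

(** Each stored row is a combination of equations that hold at [X]. Running out of fuel loses an
    equation, which is harmless for soundness. *)
Lemma reduce_ok d X fuel st row : pivots_ok d X st -> depth d row -> teval row X = 0 ->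
  pivots_ok d X (reduce fuel st row).
Proof.
elim: fuel st row => [//|fuel IH] st row stX dr rX /=.
case El: (lead row) => [[k a]|//]; have [kd a0 aE] := leadP dr El.
case Ek: (lookup st k) => [piv|]; last first.
  move=> q r E; case: (lookup_store E) => [[-> ->]|/stX//]; rewrite depth_scale teval_scale rX mulr0.
  by split=> // Y /aE; rewrite teval_scale => ->; rewrite mulrA rval_inv ?mul1r.
have [dp pX _] := stX _ _ Ek.
by apply: IH; rewrite ?depth_axpy // (teval_axpy _ _ dp dr) pX rX mulr0 addr0.
Qed.
End TrieSemantics.

(** * The elimination and its soundness *)

Definition sparse (n : nat) (l : seq nat) : seq (nat * residue) :=
  [seq (i, residue_of_nat (nth 0 l i)) | i <- iota 0 n &
    ~~ is_r0 (residue_of_nat (nth 0 l i))].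

Section Elimination.
Variables (n : nat) (D : nat -> nat -> nat -> bool) (key : nat -> nat -> nat -> bitseq).

Definition equation_row (p : seq (seq (nat * residue))) s x : trie residue :=
  foldr (fun a t => foldr (fun b t =>
      if slot s D x a.1 b.1 then axpy r1 (single (slot s key x a.1 b.1) (rmul a.2 b.2)) t
      else t)
    t (nth [::] p (2 - (s == 2)))) Empty (nth [::] p (s == 0)).

Definition eliminate (pts : seq (seq (seq nat))) :=
  foldl (fun st p => let q := [seq sparse n l | l <- p] in
      foldl (fun st sx => reduce (n ^ 3 + 1) st (equation_row q sx.1 sx.2)) st
        [seq (s, x) | s <- iota 0 3, x <- iota 0 n])
    Empty pts.

Definition all_pivots (st : trie (trie residue)) :=
  all (fun x => all (fun y => all (fun z =>
    if D x y z then isSome (lookup st (key x y z)) else true)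
    (iota 0 n)) (iota 0 n)) (iota 0 n).

Definition point_coord (pts : seq (seq (seq nat))) t s x :=
  nth 0 (nth [::] (nth [::] pts t) s) x.

Section Soundness.
Local Open Scope ring_scope.
Variable d : nat.
Hypothesis size_key : forall x y z, (x < n)%N -> (y < n)%N -> (z < n)%N -> size (key x y z) = d.
Hypothesis key_inj : forall x y z x' y' z', (x < n)%N -> (y < n)%N -> (z < n)%N ->
  (x' < n)%N -> (y' < n)%N -> (z' < n)%N -> key x y z = key x' y' z' ->
  [/\ x = x', y = y' & z = z'].

Lemma sum_sparse l (g : nat -> 'F_31) :
  \sum_(e <- sparse n l) rval e.2 * g e.1 = \sum_(i < n) (nth 0%N l i)%:R * g i.
Proof.
rewrite big_map big_filter big_mkcond -(big_mkord xpredT (fun i => (nth 0%N l i)%:R * g i)).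
rewrite /index_iota subn0; apply: eq_bigr => i _ /=; rewrite -[in RHS]rval_of_nat.
by case: (boolP (is_r0 _)) => // /rval_is0->; rewrite mul0r.
Qed.

Lemma mem_sparse l e : e \in sparse n l -> (e.1 < n)%N.
Proof. by case/mapP=> i; rewrite mem_filter mem_iota => /andP[_ /= ni] ->. Qed.

Lemma size_slot s x y z : (x < n)%N -> (y < n)%N -> (z < n)%N -> size (slot s key x y z) = d.
Proof. by move=> xn yn zn; case: s => [|[|s]]; apply: size_key. Qed.

Lemma equation_row_ok (p : seq (seq nat)) s x X : (x < n)%N ->
  let q := [seq sparse n l | l <- p] in
  depth d (equation_row q s x) /\
  teval (equation_row q s x) X =
  \sum_(y < n) \sum_(z < n) (nth 0%N (nth [::] p (s == 0)%N) y)%:R *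
    (nth 0%N (nth [::] p (2 - (s == 2))%N) z)%:R *
    (if slot s D x y z then X (slot s key x y z) else 0).
Proof.
move=> xn q.
have sp k : nth [::] q k = sparse n (nth [::] p k).
  case: (ltnP k (size p)) => kp; first by rewrite (nth_map [::]).
  rewrite !nth_default ?size_map // /sparse.
  by rewrite (eq_filter (a2 := pred0)) ?filter_pred0 // => i; rewrite nth_nil.
rewrite /equation_row !sp.
set lv := nth _ p (s == 0)%N; set lw := nth _ p (2 - (s == 2))%N.
pose g (y z : nat) : 'F_31 := if slot s D x y z then X (slot s key x y z) else 0.
have inner (a : nat * residue) w t : {subset w <= sparse n lw} -> (a.1 < n)%N -> depth d t ->
  let t' := foldr (fun b t => if slot s D x a.1 b.1 then
      axpy r1 (single (slot s key x a.1 b.1) (rmul a.2 b.2)) t else t) t w in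
  depth d t' /\ teval t' X = \sum_(b <- w) rval a.2 * (rval b.2 * g a.1 b.1) + teval t X.
  elim: w => [|b w IH] /= ws an dt; first by rewrite big_nil add0r.
  have ws' : {subset w <= sparse n lw} by move=> e ew; apply: ws; rewrite in_cons ew orbT.
  have [d' E'] := IH ws' an dt.
  have bn : (b.1 < n)%N by apply: mem_sparse (ws _ (mem_head _ _)).
  rewrite big_cons /g; case: ifP => Ds; last by rewrite !mulr0 add0r.
  have dk : depth d (single (slot s key x a.1 b.1) (rmul a.2 b.2)).
    by rewrite -(size_slot s xn an bn) depth_single.
  split; first exact: depth_axpy.
  rewrite (teval_axpy _ _ dk d') E' teval_single !rval_mul.
  by rewrite (_ : rval r1 = 1) // mul1r addrA !mulrA.
have outer v : {subset v <= sparse n lv} ->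
  let t' := foldr (fun a t => foldr (fun b t => if slot s D x a.1 b.1 then
      axpy r1 (single (slot s key x a.1 b.1) (rmul a.2 b.2)) t else t) t (sparse n lw)) Empty v in
  depth d t' /\ teval t' X = \sum_(a <- v) rval a.2 * \sum_(b <- sparse n lw) rval b.2 * g a.1 b.1.
  elim: v => [|a v IH] /= vs; first by rewrite big_nil.
  have vs' : {subset v <= sparse n lv} by move=> e ev; apply: vs; rewrite in_cons ev orbT.
  have [d' E'] := IH vs'.
  have an : (a.1 < n)%N by apply: mem_sparse (vs _ (mem_head _ _)).
  have [d2 E2] := inner a (sparse n lw) _ (fun _ => id) an d'.
  by split=> //; rewrite E2 E' big_cons -mulr_sumr.
have [dr ->] := outer (sparse n lv) (fun _ => id); split=> //.
rewrite (sum_sparse lv (fun y => \sum_(b <- sparse n lw) rval b.2 * g y b.1)).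
apply: eq_bigr => y _; rewrite (sum_sparse lw (g y)) mulr_sumr.
by apply: eq_bigr => z _; rewrite mulrA.
Qed.

Lemma eliminate_ok pts X :
  (forall p s x, p \in pts -> (s < 3)%N -> (x < n)%N ->
     teval (equation_row [seq sparse n l | l <- p] s x) X = 0) ->
  pivots_ok d X (eliminate pts).
Proof.
rewrite /eliminate; set L := [seq (s, x) | s <- _, x <- _].
have : all (fun sx => (sx.1 < 3)%N && (sx.2 < n)%N) L.
  apply/allP => -[s x] /allpairsP[[s' x'] [/= s3 xn [-> ->]]] /=.
  by move: s3 xn; rewrite (mem_iota 0 3) mem_iota => /= -> ->.
move: L => L LP H; have : pivots_ok d X Empty by [].
elim: pts (Empty) H => [//|p pts IH] st H stX /=.
apply: IH => [q s x qp|]; first by apply: H; rewrite in_cons qp orbT.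
elim: L LP st stX => [//|[s x] l IHl] /= /andP[/andP[s3 xn] lP] st stX.
apply: IHl => //.
have [dr _] := equation_row_ok p s X xn.
by apply: reduce_ok => //; apply: H => //; rewrite mem_head.
Qed.

(** The form is read as an assignment [X] of values to keys, with 0 at keys of no admissible cell.
    It satisfies every stored row; since every admissible cell is a pivot, its values vanish one
    after the other, from the last key to the first. *)
Lemma all_pivots_determined pts : all_pivots (eliminate pts) ->
  determined n (iota 0 (size pts)) D (fun t s x => (point_coord pts t s x)%:R : 'F_31).
Proof.
move=> full T T0 kT.
pose X k := if [pick c : 'I_n * 'I_n * 'I_n | D c.1.1 c.1.2 c.2 && (key c.1.1 c.1.2 c.2 == k)]
  is Some c then T c.1.1 c.1.2 c.2 else 0.
have XE x y z : (x < n)%N -> (y < n)%N -> (z < n)%N ->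
    (if D x y z then X (key x y z) else 0) = T x y z.
  move=> xn yn zn; case: ifP => [Dc|/negbT/T0//]; rewrite /X; case: pickP => [[[a b] c] /=|].
    by case/andP=> _ /eqP/key_inj[] // -> -> ->.
  by move/(_ (Ordinal xn, Ordinal yn, Ordinal zn)); rewrite /= Dc eqxx.
have piv : pivots_ok d X (eliminate pts).
  apply: eliminate_ok => p s x pp s3 xn; have [_ ->] := equation_row_ok p s X xn.
  have tp : index p pts \in iota 0 (size pts) by rewrite mem_iota /= index_mem.
  rewrite -[RHS](kT _ tp s x s3 xn); apply: eq_bigr => y _; apply: eq_bigr => z _.
  rewrite /point_coord nth_index //; congr (_ * _).
  by case: s s3 => [|[|[|//]]] _ /=; rewrite XE.
have X0 : forall k, size k = d -> X k = 0.
  apply: zero_after_ind => k kd za; rewrite /X; case: pickP => [[[a b] c] /= /andP[Dc /eqP kE]|//].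
  have := full; move/allP/(_ a); rewrite mem_iota ltn_ord => /(_ isT)/allP/(_ b).
  rewrite mem_iota ltn_ord => /(_ isT)/allP/(_ c); rewrite mem_iota ltn_ord Dc => /(_ isT).
  case El: (lookup _ _) => [r|//] _; have [_ rX rE] := piv _ _ El.
  rewrite -XE ?ltn_ord // Dc -(rE X) ?rX //.
  by rewrite kE.
move=> x y z xn yn zn; rewrite -XE //; case: ifP => // _; apply: X0; exact: size_key.
Qed.
End Soundness.
End Elimination.

(** * Pseudo-random points and their certification *)

Definition block_list (sizes : seq nat) : seq nat :=
  flatten [seq nseq (nth 0 sizes b) b | b <- iota 0 (size sizes)].

Definition bits (k n : nat) : bitseq := [seq odd (n %/ 2 ^ i) | i <- rev (iota 0 k)].

(** Three bits for the block and two for the position in it: enough for 8 blocks of size at most 4.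
    That the codes are distinct and have five bits is checked by [certified]. *)
Definition code_list (sizes : seq nat) : seq bitseq :=
  flatten [seq [seq bits 3 b ++ bits 2 i | i <- iota 0 (nth 0 sizes b)]
             | b <- iota 0 (size sizes)].

(* Cells meeting many blocks come first: they occur in few equations. *)
Definition block_class (a b c : nat) : bitseq :=
  if eqn a b then [:: eqn b c; true] else [:: false; eqn b c || eqn a c].

Definition cell_key (bl : seq nat) (codes : seq bitseq) x y z : bitseq :=
  block_class (nth 0 bl x) (nth 0 bl y) (nth 0 bl z)
  ++ nth [::] codes x ++ nth [::] codes y ++ nth [::] codes z.

(** A linear congruential generator modulo the Fermat prime 2^16 + 1. Drawing the points reduces
    each certificate to a few parameters and a list of retries. *)
Definition lcg (s : N) : N := ((s * 75 + 74) mod 65537)%num.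

(* Pseudo-random residues on the blocks of sup; a draw beyond 30 counts as 0, so that a
   larger den gives sparser points. *)
Fixpoint draw (den : N) (sup bl : seq nat) (s : N) : seq nat * N :=
  if bl is b :: bl' then
    if has (eqn b) sup then
      let s' := lcg s in
      let a := (s' mod den)%num in
      let (l, s'') := draw den sup bl' s' in
      ((if (a <? 31)%num then nat_of_bin a else 0) :: l, s'')
    else let (l, s') := draw den sup bl' s in (0 :: l, s')
  else ([::], s).

Fixpoint draw_point (den : N) (bl : seq nat) (sups : seq (seq nat)) (s : N) : seq (seq nat) :=
  if sups is sup :: sups' then
    let (l, s') := draw den sup bl s in l :: draw_point den bl sups' s'
  else [::].

(* retries holds the number of rejected draws of each point; these numbers, den and seed
   were found by a search for systems of full rank with little fill-in. *)
Fixpoint draw_points (den seed : N) (bl : seq nat) (sups : seq (seq (seq nat)))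
    (retries : seq nat) (t : N) : seq (seq (seq nat)) :=
  match sups, retries with
  | sup :: sups', r :: retries' =>
    draw_point den bl sup ((t * 1009 + bin_of_nat r * 9973 + seed) mod 65537)%num
      :: draw_points den seed bl sups' retries' (t + 1)%num
  | _, _ => [::]
  end.

Definition certified (sizes : seq nat) (D : nat -> nat -> nat -> bool)
    (pts : seq (seq (seq nat))) : bool :=
  let n := sumn sizes in
  let bl := block_list sizes in
  let codes := code_list sizes in
  let D' x y z := D (nth 0 bl x) (nth 0 bl y) (nth 0 bl z) in
  let key := cell_key bl codes in
  [&& size codes == n, uniq codes, all (fun c => size c == 5) codes &
      all_pivots n D' key (eliminate n D' key pts)].

Lemma certified_determined (F : numFieldType) sizes D pts : certified sizes D pts ->
  let b := nth 0 (block_list sizes) in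
  determined (sumn sizes) (iota 0 (size pts)) (fun x y z => D (b x) (b y) (b z))
    (fun t s x => (point_coord pts t s x)%:R%R : F).
Proof.
case/and4P=> /eqP sz un c5 piv b; apply: (@determined_lift _ 31) => //.
have s5 x : (x < sumn sizes)%N -> size (nth [::] (code_list sizes) x) = 5.
  by move=> xn; apply/eqP; apply: (allP c5); rewrite mem_nth ?sz.
have size_class a c e : size (block_class a c e) = 2 by rewrite /block_class; case: ifP.
(* A key has 17 bits: two for the class of the cell and five for each of its three coordinates. *)
apply: (all_pivots_determined (d := 17) _ _ piv) => [x y z xn yn zn|x y z x' y' z' xn yn zn xn' yn' zn'].
  by rewrite /cell_key !size_cat size_class !s5.
have key_tail a c e : drop 2 (cell_key (block_list sizes) (code_list sizes) a c e) =
    nth [::] (code_list sizes) a ++ nth [::] (code_list sizes) c ++ nth [::] (code_list sizes) e.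
  by rewrite /cell_key drop_size_cat.
move/(congr1 (drop 2)); rewrite !key_tail // => /eqP.
rewrite eqseq_cat ?s5 // => /andP[ex]; rewrite eqseq_cat ?s5 // => /andP[ey ez].
by split; apply/eqP; rewrite -(nth_uniq [::] _ _ un) ?sz.
Qed.

(** * The finite configurations *)

(* A label (k, c, d, i) names the i-th point of kind k: k = 0 for the points of
   the base block, 1 for those of block c, 2 for those of the base block and
   block c, 3 for those of blocks c and d, 4 for the spare points of superblock c. *)
Definition label := (nat * nat * nat * nat)%type.

Definition base_labels (p : nat) : seq label := [seq (0, 0, 0, i) | i <- iota 0 p].
Definition single_labels (C : seq nat) : seq label :=
  [seq (1, c, 0, i) | c <- C, i <- iota 0 3].
Definition mixed_labels (k : nat) (C : seq nat) : seq label :=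
  [seq (2, c, 0, i) | c <- C, i <- iota 0 k].
Fixpoint ordered_pairs (C : seq nat) : seq (nat * nat) :=
  if C is c :: C' then [seq (c, d) | d <- C'] ++ ordered_pairs C' else [::].
Definition pair_labels (C : seq nat) : seq label :=
  [seq (3, e.1, e.2, i) | e <- ordered_pairs C, i <- iota 0 6].
Definition spare_labels (L : seq (nat * nat)) : seq label :=
  [seq (4, e.1, 0, i) | e <- L, i <- iota 0 e.2].

(* Blocks are numbered from 1, the base block being block 0. *)
Definition block_of (beta x : nat) : nat := if x < beta then 0 else ((x - beta) %/ 3).+1.

Definition fits (sb : nat -> nat) (l : label) (b : nat) : bool :=
  let: (k, c, d, _) := l in
  match k with
  | 0 => b == 0
  | 1 => b == c.+1
  | 2 => (b == 0) || (b == c.+1)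
  | 3 => (b == c.+1) || (b == d.+1)
  | _ => (b == 0) || (sb b.-1 == c)
  end.

(** A point that links the blocks [A] and [B] has one vector on [A], one on [B] and one on both; the
    index runs through the six distributions of these roles over the slots. *)
Definition order_support (i : nat) (A B : seq nat) : seq (seq nat) :=
  match i %% 6 with
  | 0 => [:: A; A ++ B; B] | 1 => [:: B; A ++ B; A]
  | 2 => [:: A; B; A ++ B] | 3 => [:: B; A; A ++ B]
  | 4 => [:: A ++ B; A; B] | _ => [:: A ++ B; B; A]
  end.

(* The base block is cut into pieces, of sizes zs; either zs is a singleton or
   zs is [:: 4; 3; 3]. *)
Definition base_support (zs : seq nat) (i : nat) : seq (seq nat) :=
  if (size zs <= 1) || (i < 7) then nseq 3 [:: 0]
  else if i < 10 then nseq 3 [:: 1]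
  else if i < 13 then nseq 3 [:: 2]
  else if i < 21 then order_support (i - 13) [:: 1] [:: 0]
  else if i < 29 then order_support (i - 21) [:: 2] [:: 0]
  else if i < 35 then order_support (i - 29) [:: 1] [:: 2]
  else nseq 3 [:: 0; 1; 2].

Definition mixed_support (zs : seq nat) (b i : nat) : seq (seq nat) :=
  if (size zs <= 1) || (i < 8) then order_support i [:: b] [:: 0]
  else if i < 14 then order_support (i - 8) [:: b] [:: 1]
  else order_support (i - 14) [:: b] [:: 2].

(** From index [full] on, a mixed point is spread over base block and block in all three slots. The
    value 99 exceeds every index; with [full = 3] and a base block of size 2, the last of the four
    mixed points of each block is of this sort. *)
Definition support (zs : seq nat) (full : nat) (sp : nat -> seq nat) (l : label) :=
  let z := size zs in
  let: (k, c, d, i) := l in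
  match k with
  | 0 => base_support zs i
  | 1 => nseq 3 [:: z + c]
  | 2 => if full <= i then nseq 3 [:: 0; z + c] else mixed_support zs (z + c) i
  | 3 => order_support i [:: z + c] [:: z + d]
  | _ => nseq 3 (sp c)
  end.

Definition table (zs : seq nat) (m full : nat) (sp : nat -> seq nat) (ls : seq label)
    (den seed : BinNums.N) (retries : seq nat) : seq (seq (seq nat)) :=
  draw_points den seed (block_list (zs ++ nseq m 3))
    [seq support zs full sp l | l <- ls] retries BinNums.N0.

Definition respects (beta : nat) (sb : nat -> nat) (ls : seq label)
    (pts : seq (seq (seq nat))) : bool :=
  all2 (fun l p => all (fun v => all (fun x => (nth 0 v x == 0) || fits sb l (block_of beta x))
    (iota 0 (size v))) p) ls pts.

(** The elimination sees the pieces of the base block, the gluing only whole blocks: [ib] sends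
    every piece to block 0. The last two checks make the points compatible with [block_of] and
    [fits]. *)
Definition valid_table (zs : seq nat) (m : nat) (R : seq nat -> bool) (sb : nat -> nat)
    (ls : seq label) (pts : seq (seq (seq nat))) : bool :=
  let sizes := zs ++ nseq m 3 in
  let beta := sumn zs in
  let ib b := if b < size zs then 0 else (b - size zs).+1 in
  [&& uniq ls, certified sizes (fun a b c => R [:: ib a; ib b; ib c]) pts,
      all (fun x => ib (nth 0 (block_list sizes) x) == block_of beta x) (iota 0 (beta + 3 * m)) &
      respects beta sb ls pts].

Lemma determined_ext (A : pzRingType) (P : eqType) n (S : seq P) D D' (p : P -> nat -> nat -> A) :
  (forall x y z, x < n -> y < n -> z < n -> D x y z = D' x y z) ->
  determined n S D p -> determined n S D' p.
Proof.
move=> DD' det T T0 kT x y z xn yn zn.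
pose T' x y z := if [&& x < n, y < n & z < n] then T x y z else 0%R.
have T'E a b c : a < n -> b < n -> c < n -> T' a b c = T a b c by rewrite /T' => -> -> ->.
rewrite -T'E //; apply: det => // [a b c Dn|t tS s a s3 an].
  by rewrite /T'; case: ifP => // /and3P[an bn cn]; apply: T0; rewrite -DD'.
rewrite -[RHS](kT t tS s a s3 an); apply: eq_bigr => b _; apply: eq_bigr => c _.
by congr (_ * _)%R; case: s s3 => [|[|s]] _ /=; rewrite T'E.
Qed.

Lemma valid_table_determined (F : numFieldType) zs m R sb ls pts :
  valid_table zs m R sb ls pts ->
  determined (sumn zs + 3 * m) (iota 0 (size ls))
    (fun x y z => R [:: block_of (sumn zs) x; block_of (sumn zs) y; block_of (sumn zs) z])
    (fun t s x => (point_coord pts t s x)%:R%R : F).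
Proof.
case/and4P=> _ /(@certified_determined F) det /allP ib.
rewrite /respects all2E => /andP[/eqP sz _].
have nE : sumn (zs ++ nseq m 3) = sumn zs + 3 * m by rewrite sumn_cat sumn_nseq.
rewrite sz -nE; apply: determined_ext det => x y z.
rewrite nE => xn yn zn.
have ibE w : w < sumn zs + 3 * m ->
    (if nth 0 (block_list (zs ++ nseq m 3)) w < size zs then 0
     else (nth 0 (block_list (zs ++ nseq m 3)) w - size zs).+1) = block_of (sumn zs) w.
  by move=> wn; apply/eqP; apply: ib; rewrite mem_iota.
by rewrite !ibE.
Qed.

Lemma respects_fits beta sb ls pts t s x : respects beta sb ls pts -> t < size ls ->
  point_coord pts t s x != 0 -> fits sb (nth (0, 0, 0, 0) ls t) (block_of beta x).
Proof.
rewrite /respects all2E => /andP[/eqP sz H] tl; rewrite /point_coord => c0.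
have tp : t < size pts by rewrite -sz.
have /(allP H) : nth ((0, 0, 0, 0), [::]) (zip ls pts) t \in zip ls pts.
  by rewrite mem_nth // size1_zip ?sz.
rewrite nth_zip //= => H1.
have [sp|sp] := ltnP s (size (nth [::] pts t)); last by rewrite (nth_default [::] sp) nth_nil in c0.
have [xv|xv] := ltnP x (size (nth [::] (nth [::] pts t) s)); last by rewrite nth_default in c0.
have := allP H1 _ (mem_nth [::] sp) => /allP/(_ x); rewrite mem_iota => /(_ xv).
by rewrite (negPf c0).
Qed.

Definition spares (m : nat) : nat := if m == 3 then 2 else 1.

Definition core_labels (p k m : nat) : seq label :=
  let C := iota 0 m in
  base_labels p ++ single_labels C ++ mixed_labels k C ++ pair_labels C ++
  (if m == 0 then [::] else spare_labels [:: (0, spares m)]).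
Definition cross_labels (m m' : nat) : seq label :=
  let C := iota 0 (m + m') in
  single_labels C ++ pair_labels C ++ spare_labels [:: (0, spares m); (1, spares m')].
Definition triple_labels (k : nat) : seq label :=
  mixed_labels k [:: 0; 1] ++ pair_labels [:: 0; 1].

(** There is no base block in this configuration: the blocks 1 to [m] form the first superblock and
    the later ones the second. *)
Definition cross_region (m : nat) (bs : seq nat) : bool :=
  has (fun b => b <= m) bs && has (fun b => m < b) bs.
Definition triple_region (bs : seq nat) : bool :=
  [&& has (eqn 0) bs, has (eqn 1) bs & has (eqn 2) bs].

(* When the base points alone determine the base block, its cells may be left out. *)
Definition core_region (skip : bool) (bs : seq nat) : bool := ~~ (skip && all (eqn 0) bs).

Definition core_table skip zs p m full den seed retries :=
  let ls := core_labels p (2 * sumn zs) m in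
  valid_table zs m (core_region skip) (fun _ => 0) ls
    (table zs m full (fun _ => iota 0 (size zs + m)) ls den seed retries).
Definition cross_table m m' den seed retries :=
  let ls := cross_labels m m' in
  valid_table [::] (m + m') (cross_region m) (fun c => if c < m then 0 else 1) ls
    (table [::] (m + m') 99 (fun x => if x == 0 then iota 0 m else iota m m') ls den seed retries).
Definition triple_table zs den seed retries :=
  let ls := triple_labels (2 * sumn zs) in
  valid_table zs 2 triple_region (fun _ => 0) ls
    (table zs 2 99 (fun _ => [::]) ls den seed retries).

Lemma base2_table : core_table false [:: 2] 2 0 99 55%num 19%num [:: 0; 1].
Proof. by vm_cast_no_check (erefl true). Qed.

Lemma base3_table : core_table false [:: 3] 5 0 99 55%num 2115%num [:: 0; 0; 6; 2; 1].
Proof. by vm_cast_no_check (erefl true). Qed.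

Lemma base4_table : core_table false [:: 4] 7 0 99 55%num 369%num [:: 0; 0; 0; 3; 1; 5; 0].
Proof. by vm_cast_no_check (erefl true). Qed.

Lemma base10_table : core_table false [:: 4; 3; 3] 36 0 99 55%num 4%num [:: 0; 0; 0; 0; 0; 0; 0;
  0; 1; 1; 0; 1; 2; 0; 0; 0; 2; 0; 0; 2; 0; 3; 0; 0; 4; 0; 0; 0; 5; 5; 3; 1; 1; 1; 7; 7].
Proof. by vm_cast_no_check (erefl true). Qed.

Lemma core2_1_table : core_table false [:: 2] 2 1 3 55%num 193%num [:: 0; 1; 0; 0; 0; 1; 5; 4;
  2; 7].
Proof. by vm_cast_no_check (erefl true). Qed.

(** Four points cannot determine a base block of size 3, because of Strassen's determinant. Hence
    [skip] is false: the cells of the base block are determined jointly with those of the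
    superblock. *)
Lemma core3_1_table : core_table false [:: 3] 4 1 99 55%num 61%num [:: 0; 0; 1; 3; 0; 0; 1; 2;
  0; 1; 0; 5; 0; 1].
Proof. by vm_cast_no_check (erefl true). Qed.

Lemma core4_1_table : core_table true [:: 4] 7 1 99 55%num 238%num [:: 0; 0; 0; 1; 0; 0; 0; 0;
  0; 3; 0; 0; 0; 6; 4; 2; 1; 0; 0].
Proof. by vm_cast_no_check (erefl true). Qed.

Lemma core2_3_table : core_table false [:: 2] 2 3 3 53%num 121%num [:: 3; 4; 0; 0; 0; 1; 0; 3;
  0; 2; 0; 0; 1; 5; 2; 5; 1; 1; 4; 2; 2; 3; 0; 3; 2; 1; 1; 3; 2; 0; 0; 0; 3; 0; 0; 0; 0; 0; 0;
  1; 2; 0; 3].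
Proof. by vm_cast_no_check (erefl true). Qed.

Lemma core3_3_table : core_table false [:: 3] 4 3 99 50%num 65%num [:: 0; 0; 0; 0; 0; 0; 1; 0;
  0; 1; 1; 0; 0; 0; 0; 0; 1; 1; 2; 0; 0; 0; 2; 0; 6; 0; 0; 0; 6; 7; 3; 0; 5; 0; 0; 0; 3; 1; 0;
  1; 2; 0; 0; 2; 0; 1; 0; 7; 3; 0; 2].
Proof. by vm_cast_no_check (erefl true). Qed.

Lemma core4_3_table : core_table true [:: 4] 7 3 99 53%num 48%num [:: 0; 0; 0; 0; 0; 0; 0; 0; 0;
  1; 0; 2; 0; 0; 0; 1; 1; 0; 0; 0; 0; 0; 0; 4; 0; 0; 0; 0; 0; 0; 1; 1; 0; 0; 0; 1; 0; 2; 0; 0;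
  0; 6; 0; 1; 2; 0; 0; 1; 0; 6; 2; 2; 0; 1; 2; 0; 2; 3; 0; 4].
Proof. by vm_cast_no_check (erefl true). Qed.

Lemma core10_3_table : core_table true [:: 4; 3; 3] 36 3 99 49%num 52%num [:: 0; 1; 0; 0; 0; 0;
  0; 0; 0; 0; 0; 1; 0; 1; 0; 0; 0; 0; 0; 0; 0; 0; 0; 0; 0; 0; 1; 0; 0; 0; 0; 0; 0; 0; 0; 0; 0;
  1; 3; 0; 0; 0; 0; 0; 1; 0; 0; 1; 0; 0; 0; 1; 0; 1; 1; 0; 1; 2; 2; 2; 3; 0; 0; 3; 0; 0; 0; 0;
  0; 0; 0; 0; 0; 0; 0; 0; 3; 0; 4; 2; 1; 0; 1; 5; 2; 0; 0; 1; 1; 0; 0; 0; 1; 1; 0; 0; 1; 0; 0;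
  3; 1; 4; 4; 2; 9; 1; 0; 0; 0; 2; 0; 0; 1; 0; 1; 0; 2; 1; 2; 1; 0; 1; 3; 0; 5].
Proof. by vm_cast_no_check (erefl true). Qed.

Lemma cross1_1_table : cross_table 1 1 55%num 89%num [:: 1; 0; 0; 0; 0; 0; 2; 1; 0; 0; 1; 4; 6;
  6].
Proof. by vm_cast_no_check (erefl true). Qed.

Lemma cross1_3_table : cross_table 1 3 43%num 4%num [:: 0; 0; 0; 0; 0; 0; 0; 0; 0; 0; 0; 0; 0;
  0; 1; 0; 0; 1; 0; 0; 0; 0; 0; 0; 1; 0; 1; 1; 1; 1; 0; 0; 0; 0; 0; 0; 0; 1; 1; 0; 2; 0; 0; 0;
  0; 0; 0; 0; 0; 0; 0].
Proof. by vm_cast_no_check (erefl true). Qed.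

Lemma cross3_3_table : cross_table 3 3 43%num 70%num [:: 0; 0; 0; 0; 1; 0; 0; 0; 0; 0; 1; 0; 0;
  0; 0; 0; 0; 0; 0; 0; 0; 0; 0; 0; 0; 0; 0; 0; 1; 0; 0; 0; 1; 0; 0; 0; 0; 0; 0; 0; 1; 0; 2; 0;
  0; 0; 0; 1; 0; 0; 0; 0; 0; 0; 0; 0; 0; 0; 0; 0; 0; 0; 0; 2; 0; 2; 0; 1; 0; 0; 0; 0; 0; 0; 1;
  0; 0; 2; 0; 0; 1; 0; 0; 1; 0; 0; 0; 0; 1; 2; 0; 0; 0; 0; 0; 0; 0; 0; 0; 0; 0; 2; 0; 0; 0; 0;
  0; 0; 0; 0; 0; 0].
Proof. by vm_cast_no_check (erefl true). Qed.

Lemma triple2_table : triple_table [:: 2] 55%num 225%num [:: 0; 0; 0; 0; 1; 4; 2; 0; 1; 2; 1; 0;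
  7; 0].
Proof. by vm_cast_no_check (erefl true). Qed.

(** Serves twice: for a base block of size 3, and for triples of blocks of size 3, one of which
    plays the base block. *)
Lemma triple3_table : triple_table [:: 3] 55%num 23%num [:: 0; 0; 0; 0; 1; 0; 0; 3; 1; 0; 0; 0;
  4; 0; 0; 0; 5; 2].
Proof. by vm_cast_no_check (erefl true). Qed.

Lemma triple4_table : triple_table [:: 4] 55%num 24%num [:: 0; 0; 0; 0; 1; 0; 0; 0; 0; 2; 0; 2;
  0; 0; 0; 1; 4; 0; 3; 0; 0; 2].
Proof. by vm_cast_no_check (erefl true). Qed.

Lemma triple10_table : triple_table [:: 4; 3; 3] 43%num 5%num [:: 0; 0; 0; 0; 0; 0; 0; 0; 0; 2;
  0; 0; 0; 0; 0; 0; 0; 0; 0; 1; 0; 0; 0; 0; 0; 0; 0; 0; 0; 0; 0; 0; 0; 0; 0; 0; 0; 0; 1; 0; 1;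
  5; 4; 0; 0; 2].
Proof. by vm_cast_no_check (erefl true). Qed.

(** * From local to global configurations *)

Section Embedding.
Local Open Scope ring_scope.
Variables (F : numFieldType) (P Q : eqType) (n n' : nat) (g : nat -> nat) (rho : nat -> Q).
Hypothesis g_lt : forall x, (x < n')%N -> (g x < n)%N.
Hypothesis g_inj : forall x y, (x < n')%N -> (y < n')%N -> g x = g y -> x = y.

Lemma sum_embed (f : nat -> F) :
  (forall y, (y < n)%N -> (forall x, (x < n')%N -> y <> g x) -> f y = 0) ->
  \sum_(y < n) f y = \sum_(x < n') f (g x).
Proof.
move=> f0; pose h (x : 'I_n') := Ordinal (g_lt (ltn_ord x)).
have h_inj : {in predT &, injective h} by move=> x y _ _ /(congr1 val)/= /g_inj/val_inj->.
rewrite (bigID (fun y => y \in [set h x | x in predT])) /= addrC big1 ?add0r => [|y /negP yh].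
  by rewrite big_imset //=; apply: eq_big => // x; rewrite inE.
by apply: f0 => // x xn yx; apply/yh/imsetP; exists (Ordinal xn) => //; exact: val_inj.
Qed.

Variables (N' : nat) (D' D : nat -> nat -> nat -> bool) (p' : nat -> nat -> nat -> F).
Hypothesis rho_inj : forall t u, (t < N')%N -> (u < N')%N -> rho t = rho u -> t = u.
Hypothesis DE : forall x y z, (x < n)%N -> (y < n)%N -> (z < n)%N -> D x y z ->
  exists x' y' z', [/\ [/\ (x' < n')%N, (y' < n')%N & (z' < n')%N],
    [/\ x = g x', y = g y' & z = g z'] & D' x' y' z'].

(** Labels outside the image of [rho] and coordinates outside the image of [g] have an index equal
    to the length of the list, and get 0. *)
Definition transport (t : Q) (s x : nat) : F :=
  let i := index t (map rho (iota 0 N')) in let y := index x (map g (iota 0 n')) in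
  if (i < N')%N && (y < n')%N then p' i s y else 0.

Lemma index_map_iota (X : eqType) (f : nat -> X) m i : (i < m)%N ->
  (forall x y, (x < m)%N -> (y < m)%N -> f x = f y -> x = y) ->
  index (f i) (map f (iota 0 m)) = i.
Proof.
move=> im finj.
have := @nth_index _ (f i) (f i) (map f (iota 0 m)).
rewrite map_f ?mem_iota // => /(_ isT).
have il : (index (f i) (map f (iota 0 m)) < m)%N.
  by rewrite -[X in (_ < X)%N](size_iota 0 m) -(size_map f) index_mem map_f // mem_iota.
by rewrite (nth_map 0%N) ?size_iota // nth_iota // add0n => /finj; apply.
Qed.

Lemma transport_neq0 t s x : transport t s x != 0 ->
  exists i y, [/\ (i < N')%N, (y < n')%N, t = rho i, x = g y & p' i s y != 0].
Proof.
rewrite /transport; set i := index t _; set y := index x _; case: ifP; last by rewrite eqxx.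
move=> /andP[iN yn] pn; exists i, y; split=> //.
  have := @nth_index _ t t (map rho (iota 0 N')).
  rewrite -index_mem size_map size_iota -/i iN => /(_ isT) <-.
  by rewrite (nth_map 0%N) ?size_iota // nth_iota.
have := @nth_index _ x x (map g (iota 0 n')).
rewrite -index_mem size_map size_iota -/y yn => /(_ isT) <-.
by rewrite (nth_map 0%N) ?size_iota // nth_iota.
Qed.

Lemma transportE i s y : (i < N')%N -> (y < n')%N -> transport (rho i) s (g y) = p' i s y.
Proof. by move=> iN yn; rewrite /transport !index_map_iota // iN yn. Qed.

(** The form is pulled back along [g]. A transported point vanishes off the image of [g], so
    contracting the form with it is the same as contracting the pullback with the local point. *)
Lemma determined_transport : determined n' (iota 0 N') D' p' ->
  determined n (map rho (iota 0 N')) D transport.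
Proof.
move=> det T T0 kT x y z xn yn zn.
case Dxyz: (D x y z); last by apply: T0; rewrite Dxyz.
have [x' [y' [z' [[xn' yn' zn'] [-> -> ->] _]]]] := DE xn yn zn Dxyz.
pose T' x y z := if [&& x < n', y < n' & z < n']%N then T (g x) (g y) (g z) else 0.
have T'E a b c : (a < n')%N -> (b < n')%N -> (c < n')%N -> T' a b c = T (g a) (g b) (g c).
  by rewrite /T' => -> -> ->.
rewrite -T'E //; apply: det => // [a b c Dn|t].
  rewrite /T'; case: ifP => // /and3P[an bn cn]; apply: T0; apply: contraNN Dn => Dg.
  have [a' [b' [c' [[an' bn' cn'] [ea eb ec] D1]]]] := DE (g_lt an) (g_lt bn) (g_lt cn) Dg.
  by rewrite (g_inj an an' ea) (g_inj bn bn' eb) (g_inj cn cn' ec).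
rewrite mem_iota => /= tN s a s3 an.
rewrite -(kT (rho t) _ s (g a) s3 (g_lt an)); last by rewrite map_f // mem_iota.
have tr0 u b : (forall c, (c < n')%N -> b <> g c) -> transport (rho t) u b = 0.
  by move=> H; apply/eqP; apply: contraPT H => /transport_neq0[i [c [_ cn _ -> _]]] /(_ c cn).
rewrite /pairing.
rewrite [RHS](sum_embed (f := fun b => \sum_(c < n) transport (rho t) (s == 0)%N b *
  transport (rho t) (2 - (s == 2))%N c * slot s T (g a) b c)) => [|b _ bg]; last first.
  by rewrite big1 // => c _; rewrite (tr0 _ _ bg) !mul0r.
apply: eq_bigr => b _.
rewrite [RHS](sum_embed (f := fun c => transport (rho t) (s == 0)%N (g b) *
  transport (rho t) (2 - (s == 2))%N c * slot s T (g a) (g b) c)) => [|c _ cg]; last first.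
  by rewrite (tr0 _ _ cg) mulr0 mul0r.
apply: eq_bigr => c _; rewrite !transportE //; congr (_ * _).
by case: s s3 => [|[|s]] _ /=; rewrite T'E.
Qed.
End Embedding.

(** * Decoupling the equations by the blocks of the cells *)

Section Restriction.
Local Open Scope ring_scope.
Variables (F : numFieldType) (P : eqType) (n : nat) (bl : nat -> nat).
Implicit Types (Rg Z : seq nat -> bool) (W : P -> nat -> bool).

Definition on_blocks Rg x y z := Rg [:: bl x; bl y; bl z].
Definition symmetric_region Rg := forall s s' : seq nat, perm_eq s s' -> Rg s = Rg s'.
Definition supported W (p : P -> nat -> nat -> F) :=
  forall t s x, p t s x != 0 -> W t (bl x).
Definition zero_on Rg (T : nat -> nat -> nat -> F) :=
  forall x y z, (x < n)%N -> (y < n)%N -> (z < n)%N -> Rg [:: bl x; bl y; bl z] -> T x y z = 0.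

Lemma region_swap Rg x y z : symmetric_region Rg -> Rg [:: y; x; z] = Rg [:: x; y; z].
Proof. by apply; rewrite (perm_catCA [:: y] [:: x]). Qed.

Lemma region_rot Rg x y z : symmetric_region Rg -> Rg [:: y; z; x] = Rg [:: x; y; z].
Proof. by apply; rewrite (perm_rot 1 [:: x; y; z]). Qed.

(* Among the cells met by an equation of a point of S, either none lies in Rg or
   all those outside Rg are already known to carry 0. *)
Lemma zero_on_step W (S : seq P) Rg Z p T :
  symmetric_region Rg -> symmetric_region Z -> supported W p ->
  (forall t b c d c' d', t \in S -> W t c -> W t d -> W t c' -> W t d' ->
     Rg [:: b; c; d] -> ~~ Rg [:: b; c'; d'] -> Z [:: b; c'; d']) ->
  determined n S (on_blocks Rg) p ->
  (forall t, t \in S -> kills n (p t) T) -> zero_on Z T -> zero_on Rg T.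
Proof.
move=> RgS ZS sp RZ det kT T0 x y z xn yn zn Rxyz.
pose T' x y z := if [&& x < n, y < n & z < n]%N && Rg [:: bl x; bl y; bl z] then T x y z else 0.
have -> : T x y z = T' x y z by rewrite /T' xn yn zn Rxyz.
apply: det => // [a b c /negPf Rn|t tS s a s3 an]; first by rewrite /T' [Rg _]Rn andbF.
have slotE b c : (b < n)%N -> (c < n)%N ->
    slot s T' a b c = if Rg [:: bl a; bl b; bl c] then slot s T a b c else 0.
  move=> bn cn; case: s s3 => [|[|[|//]]] _; rewrite /slot /T' an bn cn //=.
  - by rewrite region_swap.
  - by rewrite region_rot.
have slotZ b c : (b < n)%N -> (c < n)%N -> Z [:: bl a; bl b; bl c] -> slot s T a b c = 0.
  move=> bn cn Zc; case: s s3 {slotE} => [|[|[|//]]] _; apply: T0 => //.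
  - by rewrite region_swap.
  - by rewrite region_rot.
(* If a cell of [Rg] enters the equation, the terms outside [Rg] carry 0 and the equation for [T']
   is that for [T]; if none does, [T'] makes every term vanish. *)
pose live (bc : 'I_n * 'I_n) := [&& W t (bl bc.1), W t (bl bc.2) & Rg [:: bl a; bl bc.1; bl bc.2]].
have dead (b c : 'I_n) : ~~ (W t (bl b) && W t (bl c)) ->
    p t (s == 0)%N b * p t (2 - (s == 2))%N c = 0.
  rewrite negb_and => /orP[|] Wn.
    have /eqP-> : p t (s == 0)%N b == 0 by apply: contraNT Wn; apply: sp.
    by rewrite mul0r.
  have /eqP-> : p t (2 - (s == 2))%N c == 0 by apply: contraNT Wn; apply: sp.
  by rewrite mulr0.
case: (pickP live) => [[b c] /and3P[/= Wb Wc Rbc]|none].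
  rewrite -[RHS](kT t tS s a s3 an); apply: eq_bigr => b' _; apply: eq_bigr => c' _.
  rewrite slotE //; case: ifP => // /negbT Rn.
  case: (boolP (W t (bl b') && W t (bl c'))) => [/andP[Wb' Wc']|/dead->]; last by rewrite !mul0r.
  by rewrite slotZ // (RZ t _ (bl b) (bl c)).
rewrite /pairing big1 // => b _; rewrite big1 // => c _; rewrite slotE //.
case: ifP => Rbc; last by rewrite mulr0.
rewrite dead ?mul0r //; apply/negP => /andP[Wb Wc].
by have := none (b, c); rewrite /live /= Wb Wc Rbc.
Qed.

Lemma determined_sub (S S' : seq P) Rg Rg' (p : P -> nat -> nat -> F) : {subset S <= S'} ->
  (forall s, Rg' s -> Rg s) -> determined n S (on_blocks Rg) p -> determined n S' (on_blocks Rg') p.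
Proof.
move=> SS RR det T T0 kT; apply: det => [x y z Rn|t tS]; last exact/kT/SS.
by apply: T0; apply: contraNN Rn; apply: RR.
Qed.
End Restriction.

(** * Blocks, offsets and the transport of a table *)

Definition width (beta b : nat) : nat := if b == 0 then beta else 3.
Definition start (beta b : nat) : nat := if b == 0 then 0 else beta + 3 * b.-1.
Definition offset (beta x : nat) : nat := if x < beta then x else (x - beta) %% 3.

Lemma block_of_start beta b o : o < width beta b -> block_of beta (start beta b + o) = b.
Proof.
rewrite /width /start /block_of; case: b => [|b] /= ob; first by rewrite add0n ob.
by case: ifP => [|_]; [lia|]; congr _.+1; lia.
Qed.

Lemma offset_start beta b o : o < width beta b -> offset beta (start beta b + o) = o.
Proof.
rewrite /width /start /offset; case: b => [|b] /= ob; first by rewrite add0n ob.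
by rewrite ltnNge -addnA leq_addr addKn mulnC modnMDl modn_small.
Qed.

Lemma start_offset beta x : start beta (block_of beta x) + offset beta x = x.
Proof.
rewrite /start /block_of /offset; case: ltnP => //= xb.
by rewrite -addnA [3 * _]mulnC -divn_eq subnKC.
Qed.

Lemma offset_lt beta x : offset beta x < width beta (block_of beta x).
Proof. by rewrite /width /block_of /offset; case: ifP => //= _; rewrite ltn_mod. Qed.

Lemma block_of_le beta N x : x < beta + 3 * N -> block_of beta x <= N.
Proof. by rewrite /block_of; case: ifP => //= xb xN; lia. Qed.

Lemma start_lt beta N b o : b <= N -> o < width beta b -> start beta b + o < beta + 3 * N.
Proof. by rewrite /width /start; case: b => [|b] /=; lia. Qed.

(** The tables for two superblocks have a base block of width 0, which holds no coordinate and has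
    no counterpart among the global blocks. *)
Definition valid_block (beta m b : nat) : bool := (b <= m) && (0 < width beta b).

Lemma valid_block_of beta m x : x < beta + 3 * m -> valid_block beta m (block_of beta x).
Proof. by move=> xm; rewrite /valid_block block_of_le //= (leq_ltn_trans _ (offset_lt beta x)). Qed.

(** The map [phi] matches local blocks with global blocks of the same width, and coordinates keep
    their offsets. Every cell of [Rg] comes from a cell of [Rl], so a form on the global region is
    one that the table has treated. *)
Lemma transport_table (F : numFieldType) beta N zs m (Rl Rg : seq nat -> bool) sb ls pts
    (phi : nat -> nat) (rho : label -> label) (W : label -> nat -> bool) :
  valid_table zs m Rl sb ls pts ->
  (forall b, valid_block (sumn zs) m b -> width (sumn zs) b = width beta (phi b) /\ phi b <= N) ->
  {in valid_block (sumn zs) m &, injective phi} ->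
  (forall a b c, a <= N -> b <= N -> c <= N -> Rg [:: a; b; c] ->
     exists a' b' c', [/\ [/\ valid_block (sumn zs) m a', valid_block (sumn zs) m b' &
       valid_block (sumn zs) m c'], [/\ a = phi a', b = phi b' & c = phi c'] & Rl [:: a'; b'; c']]) ->
  {in ls &, injective rho} ->
  (forall l b, l \in ls -> valid_block (sumn zs) m b -> fits sb l b -> W (rho l) (phi b)) ->
  exists2 p : label -> nat -> nat -> F, supported (block_of beta) W p &
    determined (beta + 3 * N) (map rho ls) (on_blocks (block_of beta) Rg) p.
Proof.
move=> tab wid phi_inj RR rho_inj fitsW; set beta' := sumn zs in wid phi_inj RR fitsW.
have /and4P[uls _ _ res] := tab.
have det := @valid_table_determined F _ _ _ _ _ _ tab.
pose g x := start beta (phi (block_of beta' x)) + offset beta' x.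
have off x : x < beta' + 3 * m -> offset beta' x < width beta (phi (block_of beta' x)).
  by move=> xm; have [<- _] := wid _ (valid_block_of xm); exact: offset_lt.
have bg x : x < beta' + 3 * m -> block_of beta (g x) = phi (block_of beta' x).
  by move=> xm; rewrite block_of_start ?off.
have g_lt x : x < beta' + 3 * m -> g x < beta + 3 * N.
  by move=> xm; apply: start_lt (off _ xm); have [] := wid _ (valid_block_of xm).
have g_inj x y : x < beta' + 3 * m -> y < beta' + 3 * m -> g x = g y -> x = y.
  move=> xm ym gxy; have := congr1 (offset beta) gxy; rewrite !offset_start ?off // => oxy.
  have := congr1 (block_of beta) gxy; rewrite !bg // => /phi_inj bxy.
  by rewrite -(start_offset beta' x) -(start_offset beta' y) oxy bxy //; exact: valid_block_of.
pose l0 : label := (0, 0, 0, 0); pose r t := rho (nth l0 ls t).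
have r_inj t u : t < size ls -> u < size ls -> r t = r u -> t = u.
  by move=> tl ul /rho_inj e; apply/eqP; rewrite -(nth_uniq l0 tl ul uls) e ?mem_nth.
have lift_g x b' : x < beta + 3 * N -> valid_block beta' m b' -> block_of beta x = phi b' ->
    exists2 x', x' < beta' + 3 * m & x = g x' /\ block_of beta' x' = b'.
  move=> xN vb bx; have [wb _] := wid _ vb.
  have ob : offset beta x < width beta' b' by rewrite wb -bx; exact: offset_lt.
  exists (start beta' b' + offset beta x); first by apply: start_lt ob; case/andP: vb.
  by rewrite /g block_of_start // offset_start // -bx start_offset.
have DE x y z : x < beta + 3 * N -> y < beta + 3 * N -> z < beta + 3 * N ->
    on_blocks (block_of beta) Rg x y z -> exists x' y' z',
    [/\ [/\ x' < beta' + 3 * m, y' < beta' + 3 * m & z' < beta' + 3 * m],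
       [/\ x = g x', y = g y' & z = g z'] &
       Rl [:: block_of beta' x'; block_of beta' y'; block_of beta' z']].
  move=> xn yn zn /RR[]; do ?exact: block_of_le.
  move=> a [b [c [[va vb vc] [ea eb ec] Rabc]]].
  have [x' xm [ex bx]] := lift_g _ _ xn va ea.
  have [y' ym [ey by']] := lift_g _ _ yn vb eb.
  have [z' zm [ez bz]] := lift_g _ _ zn vc ec.
  by exists x', y', z'; rewrite bx by' bz.
have -> : map rho ls = map r (iota 0 (size ls)).
  by rewrite -{1}(mkseq_nth l0 ls) -map_comp.
exists (transport (beta' + 3 * m) g r (size ls) (fun t s x => (point_coord pts t s x)%:R%R)).
  move=> t s x /transport_neq0[i [y [il yn -> -> pn]]]; rewrite bg //.
  apply: fitsW; [exact: mem_nth|exact: valid_block_of|].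
  apply: (@respects_fits _ _ _ _ i s y) res il _.
  by apply: contraNneq pn => ->.
by apply: (@determined_transport F _ _ _ g r g_lt g_inj _ _ _ _ r_inj DE).
Qed.

Lemma mem_base_labels p K c d i :
  ((K, c, d, i) \in base_labels p) = [&& K == 0, c == 0, d == 0 & i < p].
Proof.
apply/mapP/and4P => [[i' + [-> -> -> ->]]|[/eqP-> /eqP-> /eqP-> ip]]; first by rewrite mem_iota.
by exists i; rewrite ?mem_iota.
Qed.

Lemma mem_single_labels C K c d i :
  ((K, c, d, i) \in single_labels C) = [&& K == 1, c \in C, d == 0 & i < 3].
Proof.
apply/allpairsP/and4P => [[[c' i'] []]|[/eqP-> cC /eqP-> i3]].
  by rewrite mem_iota => c'C i'3 [-> -> -> ->].
by exists (c, i); rewrite mem_iota.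
Qed.

Lemma mem_mixed_labels k C K c d i :
  ((K, c, d, i) \in mixed_labels k C) = [&& K == 2, c \in C, d == 0 & i < k].
Proof.
apply/allpairsP/and4P => [[[c' i'] []]|[/eqP-> cC /eqP-> i3]].
  by rewrite mem_iota => c'C i'3 [-> -> -> ->].
by exists (c, i); rewrite mem_iota.
Qed.

Lemma mem_pair_labels C K c d i :
  ((K, c, d, i) \in pair_labels C) = [&& K == 3, (c, d) \in ordered_pairs C & i < 6].
Proof.
apply/allpairsP/and3P => [[[[c' d'] i'] []]|[/eqP-> cC i6]].
  by rewrite mem_iota => c'C i'3 [-> -> -> ->].
by exists ((c, d), i); rewrite mem_iota.
Qed.

Lemma mem_spare_labels (L : seq (nat * nat)) K c d i :
  ((K, c, d, i) \in spare_labels L) = [&& K == 4, d == 0 & has (fun e => (e.1 == c) && (i < e.2)) L].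
Proof.
apply/allpairsPdep/and3P => [[[c' k] [i' [/= eL + [-> -> -> ->]]]]|[/eqP-> /eqP-> /hasP[[c' k] eL]]].
  by rewrite mem_iota => /= ik; split=> //; apply/hasP; exists (c', k) => //=; rewrite eqxx.
by case/andP=> /eqP/= <- ik; exists (c', k), i; rewrite mem_iota.
Qed.

Lemma mem_ordered_pairs a m c d :
  ((c, d) \in ordered_pairs (iota a m)) = [&& a <= c, c < d & d < a + m].
Proof.
elim: m a => [|m IH] a /=; first by rewrite in_nil; lia.
rewrite mem_cat IH; set b := _ \in _.
have -> : b = (c == a) && (a < d < a + m.+1).
  apply/mapP/andP => [[d' + [-> ->]]|[/eqP-> da]]; first by rewrite mem_iota; lia.
  by exists d => //; rewrite mem_iota; lia.
lia.
Qed.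

Lemma ordered_pairs_size C : size (ordered_pairs C) = 'C(size C, 2).
Proof.
elim: C => //= c C IH; rewrite size_cat size_map IH binS bin1 addnC //.
Qed.

(** * Gluing the local configurations *)

Section Assembly.
Variables (F : numFieldType) (skip : bool) (zs : seq nat) (j k p full : nat).
Let beta := sumn zs.
Hypothesis beta_gt0 : 0 < beta.
Let N := j + 3 * k.
Let n := beta + 3 * N.
Let bl := block_of beta.
Local Notation multiplicity x := (if x < j then 1 else 3).

(** The single blocks come before the groups of three, so that two superblocks in increasing order
    have sizes (1, 1), (1, 3) or (3, 3) only. *)
Definition superblock (c : nat) : nat := if c < j then c else j + (c - j) %/ 3.
Definition members (x : nat) : seq nat :=
  iota (if x < j then x else j + 3 * (x - j)) (multiplicity x).

Definition all_labels : seq label :=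
  base_labels p ++ single_labels (iota 0 N) ++ mixed_labels (2 * beta) (iota 0 N) ++
  pair_labels (iota 0 N) ++ spare_labels [seq (x, spares (multiplicity x)) | x <- iota 0 (j + k)].

Lemma mem_all_labels K c d i : ((K, c, d, i) \in all_labels) =
  match K with
  | 0 => [&& c == 0, d == 0 & i < p]
  | 1 => [&& c < N, d == 0 & i < 3]
  | 2 => [&& c < N, d == 0 & i < 2 * beta]
  | 3 => [&& c < d, d < N & i < 6]
  | 4 => [&& d == 0, c < j + k & i < spares (multiplicity c)]
  | _ => false
  end.
Proof.
rewrite !mem_cat mem_base_labels mem_single_labels mem_mixed_labels mem_pair_labels.
rewrite mem_spare_labels mem_ordered_pairs !mem_iota !leq0n !add0n.
case: K => [|[|[|[|[|K]]]]] //=; rewrite ?orbF ?andbA //.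
rewrite -andbA; congr (_ && _); apply/hasP/andP => [[_ /mapP[x + ->]]|[cjk ic]] /=.
  by rewrite mem_iota add0n => /= xjk /andP[/eqP<- ->].
exists (c, spares (multiplicity c)); last by rewrite /= eqxx.
by apply/mapP; exists c; rewrite ?mem_iota.
Qed.

(** Single and pair points together number 3 N + 6 N (N - 1) / 2 = 3 N^2. *)
Lemma size_all_labels : size all_labels = p + 3 * N ^ 2 + 2 * beta * N + (j + 2 * k).
Proof.
have size_sp (L : seq nat) : size (spare_labels [seq (x, spares (multiplicity x)) | x <- L]) =
    sumn [seq spares (multiplicity x) | x <- L].
  by elim: L => //= x L IH; rewrite size_cat size_map size_iota IH.
have sum_spares a m q : (forall x, x \in iota a m -> spares (multiplicity x) = q) ->
    sumn [seq spares (multiplicity x) | x <- iota a m] = m * q.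
  elim: m a => //= m IH a aq; rewrite mulSn aq ?mem_head // IH // => x xm.
  by apply: aq; rewrite in_cons xm orbT.
rewrite !size_cat size_sp /base_labels /single_labels /mixed_labels /pair_labels.
rewrite !size_allpairs !size_map !size_iota ordered_pairs_size size_iota iotaD map_cat sumn_cat.
rewrite (@sum_spares 0 j 1) => [|x]; last by rewrite mem_iota add0n => /= ->.
rewrite (@sum_spares (0 + j) k 2) => [|x]; last first.
  by rewrite mem_iota => /andP[]; rewrite add0n leqNgt => /negPf->.
have : 'C(N, 2) * 2 + N = N * N by elim: (N) => // m IH; rewrite binS bin1; nia.
nia.
Qed.

Lemma mem_members x c : x < j + k -> (c \in members x) = (superblock c == x).
Proof. by move=> xjk; rewrite mem_iota /superblock; case: (ltnP x j) => xj; case: (ltnP c j) => cj; lia. Qed.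

Lemma superblock_lt c : (superblock c < j + k) = (c < N).
Proof. by rewrite /superblock /N; case: (ltnP c j) => cj; lia. Qed.

Definition in_super (x b : nat) : bool := (b != 0) && (superblock b.-1 == x).
Definition in_zones (X : seq nat) (b : nat) : bool := (b == 0) || (superblock b.-1 \in X).
Definition carried_by (X : seq nat) (t : label) : bool :=
  let: (K, c, d, _) := t in
  match K with
  | 0 => true
  | 1 | 2 => superblock c \in X
  | 3 => (superblock c \in X) && (superblock d \in X)
  | _ => c \in X
  end.

Lemma fits_near X t b : carried_by X t -> fits superblock t b -> in_zones X b.
Proof.
case: t => -[[K c] d] i; rewrite /in_zones; case: K => [|[|[|[|K]]]] /=.
- by move=> _ ->.
- by move=> cX /eqP->.
- by move=> cX /orP[->|/eqP->] //=; rewrite cX orbT.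
- by move=> /andP[cX dX] /orP[/eqP->|/eqP->] /=.
- by move=> cX /orP[->|/eqP->] //; rewrite cX orbT.
Qed.

(** The zones sort the cells by the blocks they meet: the base block and one superblock; exactly two
    superblocks, with or without the base block; exactly three given blocks. *)
Definition core_zone x bs := all (in_zones [:: x]) bs.
Definition new_zone x y bs :=
  [&& all (in_zones [:: x; y]) bs, has (in_super x) bs & has (in_super y) bs].
Definition cross_zone x y bs := new_zone x y bs && (0 \notin bs).
Definition triple_zone a b c (bs : seq nat) :=
  [&& all (mem [:: a; b; c]) bs, a \in bs, b \in bs & c \in bs].

Lemma core_zone_sym x : symmetric_region (core_zone x).
Proof. by move=> s s' /perm_mem ss'; exact: eq_all_r. Qed.
Lemma new_zone_sym x y : symmetric_region (new_zone x y).
Proof.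
by move=> s s' /perm_mem ss'; rewrite /new_zone (eq_all_r ss') !(eq_has_r ss').
Qed.
Lemma cross_zone_sym x y : symmetric_region (cross_zone x y).
Proof. by move=> s s' ss'; rewrite /cross_zone (new_zone_sym _ _ ss') (perm_mem ss'). Qed.
Lemma triple_zone_sym a b c : symmetric_region (triple_zone a b c).
Proof. by move=> s s' /perm_mem ss'; rewrite /triple_zone (eq_all_r ss') !ss'. Qed.

Definition lift_block (C : seq nat) (b : nat) : nat := if b is c.+1 then (nth 0 C c).+1 else 0.
Definition relabel (C : seq nat) (X : nat -> nat) (l : label) : label :=
  let: (K, c, d, i) := l in
  match K with
  | 0 => l
  | 3 => (3, nth 0 C c, nth 0 C d, i)
  | 4 => (4, X c, d, i)
  | _ => (K, nth 0 C c, d, i)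
  end.
Definition local_label (m : nat) (l : label) : bool :=
  let: (K, c, d, _) := l in
  match K with 0 => true | 1 | 2 => c < m | 3 => (c < m) && (d < m) | _ => (K == 4) && (c < 2) end.

Lemma relabel_inj C X : uniq C -> (X 0 != X 1) ->
  {in local_label (size C) &, injective (relabel C X)}.
Proof.
move=> uC X01 [[[K c] d] i] [[[K' c'] d'] i'].
have nthC a b : a < size C -> b < size C -> nth 0 C a = nth 0 C b -> a = b.
  by move=> aC bC e; apply/eqP; rewrite -(nth_uniq 0 aC bC uC) e.
rewrite !unfold_in.
case: K => [|[|[|[|[|K]]]]]; case: K' => [|[|[|[|[|K']]]]] //=.
- by move=> cC c'C [/nthC-> // -> ->].
- by move=> cC c'C [/nthC-> // -> ->].
- by move=> /andP[cC dC] /andP[c'C d'C] [/nthC-> // /nthC-> // ->].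
- move=> c2 c'2 [Xc -> ->]; congr (_, _, _, _).
  by case: c c' c2 c'2 Xc X01 => [|[|c]] [|[|c']] // _ _ ->; rewrite eqxx.
Qed.

Lemma lift_block_inj C m : uniq C -> m = size C -> {in fun b => b <= m &, injective (lift_block C)}.
Proof.
move=> uC -> [|b] [|b'] // bC b'C [] /eqP; rewrite nth_uniq // => /eqP->.
by [].
Qed.

Lemma lift_block_onto C b : b != 0 -> b.-1 \in C ->
  exists2 b', 0 < b' <= size C & b = lift_block C b'.
Proof.
case: b => //= b _ bC; exists (index b C).+1; first by rewrite /= index_mem.
by rewrite /= nth_index.
Qed.

Lemma members_uniq x : uniq (members x). Proof. exact: iota_uniq. Qed.

Lemma size_members x : size (members x) = multiplicity x. Proof. exact: size_iota. Qed.

Lemma nth_members x c : x < j + k -> c < multiplicity x -> superblock (nth 0 (members x) c) = x.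
Proof. by move=> xjk cx; apply/eqP; rewrite -mem_members // mem_nth // size_members. Qed.

Lemma nth_members_lt x c : x < j + k -> c < multiplicity x -> nth 0 (members x) c < N.
Proof. by move=> xjk cx; rewrite -superblock_lt nth_members. Qed.

Lemma nth_members_mono x c d : c < d -> d < multiplicity x ->
  nth 0 (members x) c < nth 0 (members x) d.
Proof. by move=> cd dx; rewrite !nth_iota ?(ltn_trans cd) // ltn_add2l. Qed.

(** Spare points reach the base block in the core configurations. A witness for two superblocks can
    nevertheless be sought among spares that vanish there, which separates the cells that avoid the
    base block from the others. *)
Definition flat (t : label) (b : nat) : bool := fits superblock t b && ((t.1.1.1 < 4) || (b != 0)).

Let fitted := supported (F := F) bl (fits superblock).
Let flatted := supported (F := F) bl flat.

Lemma supported_line_closed W : line_closed (supported (F := F) (P := label) bl W).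
Proof.
move=> q r a Wq Wr t s x; rewrite /segment.
have [q0|/Wq//] := eqVneq (q t s x) 0%R; have [r0|/Wr//] := eqVneq (r t s x) 0%R.
by rewrite q0 r0 subr0 mulr0 addr0 eqxx.
Qed.

Lemma core_generic x : x < j + k ->
  (exists den seed retries, core_table skip zs p (multiplicity x) full den seed retries) ->
  generic fitted (determined n [seq t <- all_labels | carried_by [:: x] t]
    (on_blocks bl (fun bs => core_zone x bs && core_region skip bs))).
Proof.
move=> xjk [den [seed [retries]]]; rewrite /core_table; set m := multiplicity x => tab.
have m_gt0 : 0 < m by rewrite /m; case: ifP.
pose rho := relabel (members x) (addn x).
have lab l : l \in core_labels p (2 * beta) m ->
    [&& local_label m l, (l.1.1.1 == 4) ==> (l.1.1.2 == 0) &
      rho l \in [seq t <- all_labels | carried_by [:: x] t]].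
  case: l => [[[K c] d] i].
  rewrite /core_labels ifN -?lt0n //; do 4 rewrite mem_cat.
  rewrite mem_base_labels mem_single_labels mem_mixed_labels mem_pair_labels mem_spare_labels
    mem_ordered_pairs !mem_iota !leq0n add0n.
  rewrite mem_filter.
  case: K => [|[|[|[|[|K]]]]] //=; rewrite ?orbF ?mem_all_labels.
  - by move=> ->.
  - by case/and3P=> cm -> ->; rewrite inE nth_members // nth_members_lt // eqxx cm.
  - by case/and3P=> cm -> ->; rewrite inE nth_members // nth_members_lt // eqxx cm.
  - case/andP=> /andP[cd dm] ->; rewrite !inE !nth_members ?(ltn_trans cd) // !eqxx.
    by rewrite nth_members_mono // nth_members_lt // dm.
  - rewrite !inE => /and3P[-> /eqP<- im].
    by rewrite addn0 !eqxx xjk /=; exact: im.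
have [//|||||q Vq dq] := transport_table F (beta := beta) (N := N)
  (Rg := fun bs => core_zone x bs && core_region skip bs)
  (phi := lift_block (members x)) (rho := rho) (W := fits superblock) tab.
- move=> [|b] /andP[bm _] //=; split=> //.
  by apply: nth_members_lt.
- apply: sub_in2 (lift_block_inj (members_uniq x) (esym (size_members x))) => b.
  by case/andP.
- have onto b : in_zones [:: x] b -> exists2 b', b' <= m & b = lift_block (members x) b'.
    rewrite /in_zones inE; case: eqP => [-> _|/eqP b0 /= bx]; first by exists 0.
    rewrite -mem_members // in bx; have [b' + ->] := lift_block_onto b0 bx.
    by rewrite size_members => /andP[_ bm]; exists b'.
  move=> a b c _ _ _ /andP[/and4P[/onto[a' am ->] /onto[b' bm ->] /onto[c' cm ->] _] sk].
  have v b0 : b0 <= m -> valid_block (sumn zs) m b0.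
    by move=> b0m; rewrite /valid_block b0m /width; case: eqP.
  exists a', b', c'; split; [by rewrite !v|by []|].
  by move: sk; case: (a') (b') (c') => [|?] [|?] [|?].
- move=> l l' /lab/and3P[wl _ _] /lab/and3P[wl' _ _].
  apply: (relabel_inj (X := addn x) (members_uniq x)); rewrite ?size_members //.
  by rewrite addn0 addn1 neq_ltn leqnn.
- move=> [[[K c] d] i] b /lab/and3P[wl c0 _] /andP[bm _].
  case: K wl c0 => [|[|[|[|[|K]]]]] //=; rewrite /rho /=.
  - by move=> _ _ /eqP->.
  - by move=> _ _ /eqP->.
  - by move=> _ _ /orP[|] /eqP-> //=; rewrite eqxx.
  - by move=> _ _ /orP[|] /eqP->; rewrite eqxx ?orbT.
  - move=> _ /eqP-> _; case: b bm => //= b bm; rewrite nth_members //.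
    by rewrite addn0.
apply: generic_determined Vq _; apply: determined_sub dq => // l /mapP[l' /lab/and3P[_ _ +] ->].
by [].
Qed.

Lemma superblock_mono c d : c <= d -> superblock c <= superblock d.
Proof. by rewrite /superblock; case: (ltnP c j) => cj; case: (ltnP d j) => dj; lia. Qed.

Lemma members2_sorted x y : x < y < j + k -> sorted ltn (members x ++ members y).
Proof.
case/andP=> xy yjk; rewrite (sorted_pairwise ltn_trans) pairwise_cat.
rewrite -!(sorted_pairwise ltn_trans) !iota_ltn_sorted !andbT.
apply/allrelP => c d; rewrite !mem_members // ?(ltn_trans xy) // => /eqP cx /eqP dy.
by rewrite ltnNge; apply/negP => /superblock_mono; rewrite cx dy leqNgt xy.
Qed.

Lemma flat_fits t b : flat t b -> fits superblock t b. Proof. by case/andP. Qed.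

Lemma cross_generic x y : x < y < j + k ->
  (exists den seed retries, cross_table (multiplicity x) (multiplicity y) den seed retries) ->
  generic flatted (determined n
    [seq t <- all_labels | carried_by [:: x; y] t && (t.1.1.1 \notin [:: 0; 2])]
    (on_blocks bl (cross_zone x y))).
Proof.
move=> /[dup] xyjk /andP[xy yjk] [den [seed [retries]]]; rewrite /cross_table.
have xjk := ltn_trans xy yjk.
set m := multiplicity x; set m' := multiplicity y => tab.
pose C := members x ++ members y; pose rho := relabel C (nth 0 [:: x; y]).
have szC : size C = m + m' by rewrite size_cat !size_members.
have sC := members2_sorted xyjk; have uC := sorted_uniq ltn_trans ltnn sC.
have sbC c : c < m + m' -> superblock (nth 0 C c) = if c < m then x else y.
  move=> cm; rewrite nth_cat size_members -/m; case: (ltnP c m) => [c1|mc].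
    by rewrite nth_members.
  by rewrite nth_members // ltn_subLR.
have ltC c : c < m + m' -> nth 0 C c < N.
  by move=> cm; rewrite -superblock_lt sbC //; case: ifP.
have sbxy c : c < m + m' -> superblock (nth 0 C c) \in [:: x; y].
  by move=> cm; rewrite sbC // !inE; case: ifP; rewrite eqxx ?orbT.
have monoC c d : c < d -> d < m + m' -> nth 0 C c < nth 0 C d.
  move=> cd dm; apply: (sorted_ltn_nth ltn_trans 0 sC); rewrite ?inE ?szC //.
  exact: ltn_trans dm.
have lab l : l \in cross_labels m m' -> [&& local_label (m + m') l, l.1.1.1 \notin [:: 0; 2] &
      rho l \in [seq t <- all_labels | carried_by [:: x; y] t && (t.1.1.1 \notin [:: 0; 2])]].
  case: l => [[[K c] d] i].
  rewrite /cross_labels; do 2 rewrite mem_cat.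
  rewrite mem_single_labels mem_pair_labels mem_spare_labels mem_ordered_pairs !mem_iota !leq0n add0n.
  rewrite mem_filter.
  case: K => [|[|[|[|[|K]]]]] //=; rewrite ?orbF ?mem_all_labels.
  - by case/and3P=> cm -> ->; rewrite cm sbxy // ltC.
  - case/andP=> /andP[cd dm] ->; rewrite dm (ltn_trans cd dm) !sbxy ?(ltn_trans cd) //.
    by rewrite monoC // ltC.
  - case/andP=> -> /orP[] /andP[/eqP<- im] /=.
      by rewrite !inE eqxx xjk /=; exact: im.
    by rewrite !inE eqxx orbT yjk /=; exact: im.
have vb b : valid_block (sumn [::]) (m + m') b = (0 < b <= m + m').
  by rewrite /valid_block andbC /width; case: b.
have [//|||||q Vq dq] := transport_table F (beta := beta) (N := N) (Rg := cross_zone x y)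
  (phi := lift_block C) (rho := rho) (W := flat) tab.
- by move=> [|b]; rewrite vb //= => bm; split=> //; apply: ltC.
- apply: sub_in2 (lift_block_inj uC (esym szC)) => b.
  by case/andP.
- have onto b : in_zones [:: x; y] b -> b != 0 -> exists2 b', 0 < b' <= m + m' & b = lift_block C b'.
    rewrite /in_zones orbC => /orP[bxy b0|/eqP->//].
    rewrite -szC; apply: lift_block_onto => //; rewrite mem_cat !mem_members //.
    by move: bxy; rewrite !inE.
  have inx b : 0 < b <= m + m' -> in_super x (lift_block C b) = (b <= m).
    case: b => //= b bm; rewrite /in_super /= sbC // -/m.
    by case: ltnP => _; rewrite ?eqxx // gtn_eqF.
  have iny b : 0 < b <= m + m' -> in_super y (lift_block C b) = (m < b).
    case: b => //= b bm; rewrite /in_super /= sbC // -/m ltnS.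
    by case: ltnP => _; rewrite ?eqxx // ltn_eqF.
  move=> a b c _ _ _ /andP[/and3P[/and4P[na nb nc _] hx hy]].
  rewrite !inE !negb_or eq_sym (eq_sym 0 b) (eq_sym 0 c) => /and3P[a0 b0 c0].
  have [a' am ea] := onto _ na a0; have [b' bm eb] := onto _ nb b0.
  have [c' cm ec] := onto _ nc c0.
  exists a', b', c'; rewrite !vb; split=> //.
  move: hx hy; rewrite ea eb ec /cross_region /= !inx // !iny //.
  by move=> -> ->.
- move=> l l' /lab/and3P[wl _ _] /lab/and3P[wl' _ _].
  apply: (relabel_inj (X := nth 0 [:: x; y]) uC); rewrite ?szC //=.
  by rewrite neq_ltn xy.
- move=> [[[K c] d] i] b /lab/and3P[wl K02 _]; rewrite vb => /andP[b0 bm].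
  rewrite /flat; case: K wl K02 => [|[|[|[|[|K]]]]] //=; rewrite /rho /=.
  - by move=> _ _ /eqP->; rewrite /= eqxx.
  - by move=> _ _ /orP[|] /eqP->; rewrite /= eqxx ?orbT.
  - move=> c2 _; rewrite (negPf (lt0n_neq0 b0)) /=; case: b b0 bm => //= b _ bm.
    by rewrite sbC // -/m; case: ifP => _ /eqP<-; rewrite eqxx.
apply: generic_determined Vq _; apply: determined_sub dq => // l /mapP[l' /lab/and3P[_ _ +] ->].
by [].
Qed.

Definition mixed_or_pair (c d : nat) (t : label) : bool :=
  let: (K, c', d', _) := t in (K == 2) && (c' \in [:: c; d]) || (K == 3) && ((c', d') == (c, d)).

Lemma mem_triple_labels m K c d i : ((K, c, d, i) \in triple_labels m) =
  [&& K == 2, c < 2, d == 0 & i < m] || [&& K == 3, c == 0, d == 1 & i < 6].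
Proof.
rewrite mem_cat mem_mixed_labels mem_pair_labels (mem_ordered_pairs 0 2) (mem_iota 0 2).
congr (_ || _); case: K => [|[|[|[|K]]]] //=.
by rewrite add0n andbA; congr (_ && _); lia.
Qed.

Lemma triple_generic c d : c < d < N ->
  (exists den seed retries, triple_table zs den seed retries) ->
  generic flatted (determined n [seq t <- all_labels | mixed_or_pair c d t]
    (on_blocks bl (triple_zone 0 c.+1 d.+1))).
Proof.
move=> /andP[cd dN] [den [seed [retries]]]; rewrite /triple_table => tab.
have cN := ltn_trans cd dN.
pose C := [:: c; d]; pose rho := relabel C id.
have uC : uniq C by rewrite /= inE andbT neq_ltn cd.
have lab l : l \in triple_labels (2 * beta) ->
    local_label 2 l && (rho l \in [seq t <- all_labels | mixed_or_pair c d t]).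
  case: l => [[[K c'] d'] i]; rewrite mem_triple_labels mem_filter.
  case/orP=> [/and4P[/eqP-> c2 /eqP-> im]|/and4P[/eqP-> /eqP-> /eqP-> im]] /=; rewrite !mem_all_labels.
    by rewrite im orbF; case: c' c2 => [|[|c']] //= _; rewrite !inE eqxx ?orbT ?cN ?dN.
  by rewrite cd dN eqxx.
have vb b : valid_block (sumn zs) 2 b = (b <= 2).
  by rewrite /valid_block /width -/beta; case: b => //= b; rewrite andbT.
have [//|||||q Vq dq] := transport_table F (beta := beta) (N := N)
  (Rg := triple_zone 0 c.+1 d.+1) (phi := lift_block C) (rho := rho) (W := flat) tab.
- by move=> [|[|[|b]]]; rewrite vb //= => bm; split.
- by apply: sub_in2 (lift_block_inj (m := 2) uC erefl) => b /andP[].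
- have onto b : b \in [:: 0; c.+1; d.+1] -> exists2 b', b' <= 2 & b = lift_block C b'.
    by rewrite !inE => /or3P[] /eqP->; [exists 0|exists 1|exists 2].
  move=> a b e _ _ _ /and4P[/and4P[/onto[a' a2 ->] /onto[b' b2 ->] /onto[e' e2 ->] _]] h0 h1 h2.
  exists a', b', e'; rewrite !vb; split=> //; move: h0 h1 h2; rewrite !inE.
  have cdn : (c == d) = false by rewrite ltn_eqF.
  have dcn : (d == c) = false by rewrite eq_sym.
  by case: a' a2 => [|[|[|]]] // _; case: b' b2 => [|[|[|]]] // _; case: e' e2 => [|[|[|]]] // _;
    rewrite /= ?eqSS ?cdn ?dcn.
- move=> l l' /lab/andP[wl _] /lab/andP[wl' _].
  by apply: (relabel_inj (X := id) uC).
- move=> [[[K c'] d'] i] b; rewrite mem_triple_labels vb => + b2.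
  case/orP=> [/and4P[/eqP-> c2 _ _]|/and4P[/eqP-> /eqP-> /eqP-> _]] /orP[] /eqP->;
    by rewrite /flat /= ?eqxx ?orbT.
apply: generic_determined Vq _; apply: determined_sub dq => // l /mapP[l' /lab/andP[_ +] ->].
by [].
Qed.

Definition pair_in (X : seq nat) (t : label) : bool :=
  let: (K, c, d, _) := t in [&& K == 3, c \in X & d \in X].

(* The six points of each of the pairs {c, d} and {c, e} play the part of the mixed
   points of a base block of size 3. *)
Definition relabel_pairs (c d e : nat) (l : label) : label :=
  let: (K, a, _, i) := l in if K == 2 then (3, c, nth 0 [:: d; e] a, i) else (3, d, e, i).

Lemma triple3_generic c d e : c < d < e -> e < N ->
  (exists den seed retries, triple_table [:: 3] den seed retries) ->
  generic fitted (determined n [seq t <- all_labels | pair_in [:: c; d; e] t]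
    (on_blocks bl (triple_zone c.+1 d.+1 e.+1))).
Proof.
move=> /andP[cd de] eN [den [seed [retries]]]; rewrite /triple_table => tab.
have [ce dN] := (ltn_trans cd de, ltn_trans de eN); have cN := ltn_trans cd dN.
have ne := (ltn_eqF cd, ltn_eqF de, ltn_eqF ce, gtn_eqF cd, gtn_eqF de, gtn_eqF ce).
pose rho := relabel_pairs c d e; pose phi b := nth 0 [:: c.+1; d.+1; e.+1] b.
have vb b : valid_block (sumn [:: 3]) 2 b = (b <= 2).
  by rewrite /valid_block /width; case: b => //= b; rewrite andbT.
have [//|||||q Vq dq] := transport_table F (beta := beta) (N := N)
  (Rg := triple_zone c.+1 d.+1 e.+1) (phi := phi) (rho := rho) (W := fits superblock) tab.
- by move=> [|[|[|b]]]; rewrite vb //= => bm; split.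
- move=> a b /andP[a2 _] /andP[b2 _]; move: a2 b2.
  by case: a => [|[|[|a]]] //; case: b => [|[|[|b]]] // _ _ /eqP;
    rewrite /phi /= ?eqSS ?ne.
- have onto b : b \in [:: c.+1; d.+1; e.+1] -> exists2 b', b' <= 2 & b = phi b'.
    by rewrite !inE => /or3P[] /eqP->; [exists 0|exists 1|exists 2].
  move=> a b f _ _ _ /and4P[/and4P[/onto[a' a2 ->] /onto[b' b2 ->] /onto[f' f2 ->] _]] h0 h1 h2.
  exists a', b', f'; rewrite !vb; split=> //; move: h0 h1 h2; rewrite !inE.
  by case: a' a2 => [|[|[|]]] // _; case: b' b2 => [|[|[|]]] // _; case: f' f2 => [|[|[|]]] // _;
    rewrite /= ?eqSS ?ne.
- move=> [[[K a] a'] i] [[[K' b] b'] i']; rewrite !mem_triple_labels.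
  case/orP=> [/and4P[/eqP-> a2 /eqP-> _]|/and4P[/eqP-> /eqP-> /eqP-> _]];
    case/orP=> [/and4P[/eqP-> b2 /eqP-> _]|/and4P[/eqP-> /eqP-> /eqP-> _]] /=.
  + move=> [+ ->]; case: a a2 b b2 => [|[|]] // _ [|[|]] //= _ /eqP;
      by rewrite ?ne.
  + by move=> [/eqP]; rewrite ne.
  + by move=> [/eqP]; rewrite ne.
  + by move=> [->].
- move=> [[[K a] a'] i] b; rewrite mem_triple_labels vb => + b2.
  case/orP=> [/and4P[/eqP-> a2 _ _]|/and4P[/eqP-> /eqP-> /eqP-> _]] /orP[] /eqP-> /=;
    rewrite /phi ?eqxx ?orbT //.
  by case: a a2 => [|[|]] //= _; rewrite eqxx orbT.
apply: generic_determined Vq _; apply: determined_sub dq => // l /mapP[[[[K a] a'] i] + ->].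
rewrite mem_triple_labels mem_filter.
case/orP=> [/and4P[/eqP-> a2 /eqP-> im]|/and4P[/eqP-> /eqP-> /eqP-> im]] /=; rewrite mem_all_labels.
  by case: a a2 => [|[|]] //= _; rewrite !inE !eqxx ?orbT /= ?cd ?ce ?dN ?eN.
by rewrite !inE !eqxx ?orbT de eN.
Qed.

Lemma supported_nonempty W : exists q, supported (F := F) (P := label) bl W q.
Proof. by exists (fun _ _ _ => 0%R) => t s x; rewrite eqxx. Qed.

Lemma in_super_near x b : in_super x b -> in_zones [:: x] b.
Proof. by rewrite /in_super /in_zones inE => /andP[_ ->]; rewrite orbT. Qed.

Lemma near2 x y b : in_zones [:: x; y] b = [|| b == 0, in_super x b | in_super y b].
Proof. by rewrite /in_zones /in_super !inE; case: eqP. Qed.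

Lemma flat_near X t b : carried_by X t -> t.1.1.1 \notin [:: 0; 2] -> flat t b ->
  (b != 0) && in_zones X b.
Proof.
move=> wt Kt /[dup] /flat_fits ft fl; rewrite (fits_near wt ft) andbT.
case: t Kt ft fl {wt} => -[[[|[|[|[|K]]]] c] d] i //= _; rewrite /flat /=.
- by move=> /eqP->.
- by case/orP=> /eqP->.
- by move=> _ /andP[].
Qed.

(* It suffices to treat points whose spares vanish on the base block: then the cells that
   avoid this block decouple from the others, and so do, after them, the cells of each
   triple {0, c, d}. *)
Lemma new_generic x y : x < y < j + k ->
  (exists den seed retries, cross_table (multiplicity x) (multiplicity y) den seed retries) ->
  (exists den seed retries, triple_table zs den seed retries) ->
  generic fitted (determined n [seq t <- all_labels | carried_by [:: x; y] t]
    (on_blocks bl (new_zone x y))).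
Proof.
move=> /[dup] xyjk /andP[xy yjk] tabX tabT; have xjk := ltn_trans xy yjk.
have xny : (x == y) = false by rewrite ltn_eqF.
have yn c : c < j + k -> {in members c, forall a, a < N /\ superblock a = c}.
  by move=> cjk a; rewrite mem_members // => /eqP ac; rewrite -superblock_lt ac.
pose pairs := [seq (c, d) | c <- members x, d <- members y].
have triples : generic flatted (fun q => forall e, e \in pairs ->
    determined n [seq t <- all_labels | mixed_or_pair e.1 e.2 t]
      (on_blocks bl (triple_zone 0 e.1.+1 e.2.+1)) q).
  apply: generic_all; [exact: supported_line_closed|exact: supported_nonempty|].
  move=> _ /allpairsP[[c d] /= [/(yn _ xjk)[cN cx] /(yn _ yjk)[dN dy] ->]].
  apply: triple_generic tabT; rewrite dN andbT ltnNge; apply/negP => /superblock_mono.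
  by rewrite cx dy leqNgt xy.
have [q q_flat [cross_q triple_q]] :=
  generic_ex (generic_conj (@supported_line_closed flat) (cross_generic xyjk tabX) triples).
have q_fit : fitted q by move=> t s z /q_flat/flat_fits.
(* A flat parameter is fitted, and a single witness makes the property generic among the fitted
   ones. *)
apply: generic_determined q_fit _ => T T0 kT.
have out : zero_on n bl (fun bs => ~~ new_zone x y bs) T.
  by move=> a b c _ _ _ /T0.
have out_sym : symmetric_region (fun bs => ~~ new_zone x y bs).
  by move=> s s' /new_zone_sym->.
(* The points used here avoid the base block, so at a coordinate off this block their equations only
   meet cells that avoid it. *)
have crossT : zero_on n bl (cross_zone x y) T.
  apply: zero_on_step (@cross_zone_sym x y) out_sym q_flat _ cross_q _ out.
    move=> t b c d c' d'; rewrite mem_filter => /andP[/andP[wt Kt] _].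
    move=> /(flat_near wt Kt)/andP[c0 nc] /(flat_near wt Kt)/andP[d0 nd].
    move=> /(flat_near wt Kt)/andP[c'0 nc'] /(flat_near wt Kt)/andP[d'0 nd'].
    case/andP=> /andP[/andP[nb _] _]; rewrite inE negb_or => /andP[b0 _].
    rewrite /cross_zone negb_and => /orP[//|].
    by rewrite !inE !(eq_sym 0) (negPf c'0) (negPf d'0) eq_sym (negPf b0).
  by move=> t; rewrite mem_filter => /andP[/andP[wt _] tS]; apply: kT; rewrite mem_filter wt.
pose Z bs := ~~ new_zone x y bs || cross_zone x y bs.
have Z_sym : symmetric_region Z.
  by move=> s s' ss'; rewrite /Z (out_sym _ _ ss') (cross_zone_sym _ _ ss').
have ZT : zero_on n bl Z T.
  by move=> a b c an bn cn /orP[/out|/crossT]; apply.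
(* Each point used sits on two of the three blocks. If its equation meets the triple zone, the third
   block is that of the free coordinate, and any other cell met has only two distinct blocks: it
   lies in the cross zone or misses one of the superblocks. *)
have tripleT c d : c \in members x -> d \in members y ->
    zero_on n bl (triple_zone 0 c.+1 d.+1) T.
  move=> cx dy; have cd : (c, d) \in pairs.
    by apply/allpairsP; exists (c, d).
  have [cN sc] := yn _ xjk _ cx; have [dN sd] := yn _ yjk _ dy.
  apply: zero_on_step (@triple_zone_sym _ _ _) Z_sym q_flat _ (triple_q _ cd) _ ZT => /=.
    have cdF : (c == d) = false by apply/eqP => e; move: sd; rewrite -e sc => /eqP; rewrite xny.
    have dcF : (d == c) = false by rewrite eq_sym.
    have yxF : (y == x) = false by rewrite eq_sym.
    move=> t b c0 d0 c' d'; rewrite mem_filter => /andP[tm _].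
    have [uv uvin fl] : exists2 uv, uv \in [:: (0, c.+1); (0, d.+1); (c.+1, d.+1)] &
        forall b, flat t b -> b \in [:: uv.1; uv.2].
      case: t tm => [[[K cc] dd] i] /= /orP[/andP[/eqP-> cin]|/andP[/eqP-> /eqP[-> ->]]].
        exists (0, cc.+1); first by move: cin; rewrite !inE => /orP[] /eqP->; rewrite eqxx ?orbT.
        by move=> b0 /flat_fits/=; rewrite !inE.
      exists (c.+1, d.+1); first by rewrite !inE eqxx !orbT.
      by move=> b0 /flat_fits/=; rewrite !inE.
    move=> /fl c0in /fl d0in /fl c'in /fl d'in.
    rewrite {1}/triple_zone /= -!andbA => /and4P[bin _ _ hin].
    move: uvin bin c0in d0in c'in d'in hin; rewrite !inE.
    rewrite /Z /triple_zone /cross_zone /new_zone /=.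
    move=> /or3P[] /eqP-> /= /or3P[] /eqP-> /orP[] /eqP-> /orP[] /eqP-> //;
      rewrite ?eqSS ?cdF ?dcF ?eqxx //= => /orP[] /eqP-> /orP[] /eqP->;
      by rewrite /in_zones /in_super /= ?sc ?sd !inE ?eqSS ?cdF ?dcF ?xny ?yxF ?eqxx ?orbT.
  move=> t; rewrite mem_filter => /andP[wt tS]; apply: kT; rewrite mem_filter tS andbT.
  case: t wt {tS} => [[[K c'] d'] i] /=.
  case/orP=> [/andP[/eqP-> c'cd]|/andP[/eqP-> /eqP[-> ->]]] /=.
    by move: c'cd; rewrite !inE => /orP[] /eqP->; rewrite ?sc ?sd eqxx ?orbT.
  by rewrite !inE sc sd !eqxx orbT.
move=> a b c an bn cn; case nabc: (new_zone x y [:: bl a; bl b; bl c]); last first.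
  by apply: out => //; rewrite nabc.
case cabc: (cross_zone x y [:: bl a; bl b; bl c]); first exact: crossT.
(* A cell left over meets the base block and both superblocks, hence exactly the blocks 0, [b1] and
   [b2]. *)
have [/andP[/hasP[b1 b1in x1] /hasP[b2 b2in y2]] b0] : 
    (has (in_super x) [:: bl a; bl b; bl c] && has (in_super y) [:: bl a; bl b; bl c]) /\
    0 \in [:: bl a; bl b; bl c].
  move: cabc; rewrite /cross_zone nabc andTb => /negbFE->; by case/and3P: nabc => _ -> ->.
have [/andP[b10 /eqP b1x] /andP[b20 /eqP b2y]] := (x1, y2).
apply: (tripleT b1.-1 b2.-1) => //; rewrite ?mem_members ?b1x ?b2y //.
rewrite /triple_zone !prednK ?lt0n // b1in b2in b0 !andbT.
have [] := @uniq_min_size _ [:: 0; b1; b2] [:: bl a; bl b; bl c].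
- rewrite /= !inE !negb_or !(eq_sym 0) b10 b20 /= andbT.
  by apply: contraFN xny => /eqP e; rewrite -b1x -b2y e.
- by move=> z; rewrite [z \in [:: 0; _; _]]inE !in_cons in_nil orbF => /or3P[] /eqP->.
- by [].
- by move=> _ e; apply/allP => z; rewrite -e.
Qed.

Definition base_zone (bs : seq nat) : bool := all (pred1 0) bs.

Lemma base_generic :
  (exists den seed retries, core_table false zs p 0 full den seed retries) ->
  generic fitted (determined n [seq t <- all_labels | t.1.1.1 == 0] (on_blocks bl base_zone)).
Proof.
move=> [den [seed [retries]]]; rewrite /core_table => tab.
have lsE : core_labels p (2 * sumn zs) 0 = base_labels p by rewrite /core_labels /= cats0.
have vb b : valid_block (sumn zs) 0 b = (b == 0).
  by rewrite /valid_block leqn0 andb_idr // => /eqP->.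
have [//|||||q Vq dq] := transport_table F (beta := beta) (N := N)
  (Rg := base_zone) (phi := id) (rho := id) (W := fits superblock) tab.
- by move=> b; rewrite vb => /eqP->.
- by move=> a b.
- by move=> a b c _ _ _ /and4P[/eqP-> /eqP-> /eqP-> _]; exists 0, 0, 0; rewrite vb.
- by move=> l l'.
- by rewrite lsE => -[[[K c] d] i] b; rewrite mem_base_labels => /and4P[/eqP-> _ _ _] _.
apply: generic_determined Vq _; apply: determined_sub dq => //.
move=> l; rewrite map_id lsE mem_filter; case: l => [[[K c] d] i]; rewrite mem_base_labels mem_all_labels.
by case/and4P=> /eqP-> -> -> ->.
Qed.

(** All local conditions are generic on the same space, so one parameter meets them all. For it the
    form vanishes on the base block (if [skip]), then on the cores, on the cells meeting two
    superblocks, and on the triples of blocks from three superblocks: an equation that meets cells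
    of one stage otherwise meets only cells known to carry 0. *)
Lemma determined_exists : 0 < j + k ->
  (skip -> exists den seed retries, core_table false zs p 0 full den seed retries) ->
  (forall m, (m == 1) && (0 < j) || (m == 3) && (0 < k) ->
     exists den seed retries, core_table skip zs p m full den seed retries) ->
  (forall m m', (m, m') \in [:: (1, 1); (1, 3); (3, 3)] ->
     exists den seed retries, cross_table m m' den seed retries) ->
  (exists den seed retries, triple_table zs den seed retries) ->
  (exists den seed retries, triple_table [:: 3] den seed retries) ->
  exists q : label -> nat -> nat -> F, determined n all_labels (fun _ _ _ => true) q.
Proof.
move=> jk0 tabB tabC tabX tabT tabT3.
have Vl := @supported_line_closed (fits superblock).
have Vn := supported_nonempty (fits superblock).
pose Good (S : seq label) Rg (q : label -> nat -> nat -> F) := determined n S (on_blocks bl Rg) q.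
pose S0 := [seq t <- all_labels | t.1.1.1 == 0].
pose SX X := [seq t <- all_labels | carried_by X t].
pose ST X := [seq t <- all_labels | pair_in X t].
have gB : generic fitted (fun q => skip -> Good S0 base_zone q).
  case: skip tabB => [/(_ isT)/base_generic|_].
    by apply: generic_imp => q _ + _.
  have [q Vq] := Vn; exists (fun=> 1%R); split=> //.
    by move=> q1 q2; exists 1%R => e; rewrite hornerC.
  by exists q => //; exact: oner_neq0.
have gC : generic fitted (fun q => forall x, x \in iota 0 (j + k) ->
    Good (SX [:: x]) (fun bs => core_zone x bs && core_region skip bs) q).
  apply: generic_all => // x; rewrite mem_iota add0n => /= xjk; apply: (core_generic xjk).
  by apply: tabC; case: ltnP => xj /=; lia.
have gN : generic fitted (fun q => forall e, e \in ordered_pairs (iota 0 (j + k)) ->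
    Good (SX [:: e.1; e.2]) (new_zone e.1 e.2) q).
  apply: generic_all => // -[x y]; rewrite mem_ordered_pairs /= => xy.
  apply: new_generic => //; apply: tabX.
  by case: (ltnP x j) (ltnP y j) => xj [] yj //; lia.
have gT : generic fitted (fun q => forall f, f \in [seq (e, f) | e <- ordered_pairs (iota 0 N), f <- iota 0 N] ->
    f.1.2 < f.2 -> Good (ST [:: f.1.1; f.1.2; f.2]) (triple_zone f.1.1.+1 f.1.2.+1 f.2.+1) q).
  apply: generic_all => // _ /allpairsP[[[c d] e] /= [+ + ->]] /=.
  rewrite mem_ordered_pairs mem_iota !add0n /= => /andP[cd dN] eN.
  (* A triple out of order carries a void condition, for which any generic property serves. *)
  case: (ltnP d e) => de; last by apply: generic_imp (gB) => q _ _.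
  have cde : c < d < e by rewrite cd.
  by apply: generic_imp (triple3_generic cde eN tabT3) => q _ + _.
have [q Vq [qB [qC [qN qT]]]] := generic_ex (generic_conj Vl gB (generic_conj Vl gC (generic_conj Vl gN gT))).
exists q => T _ kT.
have kS S : {subset S <= all_labels} -> forall t, t \in S -> kills n (q t) T.
  by move=> SS t /SS; exact: kT.
have base_sym : symmetric_region base_zone.
  by move=> s s' /perm_mem ss'; rewrite /base_zone (eq_all_r ss').
have ZB : zero_on n bl (fun bs => skip && base_zone bs) T.
  move=> a b c an bn cn /andP[/qB det].
  apply: (zero_on_step (Z := pred0) base_sym _ Vq _ det) => //.
    move=> t b0 c0 d0 c' d'; rewrite mem_filter; case: t => [[[K ?] ?] ?] /= /andP[/eqP-> _].
    by move=> /= /eqP-> /eqP-> /eqP-> /eqP-> ->.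
  by apply: kS => t; rewrite mem_filter => /andP[].
have skip_sym : symmetric_region (fun bs => skip && base_zone bs).
  by move=> s s' /base_sym->.
have ZC x : x < j + k -> zero_on n bl (core_zone x) T.
  move=> xjk.
  have sym : symmetric_region (fun bs => core_zone x bs && core_region skip bs).
    move=> s s' ss'; rewrite (core_zone_sym _ ss') /core_region.
    by rewrite (eq_all_r (perm_mem ss')).
  have Z1 : zero_on n bl (fun bs => core_zone x bs && core_region skip bs) T.
    apply: (zero_on_step sym skip_sym Vq _ (qC x _) _ ZB); rewrite ?mem_iota //.
      move=> t b c d c' d'; rewrite mem_filter => /andP[wt _].
      move=> _ _ /(fits_near wt) nc' /(fits_near wt) nd' /andP[/and4P[nb _ _ _] _].
      rewrite /core_zone /core_region /= nb nc' nd' /= negbK => /andP[->] /=.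
      by rewrite !eqnE !(eq_sym 0).
    by apply: kS => t; rewrite mem_filter => /andP[].
  move=> a b c an bn cn abc; case: (boolP (core_region skip [:: bl a; bl b; bl c])) => [sk|/negbNE].
    by apply: Z1 => //; rewrite abc.
  rewrite /= !eqnE !(eq_sym 0) => sk.
  exact: ZB.
have ZN x y : x < y < j + k -> zero_on n bl (new_zone x y) T.
  move=> /[dup] xy /andP[xly yjk].
  pose Z bs := core_zone x bs || core_zone y bs.
  have Zs : symmetric_region Z.
    by move=> s s' ss'; rewrite /Z (core_zone_sym x ss') (core_zone_sym y ss').
  have ZZ : zero_on n bl Z T.
    by move=> a b c an bn cn /orP[]; apply: ZC => //; exact: ltn_trans yjk.
  apply: (zero_on_step (@new_zone_sym x y) Zs Vq _ (qN (x, y) _) _ ZZ).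
  - move=> t b c d c' d'; rewrite mem_filter => /andP[wt _].
    move=> _ _ /(fits_near wt) nc' /(fits_near wt) nd' /and3P[/and4P[nb _ _ _] _ _].
    rewrite /new_zone [all _ _]/= nb nc' nd' /=.
    have near_not b1 x1 y1 : in_zones [:: x1; y1] b1 -> ~~ in_super x1 b1 -> in_zones [:: y1] b1.
      by rewrite near2 => /or3P[/eqP->|->|/in_super_near] //.
    rewrite negb_and /Z /core_zone /= !negb_or ?andbT ?orbF.
    have near_swap b1 : in_zones [:: x; y] b1 -> in_zones [:: y; x] b1 by rewrite !near2 [in_super x b1 || _]orbC.
    case/orP=> /and3P[nb1 nc1 nd1]; first by rewrite !(near_not _ x y) // orbT.
    by rewrite !(near_not _ y x) //; exact: near_swap.
  - by rewrite mem_ordered_pairs.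
  - by apply: kS => t; rewrite mem_filter => /andP[].
(* This covers all cells within the base block and two superblocks, which may coincide. *)
have two x y a b f : x < j + k -> y < j + k -> a < n -> b < n -> f < n ->
    all (in_zones [:: x; y]) [:: bl a; bl b; bl f] -> T a b f = 0%R.
  wlog xy : x y / x <= y => [H|].
    move=> xjk yjk an bn fn nabf; case: (leqP x y) => [xy|/ltnW yx]; first exact: (H x y).
    apply: (H y x) => //; apply: sub_all nabf => z; rewrite !near2.
    by rewrite [in_super x z || _]orbC.
  move=> xjk yjk an bn fn nabf; move: xy; rewrite leq_eqVlt => /predU1P[xy|xy].
    apply: (ZC x) => //; apply: sub_all nabf => z; rewrite xy near2 orbb.
    by case/orP=> [/eqP->|/in_super_near].
  have near_not x1 y1 : ~~ has (in_super x1) [:: bl a; bl b; bl f] ->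
      all (in_zones [:: x1; y1]) [:: bl a; bl b; bl f] -> core_zone y1 [:: bl a; bl b; bl f].
    move=> /hasPn nx /allP ny; apply/allP => z zin.
    have := ny z zin; rewrite near2 (negPf (nx z zin)) /= => /orP[/eqP->|/in_super_near] //.
  case hx: (has (in_super x) [:: bl a; bl b; bl f]); last first.
    by apply: (ZC y) => //; apply: near_not nabf; rewrite hx.
  case hy: (has (in_super y) [:: bl a; bl b; bl f]); last first.
    apply: (ZC x) => //; apply: (near_not y); rewrite ?hy //; apply: sub_all nabf => z; rewrite !near2.
    by rewrite [in_super x z || _]orbC.
  by apply: (ZN x y); rewrite ?xy // /new_zone nabf hx hy.
(* The base block gets superblock 0 by default, since it lies in the zones of every superblock. *)
pose h b := if b == 0 then 0 else superblock b.-1.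
have h_lt b : b <= N -> h b < j + k.
  by rewrite /h; case: b => //= b bN; rewrite superblock_lt.
have nearl b y : in_zones [:: h b; y] b by rewrite /in_zones /h; case: eqP; rewrite //= inE eqxx.
have nearr b y : in_zones [:: y; h b] b by rewrite /in_zones /h; case: eqP; rewrite //= !inE eqxx orbT.
have near_h b b' y z : superblock b.-1 = superblock b'.-1 -> in_zones [:: y; z] b -> b' != 0 ->
    b != 0 -> in_zones [:: y; z] b'.
  by move=> e nb /negPf b'0 /negPf b0; move: nb; rewrite /in_zones b0 b'0 e.
have bN a : a < n -> bl a <= N by exact: block_of_le.
(* A cell that meets the base block, or has two blocks in one superblock, involves at most two
   superblocks. *)
pose Z (bs : seq nat) := (0 \in bs) || ~~ uniq [seq superblock b.-1 | b <- bs].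
have Zs : symmetric_region Z.
  move=> s s' ss'; rewrite /Z (perm_mem ss').
  by rewrite (perm_uniq (s2 := [seq superblock b.-1 | b <- s'])) // perm_map.
have ZZ : zero_on n bl Z T.
  move=> a b f an bn fn; rewrite /Z.
  have [a0 _|a0] := eqVneq (bl a) 0.
    by apply: (two (h (bl b)) (h (bl f))); rewrite ?h_lt ?bN //= nearl nearr a0.
  have [b0 _|b0] := eqVneq (bl b) 0.
    by apply: (two (h (bl a)) (h (bl f))); rewrite ?h_lt ?bN //= nearl nearr b0.
  have [f0 _|f0] := eqVneq (bl f) 0.
    by apply: (two (h (bl a)) (h (bl b))); rewrite ?h_lt ?bN //= nearl nearr f0.
  rewrite !inE !(eq_sym 0) (negPf a0) (negPf b0) (negPf f0) /= !inE andbT negb_and !negbK.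
  case/orP=> [/orP[]|] /eqP e.
  - apply: (two (h (bl a)) (h (bl f))); rewrite ?h_lt ?bN //= nearl nearr !andbT.
    exact: near_h e (nearl _ _) b0 a0.
  - apply: (two (h (bl a)) (h (bl b))); rewrite ?h_lt ?bN //= nearl nearr !andbT.
    exact: near_h e (nearl _ _) f0 a0.
  - apply: (two (h (bl a)) (h (bl b))); rewrite ?h_lt ?bN //= nearl nearr !andbT.
    exact: near_h e (nearr _ _) f0 b0.
have ZT c d e : c < d < e -> e < N -> uniq [:: superblock c; superblock d; superblock e] ->
    zero_on n bl (triple_zone c.+1 d.+1 e.+1) T.
  move=> cde eN unq.
  have cd : (c, d) \in ordered_pairs (iota 0 N).
    by rewrite mem_ordered_pairs add0n; lia.
  have det : Good (ST [:: c; d; e]) (triple_zone c.+1 d.+1 e.+1) q.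
    apply: (qT (c, d, e)); last by case/andP: cde.
    by apply/allpairsP; exists ((c, d), e); rewrite mem_iota.
  apply: (zero_on_step (@triple_zone_sym _ _ _) Zs Vq _ det _ ZZ); last first.
    by apply: kS => t; rewrite mem_filter => /andP[].
  have [dc de] := andP cde; have ce := ltn_trans dc de.
  have ne := (ltn_eqF dc, ltn_eqF de, ltn_eqF ce, gtn_eqF dc, gtn_eqF de, gtn_eqF ce).
  move=> t b c0 d0 c' d'; rewrite mem_filter => /andP[tm tS].
  have [uv uvin fl] : exists2 uv, uv \in [:: (c.+1, d.+1); (c.+1, e.+1); (d.+1, e.+1)] &
      forall b, fits superblock t b -> b \in [:: uv.1; uv.2].
    case: t tm tS => [[[K c1] d1] i] /= /and3P[/eqP-> c1in d1in].
    rewrite mem_all_labels => /and3P[c1d1 _ _]; exists (c1.+1, d1.+1) => [|b0]; last by rewrite !inE.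
    move: c1in d1in c1d1; rewrite !inE => /or3P[] /eqP-> /or3P[] /eqP->; rewrite ?eqxx ?orbT //;
      by rewrite ltnNge ?leqnn ?(ltnW dc) ?(ltnW de) ?(ltnW ce).
  move=> /fl c0in /fl d0in /fl c'in /fl d'in.
  rewrite {1}/triple_zone /= => /and4P[/andP[bin _] h1 h2 h3].
  move: uvin bin c0in d0in c'in d'in h1 h2 h3; rewrite !inE.
  rewrite /Z /triple_zone /=.
  move=> /or3P[] /eqP-> /= /or3P[] /eqP-> /orP[] /eqP-> /orP[] /eqP-> //;
    rewrite ?eqSS ?ne ?eqxx //= => /orP[] /eqP-> /orP[] /eqP-> _ _ _;
    by rewrite ?inE ?eqSS ?ne ?eqxx ?orbT ?andbF.
move=> a b f an bn fn.
case Zabf: (Z [:: bl a; bl b; bl f]); first exact: ZZ.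
move: Zabf; rewrite /Z !inE !(eq_sym 0) => /norP[/norP[a0 /norP[b0 f0]]] /negPn unq.
have [c ec] : exists c, bl a = c.+1 by case: (bl a) a0 => // c _; exists c.
have [d ed] : exists d, bl b = d.+1 by case: (bl b) b0 => // d _; exists d.
have [e ee] : exists e, bl f = e.+1 by case: (bl f) f0 => // e _; exists e.
have [cN dN eN] : [/\ c < N, d < N & e < N] by rewrite -ec -ed -ee !bN.
have srt c1 d1 e1 : c1 < d1 < e1 -> perm_eq [:: c; d; e] [:: c1; d1; e1] -> T a b f = 0%R.
  move=> cde per; apply: (ZT c1 d1 e1) => //.
  - have : e1 \in [:: c; d; e] by rewrite (perm_mem per) !inE eqxx !orbT.
    by rewrite !inE => /or3P[] /eqP->.
  - have /perm_uniq <- : perm_eq [seq superblock z | z <- [:: c; d; e]] [:: superblock c1; superblock d1; superblock e1].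
      by have := perm_map superblock per.
    by move: unq; rewrite /= ec ed ee.
  have /perm_mem mE : perm_eq [:: bl a; bl b; bl f] [:: c1.+1; d1.+1; e1.+1].
    by rewrite ec ed ee; have := perm_map succn per.
  rewrite /triple_zone !mE !inE !eqxx !orbT !andbT; apply/allP => z; rewrite mE.
  by [].
have per : perm_eq [:: c; d; e] (sort leq [:: c; d; e]) by rewrite perm_sym perm_sort.
have : sorted ltn (sort leq [:: c; d; e]).
  rewrite ltn_sorted_uniq_leq (sort_sorted leq_total) andbT -(perm_uniq per).
  by apply: (map_uniq (f := superblock)); move: unq; rewrite /= ec ed ee.
move: (sort _ _) per => s per; have := perm_size per.
case: s per => [|c1 [|d1 [|e1 [|]]]] //= per _ /and3P[cd de _].
by apply: srt per; rewrite cd de.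
Qed.

End Assembly.

(** * The number of points *)

Section Points.
Variable F : numFieldType.

Definition determinable (n q : nat) := exists p : nat -> nat -> nat -> F,
  determined n (iota 0 q) (fun _ _ _ => true) p.

Lemma determinable_labels (P : eqType) n (S : seq P) (q : P -> nat -> nat -> F) (t0 : P) :
  determined n S (fun _ _ _ => true) q -> determinable n (size S).
Proof.
move=> det; exists (fun t => q (nth t0 S t)) => T T0 kT; apply: det => // t tS.
by rewrite -(nth_index t0 tS); apply: kT; rewrite mem_iota /= index_mem.
Qed.

Lemma determinable_base zs p full den seed retries :
  core_table false zs p 0 full den seed retries -> determinable (sumn zs) p.
Proof.
move=> tab; have := @valid_table_determined F _ _ _ _ _ _ tab.
rewrite /core_labels /= cats0 size_map size_iota muln0 addn0.
by move=> det; eexists; apply: determined_ext det.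
Qed.

Lemma determinable_blocks (skip : bool) zs j k p full : 0 < sumn zs -> 0 < j + k ->
  (skip -> exists den seed retries, core_table false zs p 0 full den seed retries) ->
  (forall m, (m == 1) && (0 < j) || (m == 3) && (0 < k) ->
     exists den seed retries, core_table skip zs p m full den seed retries) ->
  (exists den seed retries, triple_table zs den seed retries) ->
  determinable (sumn zs + 3 * (j + 3 * k))
    (p + 3 * (j + 3 * k) ^ 2 + 2 * sumn zs * (j + 3 * k) + (j + 2 * k)).
Proof.
move=> z0 jk0 tabB tabC tabT.
have [||q det] := determined_exists F z0 jk0 tabB tabC _ tabT.
- move=> m m'; rewrite !inE => /or3P[] /eqP[-> ->].
  + by do 3 eexists; exact: cross1_1_table.
  + by do 3 eexists; exact: cross1_3_table.
  + by do 3 eexists; exact: cross3_3_table.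
- by do 3 eexists; exact: triple3_table.
by rewrite -(size_all_labels j k p z0); exact: (determinable_labels (0, 0, 0, 0) det).
Qed.

Lemma determinable2 : determinable 2 2.
Proof. exact: determinable_base base2_table. Qed.
Lemma determinable3 : determinable 3 5.
Proof. exact: determinable_base base3_table. Qed.

(** The bound on [q.-1] says that [q] is at most n^3/(3n-2) rounded up; this is checked for each
    base size and number of single blocks. *)
Lemma determinable_expected n : 4 <= n ->
  exists2 q, determinable n q & q.-1 * (3 * n - 2) < n ^ 3.
Proof.
move=> n4.
(* With a base block of size 4, these n would leave two single blocks and one point too many. *)
have [n1|n1] := eqVneq (n %% 9) 1.
  have -> : n = 10 + 9 * (n %/ 9).-1 by lia.
  case: (n %/ 9).-1 => [|k]; first by exists 36 => //; exact: determinable_base base10_table.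
  exists (36 + 3 * (3 * k.+1) ^ 2 + 20 * (3 * k.+1) + 2 * k.+1); last by nia.
  have -> : 10 + 9 * k.+1 = sumn [:: 4; 3; 3] + 3 * (0 + 3 * k.+1) by rewrite /=; lia.
  apply: (@determinable_blocks true [:: 4; 3; 3] 0 k.+1 36 99) => //.
  - by move=> _; do 3 eexists; exact: base10_table.
  - by move=> m; rewrite andbF /= andbT => /eqP->; do 3 eexists; exact: core10_3_table.
  - by do 3 eexists; exact: triple10_table.
(* Whether the base size is 2, 3 or 4, there are (n - 2) %/ 3 blocks of size 3; [j] and [k] are the
   remainder and the quotient of this number by 3. *)
pose j := ((n - 2) %/ 3) %% 3; pose k := (n - 2) %/ 9.
have : [|| (n %% 3 == 2) && (n == 2 + 3 * (j + 3 * k)),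
           (n %% 3 == 0) && (n - 1 == 2 + 3 * (j + 3 * k)) |
           [&& n %% 3 == 1, n - 2 == 2 + 3 * (j + 3 * k) & j < 2]] && (j < 3).
  rewrite /j /k; lia.
case/andP=> /or3P[/andP[_ /eqP nE]|/andP[_ /eqP nE]|/and3P[_ /eqP nE j2]] j3.
- exists (2 + 3 * (j + 3 * k) ^ 2 + 4 * (j + 3 * k) + (j + 2 * k)); last first.
    rewrite nE; case: (j) j3 => [|[|[|]]] // _; nia.
  have -> : n = sumn [:: 2] + 3 * (j + 3 * k) by rewrite nE.
  apply: (@determinable_blocks false [:: 2] j k 2 3) => //; first lia.
    by move=> m /orP[] /andP[/eqP-> _]; do 3 eexists; [exact: core2_1_table|exact: core2_3_table].
  by do 3 eexists; exact: triple2_table.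
- exists (4 + 3 * (j + 3 * k) ^ 2 + 6 * (j + 3 * k) + (j + 2 * k)); last first.
    have -> : n = 3 + 3 * (j + 3 * k) by lia.
    case: (j) j3 => [|[|[|]]] // _; nia.
  have -> : n = sumn [:: 3] + 3 * (j + 3 * k) by rewrite /=; lia.
  apply: (@determinable_blocks false [:: 3] j k 4 99) => //; first lia.
    by move=> m /orP[] /andP[/eqP-> _]; do 3 eexists; [exact: core3_1_table|exact: core3_3_table].
  by do 3 eexists; exact: triple3_table.
have [jk0|jk0] := posnP (j + k).
  have -> : n = sumn [:: 4] by rewrite /=; lia.
  by exists 7; first exact: determinable_base base4_table.
exists (7 + 3 * (j + 3 * k) ^ 2 + 8 * (j + 3 * k) + (j + 2 * k)); last first.
  have -> : n = 4 + 3 * (j + 3 * k) by lia.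
  case: (j) j2 => [|[|]] // _; nia.
have -> : n = sumn [:: 4] + 3 * (j + 3 * k) by rewrite /=; lia.
apply: (@determinable_blocks true [:: 4] j k 7 99) => //.
- by move=> _; do 3 eexists; exact: base4_table.
- by move=> m /orP[] /andP[/eqP-> _]; do 3 eexists; [exact: core4_1_table|exact: core4_3_table].
- by do 3 eexists; exact: triple4_table.
Qed.
End Points.

(** * Nonnegative decompositions *)

Section Entries.
Local Open Scope classical_set_scope.
Local Open Scope ring_scope.
Variables (R : realType) (n : nat).
Implicit Types (a : 'I_n -> 'I_n -> 'I_n -> R) (A : hypermatrix R n).

Definition decomposes a (r : nat) := exists u v w : 'I_r -> 'I_n -> R,
  [/\ forall t i, 0 <= u t i, forall t i, 0 <= v t i, forall t i, 0 <= w t i &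
      forall i j k, a i j k = \sum_(t < r) u t i * v t j * w t k].

Lemma decomposableP A r : nonneg_decomposable A r <-> decomposes (fun i j k => A 0 i j k) r.
Proof.
split=> [[u [v [w [pos ->]]]]|[u [v [w [u0 v0 w0 AE]]]]].
  exists (fun t => u t 0), (fun t => v t 0), (fun t => w t 0).
  split; do ?by move=> t i; case: (pos t).
  by move=> i j k; rewrite !summxE; apply: eq_bigr => t _; rewrite !mxE.
exists (fun t => \row_i u t i), (fun t => \row_i v t i), (fun t => \row_i w t i); split.
  by move=> t; split=> i; rewrite mxE.
apply/matrixP => i0 i; rewrite ord1; apply/matrixP => j k; rewrite AE !summxE.
by apply: eq_bigr => t _; rewrite !mxE.
Qed.

Definition hyper_of a : hypermatrix R n := \row_i \matrix_(j, k) a i j k.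

Lemma hyper_ofE a i j k : hyper_of a 0 i j k = a i j k.
Proof. by rewrite !mxE. Qed.

(** Neighbourhoods are boxes in the entrywise distance; conversely, the interior of the set of
    tensors of rank [r] is an open set that contains the centre of the box. *)
Lemma typicalP r : nonneg_typical_rank R n r <->
  exists A : hypermatrix R n, exists2 e : R, 0 < e &
    forall B : hypermatrix R n, (forall i j k, `|B 0 i j k - A 0 i j k| < e) ->
      nonneg_hypermatrix B /\ is_nonneg_rank B r.
Proof.
split=> [[U [Uo [A UA] Ur]]|[A [e e0 Ae]]].
  have /nbhs_ballP[e /= e0 Ue] : nbhs A U by apply: open_nbhs_nbhs.
  exists A, e => // B AB; apply: Ur; apply: Ue.
  split=> // i0 i; rewrite ord1; split=> // j k.
  by rewrite /ball /= distrC AB.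
pose G := [set B : hypermatrix R n | nonneg_hypermatrix B /\ is_nonneg_rank B r].
exists (interior G); split; [exact: open_interior| |exact: interior_subset].
exists A; apply/nbhs_ballP; exists e => // B [_ AB]; apply: Ae => i j k.
by have [_ /(_ j k)] := AB 0 i; rewrite /ball /= distrC.
Qed.

Lemma decomposes_fin (I : finType) (u v w : I -> 'I_n -> R) a :
  (forall t i, 0 <= u t i) -> (forall t i, 0 <= v t i) -> (forall t i, 0 <= w t i) ->
  (forall i j k, a i j k = \sum_t u t i * v t j * w t k) -> decomposes a #|I|.
Proof.
move=> u0 v0 w0 aE; exists (u \o enum_val), (v \o enum_val), (w \o enum_val).
split=> [t i|t i|t i|i j k]; [exact: u0|exact: v0|exact: w0|].
rewrite aE (reindex (fun t : 'I_#|I| => enum_val t)) //=.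
exact: onW_bij (enum_val_bij _).
Qed.

Lemma decomposes_sqr a : (forall i j k, 0 <= a i j k) -> decomposes a (n ^ 2).
Proof.
move=> a0; have -> : (n ^ 2 = #|{: 'I_n * 'I_n}|)%N by rewrite card_prod !card_ord.
apply: (@decomposes_fin _ (fun t i => (t.1 == i)%:R) (fun t j => (t.2 == j)%:R)
  (fun t k => a t.1 t.2 k)) => // i j k.
rewrite (bigD1 (i, j)) //= !eqxx !mul1r big1 ?addr0 // => -[i' j'].
rewrite xpair_eqE negb_and => /orP[] /negPf /= ->; by rewrite ?mulr0 ?mul0r.
Qed.

Lemma decomposes_add a b r s : decomposes a r -> decomposes b s ->
  decomposes (fun i j k => a i j k + b i j k) (r + s).
Proof.
move=> [u [v [w [u0 v0 w0 aE]]]] [u' [v' [w' [u0' v0' w0' bE]]]].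
rewrite -[(r + s)%N](_ : #|{: 'I_r + 'I_s}| = _); last by rewrite card_sum !card_ord.
pose glue (f : 'I_r -> 'I_n -> R) g (t : 'I_r + 'I_s) := match t with inl t => f t | inr t => g t end.
apply: (@decomposes_fin _ (glue u u') (glue v v') (glue w w')); do ?by case.
by move=> i j k; rewrite big_sumType /= aE bE.
Qed.

(* The entry of L at (i, j, k) is 1 if k = i + j mod n and 0 otherwise; two of its 1's
   cannot come from the same rank-one term. *)
Lemma near_latin_rank a r : (0 < n)%N ->
  (forall i j k : 'I_n, `|a i j k - ((i + j) %% n == k)%N%:R| < (n ^ 2).+1%:R^-1) ->
  decomposes a r -> (n ^ 2 <= r)%N.
Proof.
move=> n0; set e := _^-1 => near_a [u [v [w [u0 v0 w0 aE]]]].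
have e0 : 0 < e by rewrite invr_gt0 ltr0Sn.
pose sum_ij (d : 'I_n * 'I_n) : 'I_n := Ordinal (ltn_pmod (d.1 + d.2) n0).
pose term t i j k := u t i * v t j * w t k.
have term0 t i j k : 0 <= term t i j k by rewrite !mulr_ge0.
have term_le t i j k : term t i j k <= a i j k.
  by rewrite aE (bigD1 t) //= lerDl sumr_ge0 // => ? _; exact: term0.
rewrite leqNgt; apply/negP => rn.
(* If all terms were at most [e] at this entry, it would be at most n^2 e = 1 - e, too far from
   1. *)
have large (d : 'I_n * 'I_n) : exists t, e < term t d.1 d.2 (sum_ij d).
  apply/not_existsP => small.
  have : a d.1 d.2 (sum_ij d) <= (n ^ 2)%:R * e.
    rewrite aE; apply: le_trans (_ : r%:R * e <= _).
      rewrite mulr_natl -[X in _ *+ X]card_ord -sumr_const; apply: ler_sum => t _.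
      by rewrite leNgt; apply/negP; exact: small.
    by rewrite ler_wpM2r ?(ltW e0) // ler_nat ltnW.
  have := near_a d.1 d.2 (sum_ij d); rewrite eqxx /= ltr_distl => /andP[+ _].
  have : (n ^ 2).+1%:R * e = 1 by rewrite mulfV // pnatr_eq0.
  rewrite -natr1 mulrDl mul1r; lra.
have [f fP] := choice large.
have /injectivePn[d [d' dd' fdd]] : ~~ injectiveb f.
  by apply/negP => /injectiveP/leq_card; rewrite card_prod !card_ord leqNgt rn.
(* Exchanging an index between two entries of a rank-one term keeps their product but moves both off
   the Latin square, where the term is below [e]. *)
have clash (x y x' y' : R) : e < x -> e < y -> 0 <= x' < e -> 0 <= y' < e -> x * y = x' * y' -> False.
  move=> ex ey /andP[x'0 x'e] /andP[y'0 y'e] E.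
  have : x' * y' <= e * e by rewrite ler_pM // ltW.
  by apply/negP; rewrite -ltNge -E ltr_pM // ltW.
have small t (i j k : 'I_n) : ((i + j) %% n != k)%N -> 0 <= term t i j k < e.
  move=> /negPf nk; rewrite term0 (le_lt_trans (term_le _ _ _ _)) //.
  by have := near_a i j k; rewrite nk subr0; apply: le_lt_trans; exact: ler_norm.
have modn_inj (i i' j : 'I_n) : i != i' -> ((i + j) %% n != (i' + j) %% n)%N.
  by apply: contraNneq => /eqP; rewrite eqn_modDr !modn_small ?ltn_ord.
case: d d' dd' fdd => [i j] [i' j'] dd' fdd.
have H := fP (i, j); have H' := fP (i', j'); rewrite -fdd /= in H'; rewrite /= in H.
have [ii'|ii'] := eqVneq i i'.
  have jj' : j != j' by apply: contraNneq dd' => ->; rewrite ii'.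
  apply: (clash _ _ _ _ H H' (small (f (i, j)) i j' (sum_ij (i, j)) _)
    (small (f (i, j)) i' j (sum_ij (i', j')) _)).
  - by rewrite /= ![(i + _)%N]addnC modn_inj // eq_sym.
  - by rewrite /= ![(i' + _)%N]addnC modn_inj.
  - by rewrite /term; ring.
apply: (clash _ _ _ _ H H' (small (f (i, j)) i' j (sum_ij (i, j)) _)
  (small (f (i, j)) i j' (sum_ij (i', j')) _)).
- by rewrite /= modn_inj // eq_sym.
- by rewrite /= modn_inj.
- by rewrite /term; ring.
Qed.
End Entries.

(** * Ranks that are too small *)

Section Counting.
Local Open Scope ring_scope.
Variable R : realType.

(** Dividing two of the vectors by their largest coordinates leaves 3n - 2 free coordinates; the
    third vector absorbs the factors, and is 0 for a vanishing term. *)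
Lemma normalize_term n (i0 : 'I_n) (u v w : 'I_n -> R) :
  (forall i, 0 <= u i) -> (forall i, 0 <= v i) -> (forall i, 0 <= w i) ->
  exists x : 'I_n * 'I_n * ('I_n -> R) * ('I_n -> R) * ('I_n -> R),
    let: (al, be, u', v', w') := x in
    [/\ forall i, 0 <= u' i <= 1, forall i, 0 <= v' i <= 1, forall i, 0 <= w' i,
        u' al = 1 /\ v' be = 1 & forall i j k, u i * v j * w k = u' i * v' j * w' k].
Proof.
move=> u0 v0 w0.
have max (f : 'I_n -> R) : (forall i, 0 <= f i) -> (forall i, f i = 0) \/
    exists2 al, 0 < f al & forall i, f i <= f al.
  move=> f0; case: (arg_maxP f (isT : xpredT i0)) => al _ fal.
  have [fal0|] := eqVneq (f al) 0; last first.
    by move=> fal0; right; exists al; [rewrite lt_def fal0 f0|move=> i; exact: fal].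
  by left=> i; apply/eqP; rewrite eq_le f0 andbT -fal0; exact: fal.
have null : (forall i j k, u i * v j * w k = 0) -> exists x : 'I_n * 'I_n * ('I_n -> R) * ('I_n -> R) * ('I_n -> R),
    let: (al, be, u', v', w') := x in
    [/\ forall i, 0 <= u' i <= 1, forall i, 0 <= v' i <= 1, forall i, 0 <= w' i,
        u' al = 1 /\ v' be = 1 & forall i j k, u i * v j * w k = u' i * v' j * w' k].
  move=> z; exists (i0, i0, fun=> 1, fun=> 1, fun=> 0).
  by split=> // [i|i|i j k]; rewrite ?ler01 ?lexx // z mulr0.
have [uz|[al ual ule]] := max u u0; first by apply: null => i j k; rewrite uz !mul0r.
have [vz|[be vbe vle]] := max v v0; first by apply: null => i j k; rewrite vz mulr0 mul0r.
exists (al, be, fun i => u i / u al, fun j => v j / v be, fun k => u al * v be * w k).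
split=> [i|j|k||i j k].
- by rewrite divr_ge0 ?(ltW ual) //= ler_pdivrMr // mul1r.
- by rewrite divr_ge0 ?(ltW vbe) //= ler_pdivrMr // mul1r.
- by rewrite !mulr_ge0.
- by rewrite !divff ?gt_eqF.
- by field; rewrite !gt_eqF.
Qed.

Lemma decomposes_normalized n (i0 : 'I_n) (a : 'I_n -> 'I_n -> 'I_n -> R) r (B : R) :
  (forall i j k, a i j k <= B) -> decomposes a r ->
  exists (al be : 'I_r -> 'I_n) (u v w : 'I_r -> 'I_n -> R),
    [/\ forall t i, 0 <= u t i <= 1, forall t i, 0 <= v t i <= 1, forall t i, 0 <= w t i <= B,
        forall t, u t (al t) = 1 /\ v t (be t) = 1 &
        forall i j k, a i j k = \sum_(t < r) u t i * v t j * w t k].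
Proof.
move=> aB [u [v [w [u0 v0 w0 aE]]]].
have [f fP] := choice (fun t => normalize_term i0 (u0 t) (v0 t) (w0 t)).
exists (fun t => (f t).1.1.1.1), (fun t => (f t).1.1.1.2), (fun t => (f t).1.1.2),
  (fun t => (f t).1.2), (fun t => (f t).2).
have {fP} fP t : [/\ forall i, 0 <= (f t).1.1.2 i <= 1, forall i, 0 <= (f t).1.2 i <= 1,
   forall i, 0 <= (f t).2 i, (f t).1.1.2 (f t).1.1.1.1 = 1 /\ (f t).1.2 (f t).1.1.1.2 = 1 &
   forall i j k, u t i * v t j * w t k = (f t).1.1.2 i * (f t).1.2 j * (f t).2 k].
  by move: (fP t); case: (f t) => [[[[? ?] ?] ?] ?].
split=> [t i|t i|t k|t|i j k]; try by case: (fP t).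
(* The entry of [a] at the two normalised positions dominates the third vector, as the other terms
   are nonnegative. *)
- have [_ _ w'0 [ual vbe] E] := fP t; rewrite w'0 /=.
  apply: le_trans (aB (f t).1.1.1.1 (f t).1.1.1.2 k); rewrite aE (bigD1 t) //= E ual vbe !mul1r.
  by rewrite lerDl sumr_ge0 // => s _; rewrite !mulr_ge0.
- by rewrite aE; apply: eq_bigr => t _; case: (fP t).
Qed.

Lemma truncn_close (q : nat) (x y : R) : 0 <= x -> 0 <= y ->
  Num.truncn (x * q%:R) = Num.truncn (y * q%:R) -> `|x - y| * q%:R <= 1.
Proof.
move=> x0 y0 E.
have /truncn_itv/andP[x1 x2] : 0 <= x * q%:R by rewrite mulr_ge0.
have /truncn_itv/andP[y1 y2] : 0 <= y * q%:R by rewrite mulr_ge0.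
rewrite -[q%:R in X in X <= _](ger0_norm (ler0n _ q)) -normrM mulrBl ler_norml.
rewrite -natr1 in x2; rewrite -natr1 in y2; rewrite E in x1 x2; apply/andP; split; lra.
Qed.

Lemma term_close (B d u v w u' v' w' : R) : 0 <= u <= 1 -> 0 <= v <= 1 -> 0 <= w <= B ->
  0 <= u' <= 1 -> 0 <= v' <= 1 -> 0 <= w' <= B ->
  `|u - u'| <= d -> `|v - v'| <= d -> `|w - w'| <= d ->
  `|u * v * w - u' * v' * w'| <= (2 * B + 1) * d.
Proof.
move=> /andP[u0 u1] /andP[v0 v1] /andP[w0 wB] /andP[u'0 u'1] /andP[v'0 v'1] /andP[w'0 w'B] ud vd wd.
have -> : u * v * w - u' * v' * w' =
  (u - u') * (v * w) + u' * (w * (v - v')) + u' * (v' * (w - w')) by ring.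
have d0 : 0 <= d by apply: le_trans ud.
have B0 : 0 <= B by apply: le_trans wB.
have -> : (2 * B + 1) * d = d * (1 * B) + 1 * (B * d) + 1 * (1 * d) by ring.
apply: le_trans (ler_normD _ _) _; apply: lerD; first apply: le_trans (ler_normD _ _) _; first apply: lerD.
- by rewrite !normrM (ger0_norm v0) (ger0_norm w0) !ler_pM // mulr_ge0.
- by rewrite !normrM (ger0_norm u'0) (ger0_norm w0) !ler_pM // mulr_ge0.
- by rewrite !normrM (ger0_norm u'0) (ger0_norm v'0) !ler_pM // mulr_ge0.
Qed.

(* A box holds K ^ (n ^ 3) tensors of a grid of step e / K, while the normalised
   decompositions, with 3n - 2 free parameters per term, take only O(K ^ (m (3n - 2)))
   values up to O(1 / K). *)
Lemma box_not_decomposable n m (a : 'I_n -> 'I_n -> 'I_n -> R) (e : R) :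
  (m * (3 * n - 2) < n ^ 3)%N -> 0 < e ->
  ~ (forall b : 'I_n -> 'I_n -> 'I_n -> R,
       (forall i j k, `|b i j k - a i j k| < e) -> decomposes b m).
Proof.
case: n a => [|n'] a; first by rewrite ltn0.
set n := n'.+1 => mn e0 dec; pose i0 : 'I_n := ord0.
have [Bd Bd0 aB] : exists2 Bd : nat, (0 < Bd)%N & forall i j k, a i j k + e <= Bd%:R.
  pose s := \sum_i \sum_j \sum_k `|a i j k| + e.
  have s0 : 0 <= s by rewrite addr_ge0 ?(ltW e0) // !sumr_ge0 // => ? _; rewrite !sumr_ge0 // => ? _; rewrite sumr_ge0.
  exists (Num.truncn s).+1 => // i j k.
  apply: ltW; apply: le_lt_trans (truncnS_gt s); rewrite lerD2r.
  rewrite (bigD1 i) //= (bigD1 j) //= (bigD1 k) //= -!addrA; apply: le_trans (ler_norm _) _.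
  by rewrite lerDl !addr_ge0 // !sumr_ge0 // => ? _; rewrite !sumr_ge0 // => ? _; rewrite sumr_ge0.
(* When coordinates agree up to 1 / (L K), the sums of [m] terms differ by less than the grid step e
   / K. *)
have [L L0 LP] : exists2 L : nat, (0 < L)%N & m%:R * (2 * Bd%:R + 1) < e * L%:R.
  exists (Num.truncn (m%:R * (2 * Bd%:R + 1) / e)).+1 => //.
  by rewrite [e * _]mulrC -ltr_pdivrMr // truncnS_gt.
(* There are at most X K^(m (3n - 2)) codes, so K = X + 1 leaves fewer codes than the K^(n^3) grid
   tensors. *)
pose X := ((n * n) ^ m * (2 * Bd * L) ^ (m * (3 * n - 2)))%N.
pose K := X.+1; pose M := (Bd * L * K)%N.
pose cell := ('I_n * 'I_n * 'I_n)%type.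
pose grid (c : {ffun cell -> 'I_K}) i j k := a i j k + e * ((c (i, j, k))%:R / K%:R).
have K0 : 0 < K%:R :> R by rewrite ltr0n.
have gridE c i j k : grid c i j k - a i j k = e * ((c (i, j, k))%:R / K%:R).
  by rewrite /grid addrC addKr.
have grid_near c i j k : `|grid c i j k - a i j k| < e.
  rewrite gridE normrM (gtr0_norm e0) gtr_pMr // ger0_norm ?divr_ge0 ?ler0n //.
  by rewrite ltr_pdivrMr // mul1r ltr_nat.
have grid_le c i j k : grid c i j k <= Bd%:R.
  by apply: le_trans (aB i j k); have := grid_near c i j k; rewrite ltr_distl => /andP[_ /ltW].
have normal c := decomposes_normalized i0 (grid_le c) (dec _ (grid_near c)).
have [al {}normal] := choice normal; have [be {}normal] := choice normal.
have [u {}normal] := choice normal; have [v {}normal] := choice normal.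
have [w {}normal] := choice normal.
pose rnd (x : R) : 'I_M.+1 := inord (Num.truncn (x * (L * K)%:R)).
(* The code keeps the positions of the two coordinates equal to 1 and rounds the other
   coordinates. *)
pose code c := [ffun t : 'I_m => ((al c t, be c t),
  ([ffun i : 'I_n' => rnd (u c t (lift (al c t) i))],
   [ffun j : 'I_n' => rnd (v c t (lift (be c t) j))], [ffun k : 'I_n => rnd (w c t k)]))].
have rndP (x y : R) : 0 <= x <= Bd%:R -> 0 <= y <= Bd%:R -> rnd x = rnd y ->
    `|x - y| <= (L * K)%:R^-1.
  have lt (z : R) : 0 <= z <= Bd%:R -> (Num.truncn (z * (L * K)%:R) < M.+1)%N.
    move=> /andP[z0 zB]; rewrite ltnS -(natrK (R := R) M) le_truncn //.
    by rewrite /M -mulnA [X in _ <= X]natrM ler_wpM2r.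
  move=> xB yB /(congr1 val); rewrite /= !inordK ?lt // => E.
  rewrite -[X in _ <= X]mul1r ler_pdivlMr ?ltr0n ?muln_gt0 ?L0 //.
  by apply: truncn_close E; [case/andP: xB|case/andP: yB].
have Bd1 : 1 <= Bd%:R :> R by rewrite ler1n.
have to_Bd (x : R) : 0 <= x <= 1 -> 0 <= x <= Bd%:R.
  by move=> /andP[-> x1]; exact: le_trans Bd1.
have code_inj : injective code.
  move=> c c' E; apply/ffunP => -[[i j] k]; apply/val_inj/eqP.
  have [u1 v1 w1 ab1 gE] := normal c; have [u2 v2 w2 ab2 gE'] := normal c'.
  have close t i1 : [/\ `|u c t i1 - u c' t i1| <= (L * K)%:R^-1,
      `|v c t i1 - v c' t i1| <= (L * K)%:R^-1 & `|w c t i1 - w c' t i1| <= (L * K)%:R^-1].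
    have /ffunP/(_ t) := E; rewrite !ffunE => -[ea eb /ffunP eu /ffunP ev /ffunP ew].
    split.
    - case: (unliftP (al c t) i1) => [i2 ->|->]; last first.
        by rewrite (ab1 t).1 ea (ab2 t).1 subrr normr0 invr_ge0.
      apply: rndP; [exact: to_Bd|exact: to_Bd|].
      by have := eu i2; rewrite !ffunE -ea.
    - case: (unliftP (be c t) i1) => [i2 ->|->]; last first.
        by rewrite (ab1 t).2 eb (ab2 t).2 subrr normr0 invr_ge0.
      apply: rndP; [exact: to_Bd|exact: to_Bd|].
      by have := ev i2; rewrite !ffunE -eb.
    - by apply: rndP => //; have := ew i1; rewrite !ffunE.
  have diff : `|grid c i j k - grid c' i j k| < e / K%:R.
    rewrite gE gE' -sumrB; apply: le_lt_trans (ler_norm_sum _ _ _) _.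
    apply: (@le_lt_trans _ _ (\sum_(t < m) (2 * Bd%:R + 1) * (L * K)%:R^-1)).
      apply: ler_sum => t _; apply: term_close => //; by [case: (close t i)|case: (close t j)|case: (close t k)].
    rewrite sumr_const card_ord -[X in X < _]mulr_natl mulrA natrM invfM mulrA ltr_pM2r ?invr_gt0 //.
    by rewrite ltr_pdivrMr ?ltr0n.
  move: diff; rewrite /grid opprD addrACA subrr add0r -mulrBr -mulrBl.
  rewrite normrM (gtr0_norm e0) ltr_pM2l // normrM [`|K%:R^-1|]gtr0_norm ?invr_gt0 // gtr_pMl ?invr_gt0 //.
  rewrite ltr_norml => /andP[H1 H2].
  have lt x y : x%:R - y%:R < 1 :> R -> (x <= y)%N.
    by rewrite ltrBlDr addrC natr1 ltr_nat ltnS.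
  by rewrite eqn_leq !lt // -ltrN2 opprB.
have := leq_card code code_inj.
rewrite !(card_ffun, card_prod, card_ord) -/n.
have M_le : (M.+1 <= 2 * Bd * L * K)%N.
  by rewrite /M -!mulnA mul2n -addnn -addn1 leq_add2l !muln_gt0 Bd0 L0.
move=> le1.
have : (K ^ (m * (3 * n - 2)).+1 <= X * K ^ (m * (3 * n - 2)))%N.
  have le3 : (K ^ (m * (3 * n - 2)).+1 <= K ^ (n * n * n))%N.
    by rewrite leq_pexp2l // (leq_trans mn) // !expnS expn0 muln1 mulnA.
  apply: leq_trans le3 (leq_trans le1 _).
  have -> : (X * K ^ (m * (3 * n - 2)) = (n * n * (2 * Bd * L * K) ^ (3 * n - 2)) ^ m)%N.
    by rewrite /X -[LHS]mulnA -[in LHS]expnMn [in RHS]expnMn -[in RHS]expnM [in RHS](mulnC (3 * n - 2)%N).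
  case: (posnP m) => [->//|m0]; rewrite leq_exp2r // -!mulnA !leq_mul2l /= -!expnD.
  have -> : (n' + (n' + n) = 3 * n - 2)%N by rewrite /n; lia.
  by rewrite leq_exp2r; [rewrite ?mulnA|rewrite /n; lia].
by rewrite expnS leq_pmul2r ?expn_gt0 // /K ltnn.
Qed.
End Counting.

(** * Strassen's determinant *)

Section CommutatorFlattening.
Local Open Scope ring_scope.

Lemma I3_ind (P : 'I_3 -> Prop) : P (@Ordinal 3 0 isT) -> P (@Ordinal 3 1 isT) ->
  P (@Ordinal 3 2 isT) -> forall i, P i.
Proof.
move=> P0 P1 P2 i; case: i => m; case: m => [|m] lt; first by rewrite (bool_irrelevance lt isT).
case: m lt => [|m] lt; first by rewrite (bool_irrelevance lt isT).
by case: m lt => [|m] lt; first by rewrite (bool_irrelevance lt isT).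
Qed.

Lemma sum_I3 (V : nmodType) (f : 'I_3 -> V) :
  \sum_i f i = f (@Ordinal 3 0 isT) + f (@Ordinal 3 1 isT) + f (@Ordinal 3 2 isT).
Proof.
rewrite !big_ord_recr big_ord0 Monoid.mul1m.
by congr (_ + _ + _); congr (f _); apply: val_inj.
Qed.

Section Strassen.
Variable R : realType.
Let pair := ('I_3 * 'I_3)%type.
Local Notation N := #|{: pair}|.

Definition levi_civita_int (a b l : nat) : int :=
  match a, b, l with
  | 0, 1, 2 | 1, 2, 0 | 2, 0, 1 => 1
  | 0, 2, 1 | 1, 0, 2 | 2, 1, 0 => -1
  | _, _, _ => 0
  end.
Definition levi_civita (a b l : 'I_3) : R := (levi_civita_int a b l)%:~R.

(** Strassen's 9 x 9 matrix: a skew 3 x 3 arrangement of the slices of [x], with signs given by the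
    Levi-Civita symbol. *)
Definition flattening (x : 'I_3 -> 'I_3 -> 'I_3 -> R) : 'M[R]_N :=
  \matrix_(p, q) let: (a, j) := (enum_val p : pair) in let: (b, k) := (enum_val q : pair) in
    \sum_l levi_civita a b l * x l j k.

Lemma levi_civita_skew a b l : levi_civita b a l = - levi_civita a b l.
Proof.
rewrite /levi_civita -rmorphN; congr (_%:~R).
by elim/I3_ind: a; elim/I3_ind: b; elim/I3_ind: l.
Qed.

Lemma levi_civita_le1 a b l : `|levi_civita a b l| <= 1.
Proof.
rewrite /levi_civita -intr_norm lerz1.
by elim/I3_ind: a; elim/I3_ind: b; elim/I3_ind: l.
Qed.

Lemma levi_civita_mul (a b j k : 'I_3) : \sum_l levi_civita a b l * levi_civita l j k =
  (a == j)%:R * (b == k)%:R - (a == k)%:R * (b == j)%:R.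
Proof.
rewrite sum_I3 /levi_civita -!natrM -!(rmorph_nat (intr : int -> R)) -!rmorphM -!rmorphD -rmorphB.
congr (_%:~R).
by elim/I3_ind: a; elim/I3_ind: b; elim/I3_ind: j; elim/I3_ind: k.
Qed.

(** The flattening factors through the skew 3 x 3 matrix of [u], which is singular because its size
    is odd. *)
Lemma flattening_rank1 (u v w : 'I_3 -> R) :
  (\rank (flattening (fun i j k => u i * v j * w k)%R) <= 2)%N.
Proof.
pose X : 'M[R]_3 := \matrix_(a, b) \sum_l levi_civita a b l * u l.
have rX : (\rank X <= 2)%N.
  rewrite -ltnS ltn_neqAle rank_leq_row andbT; apply/negP => full.
  have : X \in unitmx by rewrite -row_free_unit.
  have skew : X^T = (-1) *: X.
    apply/matrixP => a b; rewrite !mxE mulN1r -sumrN; apply: eq_bigr => l _.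
    by rewrite levi_civita_skew mulNr.
  have := congr1 determinant skew; rewrite det_tr detZ -signr_odd expr1 mulN1r unitmxE unitfE.
  by move=> d; apply/negP/negPn/eqP; lra.
pose P : 'M[R]_(N, 3) := \matrix_(p, c) (((enum_val p : pair).1 == c)%:R * v (enum_val p : pair).2).
pose Q : 'M[R]_(3, N) := \matrix_(c, q) (((enum_val q : pair).1 == c)%:R * w (enum_val q : pair).2).
have -> : flattening (fun i j k => u i * v j * w k) = P *m X *m Q.
  apply/matrixP => p q; rewrite !mxE.
  case Ep: (enum_val p) => [a j]; case Eq: (enum_val q) => [b k].
  rewrite [RHS](bigD1 b) //= [X in _ + X]big1 ?addr0 => [|b' bb']; last first.
    by rewrite !mxE Eq /= eq_sym (negPf bb') mul0r mulr0.
  rewrite !mxE Eq /= eqxx mul1r [in RHS](bigD1 a) //= [X in (_ + X) * _]big1 ?addr0 => [|a' aa']; last first.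
    by rewrite !mxE Ep /= eq_sym (negPf aa') !mul0r.
  rewrite !mxE Ep /= eqxx mul1r mulr_sumr mulr_suml; apply: eq_bigr => l _; ring.
by apply: leq_trans (mxrankM_maxl _ _) (leq_trans (mxrankM_maxr _ _) rX).
Qed.

Lemma flattening_rank x r : decomposes x r -> (\rank (flattening x) <= 2 * r)%N.
Proof.
move=> [u [v [w [_ _ _ xE]]]].
have -> : flattening x = \sum_(t < r) flattening (fun i j k => u t i * v t j * w t k).
  apply/matrixP => p q; rewrite summxE !mxE.
  under [in RHS]eq_bigr do rewrite mxE.
  case: (enum_val p) => a j; case: (enum_val q) => b k.
  rewrite exchange_big /=; apply: eq_bigr => l _; rewrite xE mulr_sumr.
  by [].
have rank_sum (f : 'I_r -> 'M[R]_N) : (forall t, \rank (f t) <= 2)%N ->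
    (\rank (\sum_(t < r) f t)%R <= 2 * r)%N.
  move=> f2; elim: {u v w xE} r f f2 => [|r IH] f f2; first by rewrite big_ord0 mxrank0.
  rewrite big_ord_recr /= mulnS addnC; apply: leq_trans (mxrank_add _ _) _.
  by rewrite leq_add // IH // => t; exact: f2.
by apply: rank_sum => t; exact: flattening_rank1.
Qed.

(* The flattening of the Levi-Civita tensor is x |-> (tr x) 1 - x^T. *)
Lemma flattening_levi_civita_unit : flattening levi_civita \in unitmx.
Proof.
pose K : 'M[R]_N := \matrix_(p, q) let: (b, k) := (enum_val p : pair) in let: (c, d) := (enum_val q : pair) in
  (b == k)%:R * (c == d)%:R / 2 - (k == c)%:R * (b == d)%:R.
suff /mulmx1_unit[] : flattening levi_civita *m K = 1%:M by [].
apply/matrixP => p q; rewrite !mxE -(inj_eq enum_val_inj).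
case Ep: (enum_val p) => [a j]; case Eq: (enum_val q) => [c d].
have sel (F : 'I_3 -> R) x : \sum_y (x == y)%:R * F y = F x.
  rewrite (bigD1 x) //= eqxx mul1r big1 ?addr0 // => y.
  by rewrite eq_sym => /negPf->; rewrite mul0r.
pose Kf (b k : 'I_3) : R := (b == k)%:R * (c == d)%:R / 2 - (k == c)%:R * (b == d)%:R.
transitivity (\sum_b \sum_k ((a == j)%:R * (b == k)%:R - (a == k)%:R * (b == j)%:R) * Kf b k).
  rewrite pair_bigA (reindex (fun i : 'I_N => enum_val i) (onW_bij _ (enum_val_bij _))) /=.
  apply: eq_bigr => i _; rewrite !mxE Ep Eq; case: (enum_val i) => b k.
  by rewrite levi_civita_mul.
transitivity (\sum_b ((a == j)%:R * Kf b b - (j == b)%:R * Kf b a)).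
  apply: eq_bigr => b _; rewrite -(sel (fun k => (a == j)%:R * Kf b k) b).
  rewrite -(sel (fun k => (j == b)%:R * Kf b k) a) -sumrB; apply: eq_bigr => k _.
  by rewrite [j == b]eq_sym; ring.
have tr : \sum_b Kf b b = (c == d)%:R / 2.
  have -> : (c == d)%:R = \sum_b (c == b)%:R * (b == d)%:R :> R by rewrite sel.
  under eq_bigr do rewrite /Kf eqxx [_ == c]eq_sym mul1r.
  by rewrite sumrB sel sumr_const card_ord -mulr_natl; lra.
rewrite sumrB sel -mulr_sumr tr /Kf xpair_eqE -mulnb natrM [j == a]eq_sym; ring.
Qed.

(** Four terms give a flattening of rank at most 8. Adding [s] times the Levi-Civita tensor makes it
    invertible unless [s] is an eigenvalue of [G], and arbitrarily small [s] avoid the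
    eigenvalues. *)
Lemma box3_not_decomposable (a : 'I_3 -> 'I_3 -> 'I_3 -> R) (e : R) : 0 < e ->
  ~ (forall b : 'I_3 -> 'I_3 -> 'I_3 -> R,
       (forall i j k, `|b i j k - a i j k| < e) -> decomposes b 4).
Proof.
move=> e0 dec; pose E := flattening levi_civita; pose G := - (flattening a *m invmx E).
have xinj : injective (fun i : nat => e / i.+2%:R).
  by move=> i j /(mulfI (lt0r_neq0 e0))/invr_inj/eqP; rewrite eqr_nat => /eqP[].
have [i] := nonroot xinj (monic_neq0 (char_poly_monic G)).
set s := e / _ => /negP; apply; rewrite -/(root _ _) -eigenvalue_root_char.
have s0 : 0 < s by rewrite divr_gt0.
have se : s < e by rewrite ltr_pdivrMr // ltr_pMr // ltr1n.
pose b i j k := a i j k + s * levi_civita i j k.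
have /flattening_rank rb : decomposes b 4.
  apply: dec => p q r; rewrite /b addrC addKr normrM (gtr0_norm s0).
  by apply: le_lt_trans se; apply: ler_piMr; [exact: ltW|exact: levi_civita_le1].
have bE : flattening b = flattening a + s *: E.
  apply/matrixP => p q; rewrite !mxE; case: (enum_val p) => x j; case: (enum_val q) => y k.
  by rewrite mulr_sumr -big_split /=; apply: eq_bigr => l _; rewrite /b; ring.
rewrite /eigenvalue /eigenspace kermx_eq0 row_free_unit.
have -> : G - s%:M = - (flattening b *m invmx E).
  by rewrite bE mulmxDl -scalemxAl mulmxV ?flattening_levi_civita_unit // scalemx1 opprD.
apply/negP => bu; have : flattening b \in unitmx.
  have -> : flattening b = - (- (flattening b *m invmx E)) *m E.
    by rewrite opprK mulmxKV // flattening_levi_civita_unit.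
  by rewrite unitmx_mul flattening_levi_civita_unit andbT unitmxE -scaleN1r detZ unitrM unitrX ?unitrN1 //= -unitmxE.
rewrite -row_free_unit => /eqP full; move: rb; rewrite full.
by rewrite card_prod !card_ord.
Qed.
End Strassen.

End CommutatorFlattening.

(** * Typical ranks *)

HB.instance Definition _ (R : realType) (n : nat) := Complete.on 'cV[R]_n.

(** * Solving an equation with a small nonlinear part by contraction *)

Section LocalSolve.
Local Open Scope classical_set_scope.
Local Open Scope ring_scope.
Variables (R : realType) (N : nat).
Let V := 'cV[R]_N.
Implicit Types (x y z : V) (f g : V -> R).

Lemma entry_le_norm z i : `|z i 0| <= `|z|.
Proof.
rewrite [leRHS]/Num.Def.normr /= mx_normrE.
exact: (le_bigmax _ (fun ij : 'I_N * 'I_1 => `|z ij.1 ij.2|) (i, 0)).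
Qed.

Lemma norm_le_entries z c : 0 <= c -> (forall i, `|z i 0| <= c) -> `|z| <= c.
Proof.
move=> c0 zc; rewrite /Num.Def.normr /= mx_normrE; apply: bigmax_le => // -[i j] _ /=.
by rewrite ord1.
Qed.

Definition lipschitz0 f := exists2 C, 0 <= C &
  (forall x, `|f x| <= C * `|x|) /\ (forall x y, `|f x - f y| <= C * `|x - y|).
(** The estimate satisfied by polynomials without constant and linear terms; restricting to the unit
    ball lets cubic terms satisfy it too. *)
Definition quadratic f := exists2 K, 0 <= K & f 0 = 0 /\ forall x y, `|x| <= 1 -> `|y| <= 1 ->
  `|f x - f y| <= K * (`|x| + `|y|) * `|x - y|.

Lemma lipschitz0_linear (W : 'rV[R]_N) : lipschitz0 (fun z => (W *m z) 0 0).
Proof.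
have C0 : 0 <= \sum_j `|W 0 j| by apply: sumr_ge0.
have bd z : `|(W *m z) 0 0| <= (\sum_j `|W 0 j|) * `|z|.
  rewrite mxE mulr_suml; apply: le_trans (ler_norm_sum _ _ _) _; apply: ler_sum => j _.
  by rewrite normrM ler_wpM2l // entry_le_norm.
exists (\sum_j `|W 0 j|) => //; split=> // x y.
have -> : (W *m x) 0 0 - (W *m y) 0 0 = (W *m (x - y)) 0 0 by rewrite mulmxBr !mxE.
exact: bd.
Qed.

Lemma quadratic_sum (I : finType) (P : pred I) (F : I -> V -> R) : (forall i, quadratic (F i)) ->
  quadratic (fun z => \sum_(i | P i) F i z).
Proof.
move=> /fin_all_exists2[K K0 KP]; exists (\sum_(i | P i) K i); first exact: sumr_ge0.
split=> [|x y x1 y1]; first by rewrite big1 // => i _; case: (KP i).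
rewrite -sumrB !mulr_suml; apply: le_trans (ler_norm_sum _ _ _) _; apply: ler_sum => i _.
by case: (KP i) => _; apply.
Qed.

Lemma quadraticD f g : quadratic f -> quadratic g -> quadratic (fun z => f z + g z).
Proof.
move=> [K K0 [f0 fK]] [L L0 [g0 gL]]; exists (K + L); first exact: addr_ge0.
split=> [|x y x1 y1]; first by rewrite f0 g0 addr0.
rewrite opprD addrACA !mulrDl; apply: le_trans (ler_normD _ _) _.
by rewrite lerD // ?fK ?gL.
Qed.

Lemma quadraticZ f c : quadratic f -> quadratic (fun z => f z * c).
Proof.
move=> [K K0 [f0 fK]]; exists (K * `|c|); first exact: mulr_ge0.
split=> [|x y x1 y1]; first by rewrite f0 mul0r.
rewrite -mulrBl normrM [K * _]mulrC -!mulrA mulrC ler_wpM2l //.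
by rewrite mulrA fK.
Qed.

Lemma quadraticM f g : lipschitz0 f -> lipschitz0 g -> quadratic (fun z => f z * g z).
Proof.
move=> [C C0 [fC fD]] [D D0 [gC gD]]; exists (C * D); first exact: mulr_ge0.
split=> [|x y _ _].
  have := fC 0; rewrite normr0 mulr0 normr_le0 => /eqP->; by rewrite mul0r.
have -> : f x * g x - f y * g y = f x * (g x - g y) + g y * (f x - f y) by ring.
have -> : C * D * (`|x| + `|y|) * `|x - y| =
  (C * `|x|) * (D * `|x - y|) + (D * `|y|) * (C * `|x - y|) by ring.
apply: le_trans (ler_normD _ _) _.
by rewrite !normrM lerD // ler_pM.
Qed.

Lemma quadraticMl f g : quadratic f -> lipschitz0 g -> quadratic (fun z => f z * g z).
Proof.
move=> [K K0 [f0 fK]] [D D0 [gC gD]]; exists (2 * K * D); first by rewrite !mulr_ge0.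
split=> [|x y x1 y1]; first by rewrite f0 mul0r.
have fy : `|f y| <= K * `|y|.
  have := fK y 0 y1; rewrite normr0 ler01 f0 !subr0 addr0 => /(_ isT) /le_trans; apply.
  by rewrite ler_piMr // mulr_ge0.
have gx : `|g x| <= D by apply: le_trans (gC x) _; rewrite ler_piMr.
have -> : f x * g x - f y * g y = (f x - f y) * g x + f y * (g x - g y) by ring.
apply: le_trans (ler_normD _ _) _; rewrite !normrM.
apply: (@le_trans _ _ (K * (`|x| + `|y|) * `|x - y| * D + K * `|y| * (D * `|x - y|))).
  by apply: lerD; apply: ler_pM => //; exact: fK.
have : 0 <= K * `|x| * `|x - y| * D by rewrite !mulr_ge0.
lra.
Qed.

(** For small [r] the map z |-> w - H z has Lipschitz constant at most 2 L r <= 1/2 on the ball of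
    radius [r], and preserves it because |w| <= r/2 and |H z| <= L r^2 <= r/4. *)
Lemma local_solve (H : V -> V) : (forall i, quadratic (fun z => H z i 0)) ->
  exists2 r0, 0 < r0 & forall r, 0 < r -> r <= r0 -> forall w, `|w| <= r / 2 ->
    exists2 z, `|z| <= r & z = w - H z.
Proof.
move=> /fin_all_exists2[K K0 KP]; pose L := \sum_i K i.
have L0 : 0 <= L by exact: sumr_ge0.
have H0 : H 0 = 0 by apply/matrixP => i j; rewrite ord1 mxE; case: (KP i).
have HL x y : `|x| <= 1 -> `|y| <= 1 -> `|H x - H y| <= L * (`|x| + `|y|) * `|x - y|.
  move=> x1 y1; apply: norm_le_entries => [|i]; first by rewrite !mulr_ge0 // addr_ge0.
  rewrite !mxE; case: (KP i) => _ /(_ x y x1 y1) /le_trans; apply.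
  rewrite !ler_wpM2r ?addr_ge0 // /L (bigD1 i) //= lerDl.
  by rewrite sumr_ge0.
exists (4 * (L + 1))^-1; first by rewrite invr_gt0 mulr_gt0 // ltr_wpDl.
move=> r r0 rL w wr.
have Lr : 4 * (L * r) <= 1 /\ r <= 1.
  have : r * (4 * (L + 1)) <= 1.
    by rewrite -ler_pdivlMr ?mul1r // mulr_gt0 // ltr_wpDl.
  have := mulr_ge0 L0 (ltW r0); split; lra.
pose U : set V := [set z | `|z| <= r].
have U1 z : U z -> `|z| <= 1 by move=> /le_trans; apply; exact: Lr.2.
have fU : {homo (fun z => w - H z) : z / U z >-> U z}.
  move=> z Uz; rewrite /U /=; apply: le_trans (ler_normB _ _) _.
  have := HL z 0 (U1 _ Uz); rewrite normr0 ler01 H0 !subr0 addr0 => /(_ isT) Hz.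
  have : `|H z| <= L * r * r.
    apply: le_trans Hz _; rewrite ler_pM // ?mulr_ge0 // ler_wpM2l //.
  have := ler_wpM2r (ltW r0) Lr.1; lra.
pose f : {fun U >-> U} := mkfun fU.
have ctr : is_contraction f.
  have half0 : 0 <= 2^-1 :> R by rewrite invr_ge0.
  exists (NngNum half0); split; first by rewrite /= invf_lt1 ?ltr1n.
  move=> [x y] [/= Ux Uy]; rewrite /f /=.
  have -> : w - H x - (w - H y) = - (H x - H y) by rewrite opprD addrACA subrr add0r opprB opprK addrC.
  rewrite normrN; apply: le_trans (HL _ _ (U1 _ Ux) (U1 _ Uy)) _.
  rewrite ler_wpM2r //.
  apply: (@le_trans _ _ (L * (r + r))); first by rewrite ler_wpM2l // lerD.
  have := Lr.1; lra.
have clU : closed U by apply: (preimage_closed _ (@closed_le R r)) => z _; exact: norm_continuous.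
have [|z Uz zE] := banach_fixed_point ctr clU; first by exists 0; rewrite /U /= normr0 ltW.
by exists z.
Qed.
End LocalSolve.

(** * The differential of a sum of rank-one terms *)

Section Tangent.
Local Open Scope ring_scope.
Variables (R : realType) (n : nat).
Let cell := ('I_n * 'I_n * 'I_n)%type.
Local Notation N := #|{: cell}|.

Definition derivative (p d : nat -> nat -> R) (a b c : nat) : R :=
  d 0%N a * p 1%N b * p 2%N c + p 0%N a * d 1%N b * p 2%N c + p 0%N a * p 1%N b * d 2%N c.

(** The transposed system matrix is the differential. A left inverse [B] of the system becomes,
    after transposition, a right inverse of the differential; the rows [W] give the directions as
    linear functions of [z]. *)
Lemma tangent_inverse_seq (S : seq nat) (p : nat -> nat -> nat -> R) :
  determined n S (fun _ _ _ => true) p ->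
  exists W : nat -> nat -> nat -> 'rV[R]_N, forall (z : 'cV[R]_N) (a b c : 'I_n),
    z (enum_rank (a, b, c)) 0 =
    \sum_(t < size S) derivative (p (nth 0 S t)) (fun s x => (W t s x *m z) 0 0) a b c.
Proof.
move=> /sysmxP/trivial_kernel_minor[g dg].
set M := sysmx n S _ p in g dg.
pose B := invmx (rowsub g M) *m rowsub g 1%:M.
have BM : B *m M = 1%:M.
  by rewrite -mulmxA mul_rowsub_mx mul1mx mulVmx // unitmxE unitfE.
pose row_of (t : 'I_(size S)) (s : 'I_3) (x : 'I_n) : 'rV[R]_N := row (enum_rank (inl (t, s, x))) B^T.
pose W t s x : 'rV[R]_N := if insub t is Some t' then if insub s is Some s' then
  if insub x is Some x' then row_of t' s' x' else 0 else 0 else 0.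
have WE (t : 'I_(size S)) (s : 'I_3) (x : 'I_n) : W t s x = row_of t s x.
  by rewrite /W !valK.
exists W => z a b c; set j := enum_rank (a, b, c).
have -> : z j 0 = \sum_i M i j * (B^T *m z) i 0.
  have : M^T *m (B^T *m z) = z by rewrite mulmxA -trmx_mul BM trmx1 mul1mx.
  by move/matrixP/(_ j 0); rewrite mxE => <-; apply: eq_bigr => i _; rewrite mxE.
rewrite (reindex (fun e => enum_rank e) (onW_bij _ (enum_rank_bij _))) big_sumType /= [X in _ + X]big1 ?addr0; last first.
  by move=> d _; rewrite [M _ _]mxE !enum_rankK /= !mul0r.
have pairE (I J : finType) (f : I * J -> R) : \sum_i f i = \sum_x \sum_y f (x, y).
  by rewrite pair_bigA; apply: eq_bigr => -[].
rewrite !pairE /=.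
apply: eq_bigr => t _; rewrite sum_I3 /derivative.
have E (s : 'I_3) (x : 'I_n) : (B^T *m z) (enum_rank (inl (t, s, x))) 0 = (W t s x *m z) 0 0.
  by rewrite WE -row_mul [RHS]mxE.
have ME s x : M (enum_rank (inl (t, s, x))) j = coef (p (nth 0 S t)) s x a b c.
  by rewrite mxE enum_rankK /j enum_rankK (tnth_nth 0).
have sel (x : 'I_n) (F : 'I_n -> R) : \sum_(y < n) (x == y :> nat)%:R * F y = F x.
  rewrite (bigD1 x) //= eqxx mul1r big1 ?addr0 // => y.
  by rewrite -val_eqE eq_sym /= => /negPf->; rewrite mul0r.
congr (_ + _ + _).
- rewrite -(sel a (fun x => (W t 0 x *m z) 0 0 * p (nth 0 S t) 1%N b * p (nth 0 S t) 2%N c)).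
  by apply: eq_bigr => x _; rewrite ME E /coef /=; ring.
- rewrite -(sel b (fun x => p (nth 0 S t) 0%N a * (W t 1%N x *m z) 0 0 * p (nth 0 S t) 2%N c)).
  by apply: eq_bigr => x _; rewrite ME E /coef /=; ring.
- rewrite -(sel c (fun x => p (nth 0 S t) 0%N a * p (nth 0 S t) 1%N b * (W t 2%N x *m z) 0 0)).
  by apply: eq_bigr => x _; rewrite ME E /coef /=; ring.
Qed.

Lemma tangent_inverse m (p : nat -> nat -> nat -> R) :
  determined n (iota 0 m) (fun _ _ _ => true) p ->
  exists W : nat -> nat -> nat -> 'rV[R]_N, forall (z : 'cV[R]_N) (a b c : 'I_n),
    z (enum_rank (a, b, c)) 0 =
    \sum_(t < m) derivative (p t) (fun s x => (W t s x *m z) 0 0) a b c.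
Proof.
move=> /tangent_inverse_seq[W]; rewrite size_iota => WE; exists W => z a b c.
by rewrite WE; apply: eq_bigr => t _; rewrite nth_iota.
Qed.

Definition tensor (p : nat -> nat -> nat -> R) (m : nat) (a b c : nat) : R :=
  \sum_(t < m) p t 0%N a * p t 1%N b * p t 2%N c.

(** A submersion theorem with bounds: along the directions given by the right inverse the linear
    part is the identity, and [H] collects the terms of order two and three. *)
Lemma tensor_open m (p : nat -> nat -> nat -> R) (e : R) : 0 < e ->
  determined n (iota 0 m) (fun _ _ _ => true) p ->
  exists2 eta, 0 < eta & forall Y : 'I_n -> 'I_n -> 'I_n -> R,
    (forall a b c, `|Y a b c - tensor p m a b c| <= eta) ->
    exists2 q : nat -> nat -> nat -> R, (forall (t : 'I_m) (s : 'I_3) (x : 'I_n), `|q t s x - p t s x| <= e) &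
      forall a b c, Y a b c = tensor q m a b c.
Proof.
move=> e0 /tangent_inverse[W WE].
pose d (z : 'cV[R]_N) t s x := (W t s x *m z) 0 0.
pose Q z t a b c := d z t 0 a * d z t 1 b * p t 2 c + d z t 0 a * d z t 2 c * p t 1 b +
  d z t 1 b * d z t 2 c * p t 0 a + d z t 0 a * d z t 1 b * d z t 2 c.
pose H z : 'cV[R]_N := \col_j let: (a, b, c) := (enum_val j : cell) in \sum_(t < m) Q z t a b c.
have lip t s x : lipschitz0 (fun z => d z t s x) by exact: lipschitz0_linear.
have quadH j : quadratic (fun z => H z j 0).
  suff : quadratic (fun z => let: (a, b, c) := (enum_val j : cell) in \sum_(t < m) Q z t a b c).
    by congr quadratic; apply: funext => z; rewrite mxE.
  case: (enum_val j) => -[a b] c; apply: quadratic_sum => t.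
  apply: quadraticD; last by apply: quadraticMl => //; exact: quadraticM.
  by do 2?[apply: quadraticD]; apply: quadraticZ; exact: quadraticM.
have [r0 r00 solve] := local_solve quadH.
have [C C0 dC] : exists2 C, 0 < C & forall z (t : 'I_m) (s : 'I_3) (x : 'I_n), `|d z t s x| <= C * `|z|.
  have [c c0 cP] := fin_all_exists2 (fun i : 'I_m * 'I_3 * 'I_n => lip i.1.1 i.1.2 i.2).
  exists (1 + \sum_i c i); first by rewrite ltr_wpDr // sumr_ge0.
  move=> z t s x; have [/(_ z) /le_trans + _] := cP (t, s, x); apply.
  rewrite ler_wpM2r // (bigD1 (t, s, x)) //= addrCA lerDl addr_ge0 // sumr_ge0 //.
pose r := Num.min r0 (e / C).
have r_gt0 : 0 < r by rewrite lt_min r00 divr_gt0.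
exists (r / 2) => [|Y YP]; first by rewrite divr_gt0.
pose w : 'cV[R]_N := \col_j let: (a, b, c) := (enum_val j : cell) in Y a b c - tensor p m a b c.
have wr : `|w| <= r / 2.
  apply: norm_le_entries => [|j]; first by rewrite ltW // divr_gt0.
  by rewrite mxE; case: (enum_val j) => -[a b] c; exact: YP.
have [|z zr zE] := solve r r_gt0 _ w wr; first by rewrite ge_min lexx.
exists (fun t s x => p t s x + d z t s x) => [t s x|a b c].
  rewrite addrC addKr; apply: le_trans (dC z t s x) _.
  by rewrite mulrC -ler_pdivlMr // (le_trans zr) // ge_min lexx orbT.
have -> : tensor (fun t s x => p t s x + d z t s x) m a b c = tensor p m a b c +
    \sum_(t < m) derivative (p t) (fun s x => (W t s x *m z) 0 0) a b c + \sum_(t < m) Q z t a b c.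
  rewrite /tensor -!big_split; apply: eq_bigr => t _; rewrite /= /Q /derivative -!/(d _ _ _ _).
  ring.
have := congr1 (fun u : 'cV[R]_N => u (enum_rank (a, b, c)) 0) zE.
by rewrite /= !mxE enum_rankK WE => ->; ring.
Qed.
End Tangent.

(** * Boxes of tensors of constant nonnegative rank *)

Section Typical.
Local Open Scope ring_scope.
Variable R : realType.
Implicit Type p : nat -> nat -> nat -> R.

(** The point t = i n + j consists of e_i, e_j and e_k with k = i + j mod n. *)
Definition latin_points (n t s x : nat) : R :=
  match s with
  | 0 => (t %/ n == x)%N%:R
  | 1 => (t %% n == x)%N%:R
  | _ => ((t %/ n + t %% n) %% n == x)%N%:R
  end.

Lemma tensor_latin n (a b c : 'I_n) :
  tensor (latin_points n) (n ^ 2) a b c = ((a + b) %% n == c)%N%:R.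
Proof.
have n0 : (0 < n)%N by apply: leq_ltn_trans (ltn_ord a).
have tn : (a * n + b < n ^ 2)%N by have := ltn_ord a; have := ltn_ord b; rewrite expnS expn1; nia.
rewrite /tensor (bigD1 (Ordinal tn)) //= divnMDl // modnMDl divn_small // modn_small // addn0.
rewrite !eqxx !mul1r big1 ?addr0 // => t; rewrite -val_eqE /= => tab.
have [ta|] := eqVneq (t %/ n)%N a; last by rewrite !mul0r.
have [tb|] := eqVneq (t %% n)%N b; last by rewrite mulr0 mul0r.
by case/negP: tab; rewrite -ta -tb -divn_eq.
Qed.

Lemma term_near (d u v w u' v' w' : R) : d <= 1 -> `|u'| <= 1 -> `|v'| <= 1 -> `|w'| <= 1 ->
  `|u - u'| <= d -> `|v - v'| <= d -> `|w - w'| <= d ->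
  `|u * v * w - u' * v' * w'| <= 7 * d.
Proof.
move=> d1 u1 v1 w1 ud vd wd.
have bound (x x' : R) : `|x'| <= 1 -> `|x - x'| <= d -> `|x| <= 2.
  move=> x1 xd; rewrite -(subrK x' x); apply: le_trans (ler_normD _ _) _; lra.
have -> : u * v * w - u' * v' * w' =
  (u - u') * (v * w) + u' * (w * (v - v')) + u' * (v' * (w - w')) by ring.
have -> : 7 * d = d * (2 * 2) + 1 * (2 * d) + 1 * (1 * d) by ring.
have [v2 w2] := (bound v v' v1 vd, bound w w' w1 wd).
apply: le_trans (ler_normD _ _) _; apply: lerD; first apply: le_trans (ler_normD _ _) _; first apply: lerD.
- by rewrite !normrM; do 2?[apply: ler_pM => //]; rewrite mulr_ge0.
- by rewrite !normrM; do 2?[apply: ler_pM => //]; rewrite mulr_ge0.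
- by rewrite !normrM; do 2?[apply: ler_pM => //]; rewrite mulr_ge0.
Qed.

Definition close n m p q (d : R) := forall t s x, (t < m)%N -> (s < 3)%N -> (x < n)%N ->
  `|p t s x - q t s x| <= d.

Lemma tensor_near_latin n : (0 < n)%N -> exists2 d : R, 0 < d & forall p,
  close n (n ^ 2) p (latin_points n) d ->
  forall a b c : 'I_n, `|tensor p (n ^ 2) a b c - ((a + b) %% n == c)%N%:R| < (n ^ 2).+1%:R^-1.
Proof.
move=> n0; set e := _^-1; have e0 : 0 < e by rewrite invr_gt0 ltr0Sn.
(* Each term moves by at most 7 d, as (1 + d)^3 - 1 <= 7 d for 0 <= d <= 1; the factor 8 makes the
   final inequality strict. *)
pose d := Num.min 1 (e / (8 * (n ^ 2)%:R)).
have n20 : 0 < (n ^ 2)%:R :> R by rewrite ltr0n expn_gt0 n0.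
have d0 : 0 < d by rewrite lt_min ltr01 divr_gt0 // mulr_gt0.
exists d => // p pd a b c; rewrite -tensor_latin /tensor -sumrB.
apply: le_lt_trans (ler_norm_sum _ _ _) _.
apply: (@le_lt_trans _ _ (\sum_(t < n ^ 2) 7 * d)).
  apply: ler_sum => t _; apply: term_near; rewrite ?ge_min ?lexx ?pd //;
    by rewrite /= normr_nat lern1 leq_b1.
rewrite sumr_const card_ord -[X in X < _]mulr_natl.
have : d * (8 * (n ^ 2)%:R) <= e by rewrite -ler_pdivlMr ?mulr_gt0 // ge_min lexx orbT.
have := mulr_gt0 d0 n20; lra.
Qed.

Lemma tensor_split p q m k a b c : tensor (fun t => if (t < m)%N then p t else q t) (m + k) a b c =
  tensor p m a b c + tensor (fun t => q (m + t)%N) k a b c.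
Proof.
rewrite /tensor big_split_ord /=; congr (_ + _); apply: eq_bigr => t _; first by rewrite ltn_ord.
by rewrite ltnNge leq_addr.
Qed.

Lemma decomposes_tensor n m p : (forall t s x, (t < m)%N -> (s < 3)%N -> (x < n)%N -> 0 <= p t s x) ->
  decomposes (fun a b c : 'I_n => tensor p m a b c) m.
Proof.
by move=> p0; exists (fun t i => p t 0%N i), (fun t i => p t 1%N i), (fun t i => p t 2%N i);
  split=> // t i; exact: p0.
Qed.

Lemma typical_of_determinable n q m : (0 < n)%N -> determinable R n q -> (q <= m <= n ^ 2)%N ->
  nonneg_typical_rank R n m.
Proof.
move=> n0 [pq det_q] /andP[qm mn].
have [d d0 latin_d] := tensor_near_latin n0.
(* After the shift by d/2, two further moves by at most d/6 keep all coordinates positive and within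
   5d/6 of the Latin points. *)
pose p1 t s x := latin_points n t s x + d / 2.
have gen : generic (fun _ => True) (determined (A := R) n (iota 0 m) (fun _ _ _ => true)).
  apply: (@generic_determined _ _ _ _ _ _ pq) => // T T0 kT; apply: det_q => // t.
  by rewrite mem_iota => /= tq; apply: kT; rewrite mem_iota /= (leq_trans tq).
have all_closed : line_closed (F := R) (P := nat) (fun _ => True) by [].
have [ps _ near_p1] := generic_near (p := p1) all_closed gen I.
pose S := 1 + \sum_(t < n ^ 2) \sum_(s < 3) \sum_(x < n) `|ps t s x - p1 t s x|.
have S0 : 0 < S.
  by rewrite ltr_wpDr // !sumr_ge0 // => ? _; rewrite sumr_ge0 // => ? _; rewrite sumr_ge0.
have [a [a0 aS det]] := near_p1 (d / 6 / S) (divr_gt0 (divr_gt0 d0 (ltr0Sn _ _)) S0).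
set p2 := segment p1 ps a in det.
have p21 : close n (n ^ 2) p2 p1 (d / 6).
  move=> t s x tn s3 xn; rewrite /p2 /segment addrC addKr normrM (gtr0_norm a0).
  apply: le_trans (_ : a * S <= _); last by rewrite -ler_pdivlMr // ltW.
  have le_sum (I : finType) (f : I -> R) i : (forall i, 0 <= f i) -> f i <= \sum_i f i.
    by move=> f0; rewrite (bigD1 i) //= lerDl sumr_ge0.
  apply: ler_wpM2l; first exact: ltW.
  rewrite /S -[X in X <= _]add0r; apply: lerD => //.
  pose f (t : 'I_(n ^ 2)) (s : 'I_3) (x : 'I_n) := `|ps t s x - p1 t s x|.
  have f0 t1 s1 x1 : 0 <= f t1 s1 x1 by exact: normr_ge0.
  apply: (le_trans (le_sum _ (f (Ordinal tn) (Ordinal s3)) (Ordinal xn) _)); first exact: f0.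
  apply: (le_trans (le_sum _ (fun s => \sum_x f (Ordinal tn) s x) (Ordinal s3) _)).
    by move=> s1; apply: sumr_ge0 => x1 _.
  apply: (le_sum _ (fun t => \sum_s \sum_x f t s x)) => t1.
  by apply: sumr_ge0 => s1 _; apply: sumr_ge0 => x1 _.
have [eta eta0 open_p2] := tensor_open (divr_gt0 d0 (ltr0Sn _ 5)) det.
apply/typicalP; exists (hyper_of (fun a b c => tensor p2 m a b c)), eta => // B nearB.
have [p3 p32 BE] : exists2 p3 : nat -> nat -> nat -> R,
    forall (t : 'I_m) (s : 'I_3) (x : 'I_n), `|p3 t s x - p2 t s x| <= d / 6 &
    forall i j k, B 0 i j k = tensor p3 m i j k.
  by apply: open_p2 => i j k; have := nearB i j k; rewrite hyper_ofE => /ltW.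
(* Only the first [m] points follow [B]; the others stay at [p2] and complete [B] to a tensor near
   the Latin square. *)
pose p4 t := if (t < m)%N then p3 t else p2 t.
have p42 : close n (n ^ 2) p4 p2 (d / 6).
  move=> t s x tn s3 xn; rewrite /p4; case: ifP => [tm|_]; last by rewrite subrr normr0 divr_ge0 // ltW.
  exact: (p32 (Ordinal tm) (Ordinal s3) (Ordinal xn)).
have latin0 t s x : 0 <= latin_points n t s x by case: s => [|[|s]]; exact: ler0n.
have p2_ge0 t s x : (t < n ^ 2)%N -> (s < 3)%N -> (x < n)%N -> 0 <= p2 t s x.
  move=> tn s3 xn; have := p21 t s x tn s3 xn; have := latin0 t s x.
  by rewrite /p1 ler_norml => l0 /andP[]; lra.
have p4_ge0 t s x : (t < n ^ 2)%N -> (s < 3)%N -> (x < n)%N -> 0 <= p4 t s x.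
  move=> tn s3 xn; have := p21 t s x tn s3 xn; have := p42 t s x tn s3 xn; have := latin0 t s x.
  by rewrite /p1 !ler_norml => l0 /andP[? ?] /andP[? ?]; lra.
have p3_ge0 t s x : (t < m)%N -> (s < 3)%N -> (x < n)%N -> 0 <= p3 t s x.
  by move=> tm s3 xn; have := p4_ge0 t s x (leq_trans tm mn) s3 xn; rewrite /p4 tm.
split; first by move=> i j k; rewrite BE sumr_ge0 // => t _; rewrite !mulr_ge0 ?p3_ge0.
split.
  apply/decomposableP; have := decomposes_tensor p3_ge0.
  by congr decomposes; do 3 (apply: funext => ?); rewrite BE.
move=> s /decomposableP decB.
pose k := (n ^ 2 - m)%N.
have dec_rest : decomposes (fun a b c : 'I_n => tensor (fun t => p2 (m + t)%N) k a b c) k.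
  by apply: decomposes_tensor => t s' x tk s3 xn; apply: p2_ge0 => //; rewrite -ltn_subRL.
have := near_latin_rank n0 _ (decomposes_add decB dec_rest).
have H i j l : B 0 i j l + tensor (fun t => p2 (m + t)%N) k i j l = tensor p4 (n ^ 2) i j l.
  by rewrite BE -tensor_split subnKC.
move=> le; suff : (n ^ 2 <= s + k)%N by rewrite /k; lia.
apply: le => i j l; rewrite H; apply: latin_d => t s' x tn s3 xn.
have := p21 t s' x tn s3 xn; have := p42 t s' x tn s3 xn.
by rewrite /p1 !ler_norml => /andP[? ?] /andP[? ?]; apply/andP; split; lra.
Qed.

Lemma typical_box n m : nonneg_typical_rank R n m -> exists a : 'I_n -> 'I_n -> 'I_n -> R,
  exists2 e : R, 0 < e & forall b : 'I_n -> 'I_n -> 'I_n -> R,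
    (forall i j k, `|b i j k - a i j k| < e) -> decomposes b m.
Proof.
move=> /typicalP[A [e e0 Ae]]; exists (fun i j k => A 0 i j k), e => // b ab.
have [|_ [/decomposableP dec _]] := Ae (hyper_of b).
  by move=> i j k; rewrite hyper_ofE.
by move: dec; congr decomposes; do 3 (apply: funext => ?); rewrite hyper_ofE.
Qed.

Lemma typical_expected n m : nonneg_typical_rank R n m -> (n ^ 3 <= m * (3 * n - 2))%N.
Proof.
move=> /typical_box[a [e e0 dec]]; rewrite leqNgt; apply/negP => mn.
exact: box_not_decomposable mn e0 dec.
Qed.

Lemma typical_le_sqr n m : nonneg_typical_rank R n m -> (m <= n ^ 2)%N.
Proof.
move=> /typicalP[A [e e0 Ae]]; have [|A0 [_ minA]] := Ae A.
  by move=> i j k; rewrite subrr normr0.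
by apply/minA/decomposableP/decomposes_sqr.
Qed.
End Typical.


Local Open Scope ring_scope.

Theorem proposition6p5 (R : realType) :
  [/\ (forall m : nat, nonneg_typical_rank R 2 m <-> (2 <= m <= 4)%N),
      (forall m : nat, nonneg_typical_rank R 3 m <-> (5 <= m <= 9)%N)
    & (forall n : nat, (4 <= n)%N -> forall m : nat,
        nonneg_typical_rank R n m <->
        Num.ceil ((n%:R ^+ 3 : R) / (3 * n%:R - 2)) <= m%:Z
        /\ (m <= n ^ 2)%N)].
Proof.
split=> [m|m|n n4 m].
- split=> [typ|]; last exact: typical_of_determinable (determinable2 R).
  by rewrite (typical_le_sqr typ) andbT; have := typical_expected typ; lia.
- split=> [typ|]; last exact: typical_of_determinable (determinable3 R).
  rewrite (typical_le_sqr typ) andbT ltn_neqAle.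
  have -> : (4 <= m)%N by have := typical_expected typ; lia.
  rewrite andbT; apply/eqP => m4; rewrite -m4 in typ.
  by have [a [e e0 dec]] := typical_box typ; exact: box3_not_decomposable e0 dec.
have ceilE : (Num.ceil ((n%:R ^+ 3 : R) / (3 * n%:R - 2)) <= m%:Z) = (n ^ 3 <= m * (3 * n - 2))%N.
  have -> : 3 * n%:R - 2 = (3 * n - 2)%:R :> R by rewrite natrB ?natrM //; lia.
  rewrite Num.Theory.ceil_le_int ler_pdivrMr ?ltr0n; last by lia.
  by rewrite -natrX -pmulrn -natrM ler_nat.
rewrite ceilE; split=> [typ|[mn m2]].
  by split; [exact: typical_expected typ|exact: typical_le_sqr typ].
have [q det_q q_lt] := determinable_expected R n4.
apply: typical_of_determinable det_q _; first by apply: leq_trans n4.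
rewrite m2 andbT -ltnS; have : (q.-1 * (3 * n - 2) < m * (3 * n - 2))%N by apply: leq_trans q_lt mn.
rewrite ltn_pmul2r; last by lia.
by case: (q).
Qed.
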